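(* Let $H_0$ be a semisimple Hopf algebra, let $\mathfrak{B}(V)$ be a finite-dimensional Nichols algebra in the category of (left-left) Yetter–Drinfeld modules over $H_0$, and let $H=\mathfrak{B}(V)\# H_0$. Let $A$ be a Loewy-graded, AM-exact $H$-comodule algebra, and let $A(0)\simeq_{H_0}X$ be an $H_0$-equivariant Morita equivalence, where $X$ is an $H_0$-comodule algebra. Then there exists a Loewy-graded, AM-exact $H$-comodule algebra $B$ such that $A\simeq_H B$ ($H$-equivariant Morita equivalence) and $B(0)\cong X$ as $H_0$-comodule algebras.
   Context: Throughout, $\Bbbk$ is an algebraically closed field of characteristic zero; Hopf algebras, modules, comodules and comodule algebras are finite-dimensional over $\Bbbk$. For an algebra $A$, ${}_A\mathcal{M}$ is the category of finite-dimensional left $A$-modules. $H=\mathfrak{B}(V)\#H_0$ is the bosonization, graded by $H(n)=\mathfrak{B}^n(V)\#H_0$; it is coradically graded: its coradical filtration is $H_n=\bigoplus_{i=0}^nH(i)$, with coradical $H(0)=1\#H_0\cong H_0$. $H$-comodule algebra: an algebra $A$ with a left coaction $\lambda:A\to H\otimes A$, $\lambda(a)=a_{(-1)}\otimes a_{(0)}$, that is an algebra morphism. $A$ has trivial coinvariants if $A^{\mathrm{co}H}=\{a:\lambda(a)=1\otimes a\}$ is one-dimensional. $A$ is right $H$-simple if it has no right ideals $J$ with $\lambda(J)\subseteq H\otimes J$ other than $0$ and $A$. $A$ is AM-exact if it is right $H$-simple with trivial coinvariants. The same terminology is used with $H_0$ in place of $H$. Loewy-graded: an $H$-comodule algebra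 $A$ with an algebra grading $A=\bigoplus_{n\ge0}A(n)$ such that $\lambda^{-1}(H_n\otimes A)=\bigoplus_{i=0}^nA(i)$ and $\lambda(A(n))\subseteq\bigoplus_{i=0}^nH(i)\otimes A(n-i)$ for all $n$. Then $A(0)$ is an $H_0$-comodule algebra. Morita equivalence: for an $H$-comodule algebra $A$, ${}_A\mathcal{M}$ is a left module category over the tensor category ${}_H\mathcal{M}$: for $Y\in{}_H\mathcal{M}$, $M\in{}_A\mathcal{M}$, the object $Y\otimes_\Bbbk M$ has action $a\cdot(y\otimes m)=a_{(-1)}y\otimes a_{(0)}m$. Two $H$-comodule algebras $A,B$ are $H$-equivariant Morita equivalent, $A\simeq_HB$, if ${}_A\mathcal{M}$ and ${}_B\mathcal{M}$ are equivalent as ${}_H\mathcal{M}$-module categories; $\simeq_{H_0}$ is defined in the same way for $H_0$-comodule algebras.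
   Formalization: The formal theorem additionally assumes that X is AM-exact; this is necessary, since for A = k and X = M_2(k) with trivial coaction (H = H_0) no AM-exact B with B(0) ≅ X exists, and the conclusion always forces X to be AM-exact. *)

(* Defs.v *)
From HB Require Import structures.
From mathcomp Require Import all_boot all_order all_algebra all_field.

Set Implicit Arguments.
Unset Strict Implicit.
Unset Printing Implicit Defensive.

Import GRing.Theory VectorInternalTheory.
Local Open Scope ring_scope.

Reserved Notation "u \ot v" (at level 38, left associativity,
  format "u  \ot  v").
Reserved Notation "\swd_ ( x \ot y <- t ) E" (at level 41, right associativity,
  x name, y name, t at level 200, E at level 41,
  format "\swd_ ( x  \ot  y  <-  t )  E").

(** * Tensor products of finite-dimensional vector spaces

    The tensor product of [U] and [V] is modelled by matrices indexed by the
    canonical bases of [U] and [V] (those given by [r2v]); the pure tensor of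
    [u] and [v] is the rank one matrix of products of coordinates.  The
    universal property is [tlift]: the Sweedler-style notation
    [\swd_(x \ot y <- t) E x y] is the value at [t] of the linear map sending
    [x \ot y] to [E x y], for [E] bilinear. *)

Section Tensor.
Variable K : fieldType.

Definition tens (U V : vectType K) : Type := 'M[K]_(dim U, dim V).
HB.instance Definition _ (U V : vectType K) :=
  Vector.copy (tens U V) 'M[K]_(dim U, dim V).

Definition pure (U V : vectType K) (u : U) (v : V) : tens U V :=
  (v2r u)^T *m v2r v.

Definition bvec (U : vectType K) (i : 'I_(dim U)) : U := r2v (delta_mx 0 i).

Definition tlift (U V W : vectType K) (b : U -> V -> W) (t : tens U V) : W :=
  \sum_i \sum_j (t : 'M_(_, _)) i j *: b (bvec i) (bvec j).

End Tensor.

Notation "u \ot v" := (pure u v) : ring_scope.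
Notation "\swd_ ( x \ot y <- t ) E" := (tlift (fun x y => E) t) : ring_scope.

Section TensorTheory.
Variable K : fieldType.
Implicit Types U V W : vectType K.

Definition bilin U V W (b : U -> V -> W) : Prop :=
  (forall u, linear (b u)) /\ (forall v, linear (b^~ v)).

Fact pure_linear_r U V (u : U) : linear (@pure K U V u).
Proof. by move=> a v w; rewrite /pure linearP mulmxDr -scalemxAr. Qed.
HB.instance Definition _ U V (u : U) :=
  GRing.isLinear.Build K V (tens U V) _ (pure u) (pure_linear_r u).

Fact pure_linear_l U V (v : V) : linear ((@pure K U V)^~ v).
Proof. by move=> a u w; rewrite /pure !linearP mulmxDl -scalemxAl. Qed.

Lemma pure_bilin U V : bilin (@pure K U V).
Proof. by split=> ?; [apply: pure_linear_r | apply: pure_linear_l]. Qed.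

Fact tlift_linear U V W (b : U -> V -> W) : linear (tlift b).
Proof.
move=> a s t; rewrite /tlift scaler_sumr -big_split; apply: eq_bigr => i _ /=.
rewrite scaler_sumr -big_split; apply: eq_bigr => j _ /=.
by rewrite !mxE scalerDl scalerA.
Qed.
HB.instance Definition _ U V W (b : U -> V -> W) :=
  GRing.isLinear.Build K (tens U V) W _ (tlift b) (tlift_linear b).

Lemma vec_bvec U (u : U) : u = \sum_i (v2r u) 0 i *: bvec i.
Proof.
rewrite -{1}[u]v2rK {1}[v2r u]row_sum_delta linear_sum.
by apply: eq_bigr => i _; rewrite linearZ.
Qed.

Lemma tliftE U V W (b : U -> V -> W) u v :
  bilin b -> tlift b (u \ot v) = b u v.
Proof.
case=> br bl.
pose br' x : {linear V -> W} := HB.pack (b x) (GRing.isLinear.Build _ _ _ _ _ (br x)).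
pose bl' y : {linear U -> W} := HB.pack (b^~ y) (GRing.isLinear.Build _ _ _ _ _ (bl y)).
rewrite [in RHS](vec_bvec u) -[RHS]/(bl' v _) linear_sum; apply: eq_bigr => i _.
rewrite linearZ /= [in RHS](vec_bvec v) -[X in _ *: X]/(br' _ _) linear_sum.
rewrite scaler_sumr; apply: eq_bigr => j _.
by rewrite linearZ /= scalerA /pure mxE big_ord1 !mxE.
Qed.

Lemma tens_sum U V (t : tens U V) :
  t = \sum_i \sum_j (t : 'M_(_, _)) i j *: (bvec i \ot bvec j).
Proof.
rewrite [LHS](matrix_sum_delta (t : 'M_(_, _))).
apply: eq_bigr => i _; apply: eq_bigr => j _; congr (_ *: _).
by rewrite /pure /bvec !r2vK trmx_delta mul_delta_mx.
Qed.

Lemma tens_ind U V (P : tens U V -> Prop) :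
  (forall u v, P (u \ot v)) -> (forall s t, P s -> P t -> P (s + t)) ->
  forall t, P t.
Proof.
move=> Ppure PD t; have P0 : P 0 by rewrite -(linear0 (pure (0 : U))); apply: Ppure.
rewrite [t]tens_sum; elim/big_ind: _ => // i _; elim/big_ind: _ => // j _.
by rewrite -linearZ; apply: Ppure.
Qed.

Lemma eq_tlift U V W (b b' : U -> V -> W) t :
  (forall u v, b u v = b' u v) -> tlift b t = tlift b' t.
Proof.
by move=> eb; apply: eq_bigr => i _; apply: eq_bigr => j _; rewrite eb.
Qed.

Lemma linear_tlift U V W W' (f : {linear W -> W'}) (b : U -> V -> W) t :
  f (\swd_(x \ot y <- t) b x y) = \swd_(x \ot y <- t) f (b x y).
Proof.
rewrite /tlift linear_sum; apply: eq_bigr => i _; rewrite linear_sum.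
by apply: eq_bigr => j _; rewrite linearZ.
Qed.

Lemma tliftD U V W (b b' : U -> V -> W) t :
  \swd_(x \ot y <- t) (b x y + b' x y) = tlift b t + tlift b' t.
Proof.
rewrite /tlift -big_split; apply: eq_bigr => i _ /=; rewrite -big_split.
by apply: eq_bigr => j _; rewrite scalerDr.
Qed.

Lemma tliftZ U V W a (b : U -> V -> W) t :
  \swd_(x \ot y <- t) (a *: b x y) = a *: tlift b t.
Proof.
rewrite /tlift scaler_sumr; apply: eq_bigr => i _; rewrite scaler_sumr.
by apply: eq_bigr => j _; rewrite !scalerA mulrC.
Qed.

Lemma tlift_pure U V (t : tens U V) : \swd_(x \ot y <- t) (x \ot y) = t.
Proof. by rewrite [RHS]tens_sum. Qed.

Definition tmap U V U' V' (f : U -> U') (g : V -> V') (t : tens U V) :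
  tens U' V' := \swd_(x \ot y <- t) (f x \ot g y).
HB.instance Definition _ U V U' V' (f : U -> U') (g : V -> V') :=
  GRing.Linear.copy (tmap f g) (tlift (fun x y => f x \ot g y)).

Definition tassoc U V W (t : tens (tens U V) W) : tens U (tens V W) :=
  \swd_(s \ot w <- t) \swd_(u \ot v <- s) (u \ot (v \ot w)).

Definition tunit V : tens K^o V -> V := tlift (fun (x : K^o) v => (x : K) *: v).
HB.instance Definition _ V :=
  GRing.Linear.copy (@tunit V) (tlift (fun (x : K^o) v => (x : K) *: v)).

Definition tensv U V (U1 : {vspace U}) (V1 : {vspace V}) : {vspace tens U V} :=
  <<[seq u \ot v | u <- vbasis U1, v <- vbasis V1]>>%VS.

Lemma tlift_lin U V W W' (t : tens U V) (f : U -> V -> W -> W') :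
  (forall x y, linear (f x y)) ->
  linear (fun w => \swd_(x \ot y <- t) f x y w).
Proof.
move=> fl a w w'; rewrite -tliftZ -tliftD.
by apply: eq_tlift => x y; rewrite fl.
Qed.

Lemma tlift_comp_lin U V W W' (g : {linear W -> tens U V}) (b : U -> V -> W') :
  linear (fun w => tlift b (g w)).
Proof. by move=> a w w'; rewrite !linearP. Qed.

Lemma tmapE U V U' V' (f : {linear U -> U'}) (g : {linear V -> V'}) u v :
  tmap f g (u \ot v) = f u \ot g v.
Proof.
rewrite /tmap tliftE //; split=> [x|y] a z z'; first by rewrite !linearP.
by rewrite linearP pure_linear_l.
Qed.

End TensorTheory.

Section TensorTheory2.
Variable K : fieldType.
Implicit Types U V W : vectType K.

Lemma tmap_lin U V U' V' (f : U -> U') (g : V -> V') u v :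
  linear f -> linear g -> tmap f g (u \ot v) = f u \ot g v.
Proof.
move=> fl gl; rewrite /tmap tliftE //; split=> [x|y] a z z'.
  by rewrite gl linearP.
by rewrite fl pure_linear_l.
Qed.

Lemma tassoc_is_linear U V W : linear (@tassoc K U V W).
Proof. exact: linearP. Qed.
HB.instance Definition _ U V W :=
  GRing.isLinear.Build K _ _ _ (@tassoc K U V W) (@tassoc_is_linear U V W).

Lemma pureDl U V (u u' : U) (v : V) : (u + u') \ot v = u \ot v + u' \ot v.
Proof. by have := pure_linear_l v 1 u u'; rewrite !scale1r. Qed.

Lemma pureZl U V a (u : U) (v : V) : (a *: u) \ot v = a *: (u \ot v).
Proof.
pose f : {linear U -> tens U V} :=
  HB.pack ((@pure K U V)^~ v) (GRing.isLinear.Build _ _ _ _ _ (pure_linear_l v)).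
exact: (linearZ_LR f).
Qed.

Lemma pure_tlift_l U V W (b : U -> V -> W) t W' (w : W') :
  tlift b t \ot w = \swd_(x \ot y <- t) (b x y \ot w).
Proof.
pose f : {linear W -> tens W W'} :=
  HB.pack ((@pure K W W')^~ w) (GRing.isLinear.Build _ _ _ _ _ (pure_linear_l w)).
exact: (linear_tlift f).
Qed.

Lemma tassocE U V W (u : U) (v : V) (w : W) :
  tassoc (u \ot v \ot w) = u \ot (v \ot w).
Proof.
rewrite /tassoc tliftE; last first.
  split=> [s|w'] a z z'; last by rewrite linearP.
  rewrite -tliftZ -tliftD; apply: eq_tlift => x y.
  by rewrite !linearP.
rewrite tliftE //; split=> [x|y] a z z'; last by rewrite pure_linear_l.
by rewrite pure_linear_l linearP.
Qed.

Lemma tlift_tmap U V U' V' W (b : U' -> V' -> W) (f : U -> U') (g : V -> V') t :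
  bilin b -> tlift b (tmap f g t) = \swd_(x \ot y <- t) b (f x) (g y).
Proof.
by move=> bb; rewrite [LHS]linear_tlift; apply: eq_tlift => x y /=; rewrite tliftE.
Qed.

Lemma tmap_comp U V U' V' U2 V2 (f' : U' -> U2) (g' : V' -> V2)
    (f : U -> U') (g : V -> V') t :
  linear f' -> linear g' ->
  tmap f' g' (tmap f g t) = tmap (f' \o f) (g' \o g) t.
Proof.
move=> fl gl; rewrite {1}/tmap tlift_tmap //.
split=> [x|y] a z z'; first by rewrite gl linearP.
by rewrite fl pure_linear_l.
Qed.

Lemma tmap_id U V (t : tens U V) : tmap id id t = t.
Proof. exact: tlift_pure. Qed.

Lemma eq_tmap U V U' V' (f f' : U -> U') (g g' : V -> V') t :
  f =1 f' -> g =1 g' -> tmap f g t = tmap f' g' t.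
Proof. by move=> ef eg; apply: eq_tlift => x y; rewrite ef eg. Qed.

Lemma tmap_can U V U' V' (f : U -> U') (g : V -> V') (f' : U' -> U)
    (g' : V' -> V) :
  linear f' -> linear g' -> cancel f f' -> cancel g g' ->
  cancel (tmap f g) (tmap f' g').
Proof.
by move=> fl gl fK gK t; rewrite tmap_comp // -[RHS]tmap_id; apply: eq_tmap.
Qed.

Lemma tensv_eq U V W (f g : {linear tens U V -> W}) (U1 : {vspace U})
    (V1 : {vspace V}) :
  {in U1 & V1, forall u v, f (u \ot v) = g (u \ot v)} ->
  {in tensv U1 V1, f =1 g}.
Proof.
move=> efg t; pose X := [seq u \ot v | u <- vbasis U1, v <- vbasis V1].
rewrite -[tensv _ _]/<<in_tuple X>>%VS => /coord_span ->.
rewrite !linear_sum; apply: eq_bigr => i _.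
rewrite !linearZ /=; congr (_ *: _).
have /allpairsP[[u v] /= [uU vV ->]] : X`_i \in X by apply: mem_nth.
by apply: efg; apply: vbasis_mem.
Qed.

End TensorTheory2.

(** * Hopf algebras and comodule algebras *)

Record hopfAlg (K : fieldType) := HopfAlg {
  hopf_alg :> falgType K;
  comul : {linear hopf_alg -> tens hopf_alg hopf_alg};
  counit : {scalar hopf_alg};
  antipode : {linear hopf_alg -> hopf_alg};
  comulA : forall h, tassoc (tmap comul id (comul h)) = tmap id comul (comul h);
  counitl : forall h, \swd_(x \ot y <- comul h) (counit x *: y) = h;
  counitr : forall h, \swd_(x \ot y <- comul h) (counit y *: x) = h;
  comul1 : comul 1 = 1 \ot 1;
  comulM : forall g h, comul (g * h) =
    \swd_(x \ot y <- comul g) \swd_(z \ot w <- comul h) ((x * z) \ot (y * w));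
  counit1 : counit 1 = 1;
  counitM : forall g h, counit (g * h) = counit g * counit h;
  antipodel : forall h, \swd_(x \ot y <- comul h) (antipode x * y) = (counit h)%:A;
  antipoder : forall h, \swd_(x \ot y <- comul h) (x * antipode y) = (counit h)%:A
}.

Arguments comul {K h0}.
Arguments counit {K h0}.
Arguments antipode {K h0}.

Record is_coaction (K : fieldType) (H : hopfAlg K) (M : vectType K)
    (coact : M -> tens H M) : Prop := IsCoaction {
  coactA : forall m,
    tassoc (tmap (@comul K H) id (coact m)) = tmap id coact (coact m);
  coact_counit : forall m, \swd_(h \ot x <- coact m) (counit h *: x) = m
}.

Record comodAlg (K : fieldType) (H : hopfAlg K) := ComodAlg {
  ca_alg :> falgType K;
  coact : {linear ca_alg -> tens H ca_alg};
  coactP : is_coaction coact;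
  coact1 : coact 1 = 1 \ot 1;
  coactM : forall a b, coact (a * b) =
    \swd_(h \ot x <- coact a) \swd_(k \ot y <- coact b) ((h * k) \ot (x * y))
}.

Arguments coact {K H c}.

Definition regular_comodAlg (K : fieldType) (H : hopfAlg K) : comodAlg H :=
  @ComodAlg K H H (@comul K H) (IsCoaction (@comulA K H) (@counitl K H))
    (@comul1 K H) (@comulM K H).

Definition comodAlg_isom (K : fieldType) (H : hopfAlg K) (A B : comodAlg H) :=
  exists f : 'AHom(A, B), bijective f /\
    forall a, coact (f a) = tmap id f (coact a).

Section AMExact.
Variables (K : fieldType) (H : hopfAlg K) (A : comodAlg H).

Definition coinvariants : {vspace A} :=
  lker (linfun (fun a : A => coact a - 1 \ot a)).

Lemma coinvariantsP a : reflect (coact a = 1 \ot a) (a \in coinvariants).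
Proof.
have l : linear (fun a : A => coact a - (1 : H) \ot a).
  by move=> c x y; rewrite !linearP scalerDr addrACA.
pose f : {linear A -> tens H A} := HB.pack (fun a : A => coact a - (1 : H) \ot a)
  (GRing.isLinear.Build _ _ _ _ _ l).
by rewrite memv_ker (lfunE f) /= subr_eq0; apply: eqP.
Qed.

Definition trivial_coinvariants : Prop := \dim coinvariants = 1%N.

Definition right_Hsimple : Prop := forall J : {vspace A},
  (forall x a, x \in J -> x * a \in J) ->
  (forall x, x \in J -> coact x \in tensv fullv J) ->
  J = 0%VS \/ J = fullv.

Definition AM_exact : Prop := right_Hsimple /\ trivial_coinvariants.

End AMExact.

(** Every left ideal has a complementary left ideal. *)
Definition semisimple_alg (K : fieldType) (A : falgType K) : Prop :=
  forall I : {vspace A}, (forall a x, x \in I -> a * x \in I) ->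
  exists J : {vspace A}, [/\ forall a x, x \in J -> a * x \in J,
    (I :&: J = 0)%VS & (I + J = fullv)%VS].

(** * Modules *)

Record is_action (K : fieldType) (A : falgType K) (M : vectType K)
    (act : A -> M -> M) : Prop := IsAction {
  act_bilin : bilin act;
  act1 : forall m, act 1 m = m;
  actM : forall a b m, act (a * b) m = act a (act b m)
}.

Record lmod (K : fieldType) (A : falgType K) := Lmod {
  lmod_space :> vectType K;
  lact : A -> lmod_space -> lmod_space;
  lactP : is_action lact
}.

Record lmod_hom (K : fieldType) (A : falgType K) (M N : lmod A) := LmodHom {
  hom_fun :> 'Hom(M, N);
  homP : forall a m, hom_fun (lact a m) = lact a (hom_fun m)
}.

Section Modules.
Variables (K : fieldType) (A : falgType K).

Fact lact_linear (M : lmod A) (a : A) : linear (@lact K A M a).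
Proof. by case: (act_bilin (lactP M)). Qed.
HB.instance Definition _ (M : lmod A) (a : A) :=
  GRing.isLinear.Build K M M _ (lact a) (@lact_linear M a).

Fact lact_linear_l (M : lmod A) (m : M) : linear (fun a : A => lact a m).
Proof. by case: (act_bilin (lactP M)). Qed.

Fact hom_id_subproof (M : lmod A) a (m : M) :
  (\1%VF : 'End(M)) (lact a m) = lact a ((\1%VF : 'End(M)) m).
Proof. by rewrite !id_lfunE. Qed.
Definition hom_id (M : lmod A) : lmod_hom M M := LmodHom (@hom_id_subproof M).

Fact hom_comp_subproof (M N P : lmod A) (g : lmod_hom N P) (f : lmod_hom M N) a m :
  (g \o f)%VF (lact a m) = lact a ((g \o f)%VF m).
Proof. by rewrite !comp_lfunE /= !homP. Qed.
Definition hom_comp (M N P : lmod A) (g : lmod_hom N P) (f : lmod_hom M N) :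
  lmod_hom M P := LmodHom (hom_comp_subproof g f).

End Modules.

Record lin_functor (K : fieldType) (A B : falgType K) := LinFunctor {
  fobj :> lmod A -> lmod B;
  fhom : forall M N : lmod A, lmod_hom M N -> lmod_hom (fobj M) (fobj N);
  fhom_id : forall M : lmod A, fhom (hom_id M) =1 id;
  fhom_comp : forall (M N P : lmod A) (g : lmod_hom N P) (f : lmod_hom M N),
    fhom (hom_comp g f) =1 fhom g \o fhom f;
  fhom_linear : forall (M N : lmod A) (c : K) (f g h : lmod_hom M N),
    (forall m, h m = c *: f m + g m) ->
    forall m, fhom h m = c *: fhom f m + fhom g m
}.

Definition is_equivalence (K : fieldType) (A B : falgType K)
    (F : lin_functor A B) : Prop :=
  [/\ forall (M N : lmod A) (g : lmod_hom (F M) (F N)),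
        exists f : lmod_hom M N, fhom F f =1 g,
      forall (M N : lmod A) (f g : lmod_hom M N),
        fhom F f =1 fhom F g -> f =1 g
    & forall N : lmod B, exists M : lmod A, exists i : lmod_hom (F M) N,
        bijective i].

(** * The module category of a comodule algebra

    [lmod A] is a module category over [lmod H]: [a] acts on [y \ot m] by
    [a_(-1) y \ot a_(0) m].  A module functor is a linear functor [F] with a
    natural isomorphism from [F (Y (x) M)] to [Y (x) F M] that is compatible
    with the associativity and unit constraints. *)

Section ModuleCategory.
Variables (K : fieldType) (H : hopfAlg K).

Section Tmod.
Variables (A : comodAlg H) (Y : lmod H) (M : lmod A).

Definition tact (a : A) (t : tens Y M) : tens Y M :=
  \swd_(h \ot x <- coact a) tmap (lact h) (lact x) t.

Lemma tact_linear a : linear (tact a).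
Proof. by apply: tlift_lin => h x c s t; rewrite linearP. Qed.
HB.instance Definition _ a :=
  GRing.isLinear.Build K _ _ _ (tact a) (tact_linear a).

Lemma tact_pure_bilin (y : Y) (m : M) :
  bilin (fun (h : H) (x : A) => lact h y \ot lact x m).
Proof.
by split=> z c s t; rewrite lact_linear_l ?linearP ?pure_linear_l.
Qed.

Lemma tactE a y m : tact a (y \ot m) =
  \swd_(h \ot x <- coact a) (lact h y \ot lact x m).
Proof. by apply: eq_tlift => h x; rewrite tmapE. Qed.

Fact tact_action : is_action tact.
Proof.
split.
- split=> [a|t] c s u; first by rewrite linearP.
  by rewrite /tact !linearP.
- elim/tens_ind=> [y m|s t IHs IHt]; last by rewrite linearD /= IHs IHt.
  by rewrite tactE coact1 tliftE ?(act1 (lactP _)) //; apply: tact_pure_bilin.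
move=> a b; elim/tens_ind=> [y m|s t IHs IHt]; last by rewrite !linearD /= IHs IHt.
rewrite !tactE coactM linear_tlift.
transitivity (\swd_(h \ot x <- coact a) \swd_(k \ot z <- coact b)
   (lact h (lact k y) \ot lact x (lact z m))).
  apply: eq_tlift => h x; rewrite linear_tlift; apply: eq_tlift => k z.
  by rewrite /= tliftE ?(actM (lactP _)) //; apply: tact_pure_bilin.
rewrite /tact; apply: eq_tlift => h x.
by rewrite linear_tlift; apply: eq_tlift => k z; rewrite /= tmapE.
Qed.

Definition tmod : lmod A := Lmod tact_action.

End Tmod.

Section TmodHom.
Variables (A : comodAlg H) (Y Y' : lmod H) (M M' : lmod A).
Variables (f : lmod_hom Y Y') (g : lmod_hom M M').

Fact tmod_hom_subproof a (t : tmod Y M) :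
  linfun (tmap f g : tmod Y M -> tmod Y' M') (lact a t) =
  lact a (linfun (tmap f g : tmod Y M -> tmod Y' M') t).
Proof.
rewrite !lfunE /=; elim/tens_ind: t => [y m|s t IHs IHt]; last first.
  by rewrite !linearD /= IHs IHt.
rewrite tactE linear_tlift /= tmapE tactE.
by apply: eq_tlift => h x; rewrite /= tmapE /= !homP.
Qed.
Definition tmod_hom : lmod_hom (tmod Y M) (tmod Y' M') :=
  LmodHom tmod_hom_subproof.

End TmodHom.

(** The tensor product of the category of [H]-modules is the case [A = H]. *)
Definition hmod_tens (Y Z : lmod H) : lmod H :=
  @tmod (regular_comodAlg H) Y Z.

Fact hmod_unit_action : is_action (fun (h : H) (x : K^o) => counit h *: x).
Proof.
split=> [|x|g h x]; last 2 first.
- by rewrite counit1 scale1r.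
- by rewrite counitM scalerA.
by split=> [h|x] c s t; rewrite ?linearP //= scalerDl scalerA.
Qed.
Definition hmod_unit : lmod H := Lmod hmod_unit_action.

Section Coherence.
Variable A : comodAlg H.

Fact tmod_assoc_subproof (Y Z : lmod H) (M : lmod A) a
    (t : tmod (hmod_tens Y Z) M) :
  linfun (@tassoc K Y Z M : tmod (hmod_tens Y Z) M -> tmod Y (tmod Z M))
    (lact a t) =
  lact a (linfun (@tassoc K Y Z M : _ -> tmod Y (tmod Z M)) t).
Proof.
rewrite !lfunE /=; elim/tens_ind: t => [s m|s t IHs IHt]; last first.
  by rewrite !linearD /= IHs IHt.
elim/tens_ind: s => [y z|s t IHs IHt]; last first.
  by rewrite !pureDl !linearD /= IHs IHt.
pose T2 h (s : tens H A) : tens Y (tens Z M) :=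
  \swd_(k \ot x <- s) (lact h y \ot (lact k z \ot lact x m)).
pose T := tlift T2.
have T2b h : bilin (fun (k : H) (x : A) => lact h y \ot (lact k z \ot lact x m)).
  by split=> u c v w; rewrite ?lact_linear_l ?linearP ?pure_linear_l ?linearP.
have Tb : bilin T2.
  split=> [h|s] c v w; first by rewrite /T2 linearP.
  rewrite /T2 -tliftZ -tliftD; apply: eq_tlift => k x.
  by rewrite lact_linear_l pure_linear_l.
transitivity (T (tassoc (tmap comul id (coact a)))); last first.
  rewrite (coactA (coactP A)) tassocE [RHS]tactE /T /tmap linear_tlift.
  apply: eq_tlift => h x /=; rewrite tliftE // /T2.
  by rewrite tactE [RHS]linear_tlift.
rewrite tactE /tmap ![tassoc (tlift _ _)]linear_tlift /T linear_tlift.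
apply: eq_tlift => h x /=; rewrite tactE.
change (@coact K H (regular_comodAlg H) h) with (comul h).
elim/tens_ind: (comul h) => [k l|s t IHs IHt]; last first.
  by rewrite linearD !pureDl !linearD /= IHs IHt.
rewrite tliftE; last exact: tact_pure_bilin.
by rewrite !tassocE tliftE // /T2 tliftE.
Qed.
Definition tmod_assoc (Y Z : lmod H) (M : lmod A) :
  lmod_hom (tmod (hmod_tens Y Z) M) (tmod Y (tmod Z M)) :=
  LmodHom (@tmod_assoc_subproof Y Z M).

Fact tmod_unit_subproof (M : lmod A) a (t : tmod hmod_unit M) :
  linfun (@tunit K M : tmod hmod_unit M -> M) (lact a t) =
  lact a (linfun (@tunit K M : tmod hmod_unit M -> M) t).
Proof.
rewrite !lfunE /=; elim/tens_ind: t => [c m|s t IHs IHt]; last first.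
  by rewrite !linearD /= IHs IHt.
have ub : bilin (fun (x : K^o) (v : M) => (x : K) *: v).
  by split=> [x|v] b s t; rewrite ?linearP //= scalerDl scalerA.
rewrite tactE linear_tlift [tunit _ in RHS]tliftE // linearZ /=.
rewrite -{2}(coact_counit (coactP A) a).
transitivity (c *: \swd_(h \ot x <- coact a) (counit h *: lact x m)).
  rewrite -tliftZ; apply: eq_tlift => h x /=; rewrite /tunit tliftE //=.
  by rewrite scalerA [in RHS]mulrC.
congr (_ *: _).
pose f : {linear A -> M} := HB.pack (fun a : A => lact a m)
  (GRing.isLinear.Build _ _ _ _ _ (lact_linear_l m)).
rewrite -[RHS]/(f _) linear_tlift.
by apply: eq_tlift => h x; rewrite linearZ.
Qed.
Definition tmod_unit (M : lmod A) : lmod_hom (tmod hmod_unit M) M :=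
  LmodHom (@tmod_unit_subproof M).

End Coherence.

Record mod_functor (A B : comodAlg H) := ModFunctor {
  mf_functor :> lin_functor A B;
  mf_str : forall (Y : lmod H) (M : lmod A),
    lmod_hom (mf_functor (tmod Y M)) (tmod Y (mf_functor M));
  mf_str_bij : forall Y M, bijective (mf_str Y M);
  mf_str_nat : forall (Y Y' : lmod H) (M M' : lmod A)
      (f : lmod_hom Y Y') (g : lmod_hom M M'),
    mf_str Y' M' \o fhom mf_functor (tmod_hom f g) =1
    tmod_hom f (fhom mf_functor g) \o mf_str Y M;
  mf_str_assoc : forall (Y Z : lmod H) (M : lmod A),
    tmod_assoc Y Z (mf_functor M) \o mf_str (hmod_tens Y Z) M =1
    tmod_hom (hom_id Y) (mf_str Z M) \o mf_str Y (tmod Z M)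
      \o fhom mf_functor (tmod_assoc Y Z M);
  mf_str_unit : forall M : lmod A,
    tmod_unit (mf_functor M) \o mf_str hmod_unit M =1
    fhom mf_functor (tmod_unit M)
}.

Definition equivariant_Morita (A B : comodAlg H) : Prop :=
  exists F : mod_functor A B, is_equivalence F.

End ModuleCategory.

(** * Yetter-Drinfeld modules and Nichols algebras *)

(** The compatibility condition is
    [delta (h . v) = h_1 v_(-1) S(h_3) (x) h_2 . v_(0)]. *)
Record is_yd (K : fieldType) (H : hopfAlg K) (V : vectType K)
    (act : H -> V -> V) (coa : V -> tens H V) : Prop := IsYD {
  yd_actP : is_action act;
  yd_coactP : is_coaction coa;
  yd_compat : forall h v, coa (act h v) =
    \swd_(h1 \ot h' <- comul h) \swd_(h2 \ot h3 <- comul h')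
      \swd_(x \ot w <- coa v) ((h1 * x * antipode h3) \ot act h2 w)
}.

Record ydmod (K : fieldType) (H : hopfAlg K) := Ydmod {
  yd_space :> vectType K;
  yd_act : H -> yd_space -> yd_space;
  yd_coact : {linear yd_space -> tens H yd_space};
  ydP : is_yd yd_act yd_coact
}.
Arguments yd_coact {K H y}.

(** Hopf algebras in the braided category of Yetter-Drinfeld modules: all the
    structure maps are morphisms of Yetter-Drinfeld modules, and the
    comultiplication is multiplicative for the product
    [(a (x) b)(c (x) d) = a (b_(-1) . c) (x) b_(0) d] of [R (x) R]. *)
Record braidedHopf (K : fieldType) (H : hopfAlg K) := BraidedHopf {
  bh_alg :> falgType K;
  bh_act : H -> bh_alg -> bh_alg;
  bh_coact : {linear bh_alg -> tens H bh_alg};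
  bh_ydP : is_yd bh_act bh_coact;
  bh_act1 : forall h, bh_act h 1 = (counit h)%:A;
  bh_actM : forall h r s, bh_act h (r * s) =
    \swd_(x \ot y <- comul h) (bh_act x r * bh_act y s);
  bh_coact1 : bh_coact 1 = 1 \ot 1;
  bh_coactM : forall r s, bh_coact (r * s) =
    \swd_(x \ot a <- bh_coact r) \swd_(y \ot b <- bh_coact s)
      ((x * y) \ot (a * b));
  bh_comul : {linear bh_alg -> tens bh_alg bh_alg};
  bh_counit : {scalar bh_alg};
  bh_antipode : {linear bh_alg -> bh_alg};
  bh_comulA : forall r,
    tassoc (tmap bh_comul id (bh_comul r)) = tmap id bh_comul (bh_comul r);
  bh_counitl : forall r, \swd_(a \ot b <- bh_comul r) (bh_counit a *: b) = r;
  bh_counitr : forall r, \swd_(a \ot b <- bh_comul r) (bh_counit b *: a) = r;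
  bh_comul_act : forall h r, bh_comul (bh_act h r) =
    \swd_(x \ot y <- comul h) tmap (bh_act x) (bh_act y) (bh_comul r);
  bh_comul_coact : forall r,
    \swd_(x \ot a <- bh_coact r) (x \ot bh_comul a) =
    \swd_(a \ot b <- bh_comul r) \swd_(x \ot a0 <- bh_coact a)
      \swd_(y \ot b0 <- bh_coact b) ((x * y) \ot (a0 \ot b0));
  bh_counit_act : forall h r, bh_counit (bh_act h r) = counit h * bh_counit r;
  bh_counit_coact : forall r,
    \swd_(x \ot a <- bh_coact r) (bh_counit a *: x) = (bh_counit r)%:A;
  bh_comul1 : bh_comul 1 = 1 \ot 1;
  bh_comulM : forall r s, bh_comul (r * s) =
    \swd_(a \ot b <- bh_comul r) \swd_(c \ot d <- bh_comul s)
      \swd_(x \ot b0 <- bh_coact b) ((a * bh_act x c) \ot (b0 * d));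
  bh_counit1 : bh_counit 1 = 1;
  bh_counitM : forall r s, bh_counit (r * s) = bh_counit r * bh_counit s;
  bh_antipode_act : forall h r,
    bh_antipode (bh_act h r) = bh_act h (bh_antipode r);
  bh_antipode_coact : forall r,
    bh_coact (bh_antipode r) = tmap id bh_antipode (bh_coact r);
  bh_antipodel : forall r,
    \swd_(a \ot b <- bh_comul r) (bh_antipode a * b) = (bh_counit r)%:A;
  bh_antipoder : forall r,
    \swd_(a \ot b <- bh_comul r) (a * bh_antipode b) = (bh_counit r)%:A
}.
Arguments bh_coact {K H b}.
Arguments bh_comul {K H b}.
Arguments bh_counit {K H b}.
Arguments bh_antipode {K H b}.

Record is_grading (K : fieldType) (A : falgType K) (gr : nat -> {vspace A}) :
    Prop := IsGrading {
  gr1 : 1 \in gr 0%N;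
  grM : forall m n a b, a \in gr m -> b \in gr n -> a * b \in gr (m + n)%N;
  gr_direct : forall n, directv (\sum_(i < n) gr i);
  gr_full : exists n, (\sum_(i < n) gr i)%VS = fullv
}.

(** A Nichols algebra of [V]: a graded Hopf algebra [R] in Yetter-Drinfeld
    modules with [R(0) = K], [R(1) = P(R)] isomorphic to [V], generated by
    [R(1)] as an algebra. *)
Record nicholsAlg (K : fieldType) (H : hopfAlg K) (V : ydmod H) := NicholsAlg {
  nich :> braidedHopf H;
  ngr : nat -> {vspace nich};
  ngrP : is_grading ngr;
  ngr_act : forall n h r, r \in ngr n -> bh_act h r \in ngr n;
  ngr_coact : forall n r, r \in ngr n -> bh_coact r \in tensv fullv (ngr n);
  ngr_comul : forall n r, r \in ngr n ->
    bh_comul r \in (\sum_(i < n.+1) tensv (ngr i) (ngr (n - i)%N))%VS;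
  ngr_counit : forall n r, r \in ngr n.+1 -> bh_counit r = 0;
  ngr_antipode : forall n r, r \in ngr n -> bh_antipode r \in ngr n;
  ngr0 : ngr 0%N = <[1]>%VS;
  ngr1_primitive : forall r,
    r \in ngr 1%N <-> bh_comul r = r \ot 1 + 1 \ot r;
  ngr_gen : agenv (ngr 1%N) = fullv;
  ngr1_iota : 'Hom(V, nich);
  ngr1_iso : injective ngr1_iota /\ limg ngr1_iota = ngr 1%N;
  ngr1_act : forall h v, ngr1_iota (yd_act h v) = bh_act h (ngr1_iota v);
  ngr1_coact : forall v,
    bh_coact (ngr1_iota v) = tmap id ngr1_iota (yd_coact v)
}.

(** * Bosonization

    A Hopf algebra [H] identified with [R # H0] by a linear isomorphism
    [bos_map] from [R (x) H0], under which the structure of [H] is that of the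
    smash product and smash coproduct:
    [(r # h)(s # k) = r (h_1 . s) # h_2 k] and
    [Delta (r # h) = r^1 # (r^2)_(-1) h_1 (x) (r^2)_(0) # h_2].
    The antipode of [H] is then determined. *)
Record bosonization (K : fieldType) (H0 H : hopfAlg K) (R : braidedHopf H0) :=
    Bosonization {
  bos_map : {linear tens R H0 -> H};
  bos_bij : bijective bos_map;
  bos1 : bos_map (1 \ot 1) = 1;
  bosM : forall r h s k, bos_map (r \ot h) * bos_map (s \ot k) =
    \swd_(h1 \ot h2 <- comul h) bos_map ((r * bh_act h1 s) \ot (h2 * k));
  bos_comul : forall r h, comul (bos_map (r \ot h)) =
    \swd_(r1 \ot r2 <- bh_comul r) \swd_(h1 \ot h2 <- comul h)
      \swd_(x \ot r20 <- bh_coact r2)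
        (bos_map (r1 \ot (x * h1)) \ot bos_map (r20 \ot h2));
  bos_counit : forall r h, counit (bos_map (r \ot h)) = bh_counit r * counit h
}.

Section LoewyGraded.
Variables (K : fieldType) (H0 H : hopfAlg K) (V : ydmod H0).
Variables (R : nicholsAlg V) (phi : bosonization H R).

Definition bos_gr (n : nat) : {vspace H} :=
  (linfun (bos_map phi) @: tensv (ngr R n) fullv)%VS.

(** [R # H0] is coradically graded for this grading: [bos_filt] is its
    coradical filtration when [H0] is cosemisimple, e.g. semisimple in
    characteristic zero. *)
Definition bos_filt (n : nat) : {vspace H} := (\sum_(i < n.+1) bos_gr i)%VS.

Definition bos_incl (h : H0) : H := bos_map phi (1 \ot h).

Record is_Loewy_graded (A : comodAlg H) (gr : nat -> {vspace A}) : Prop :=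
    IsLoewyGraded {
  lgr_grading : is_grading gr;
  lgr_filt : forall n a,
    coact a \in tensv (bos_filt n) fullv <-> a \in (\sum_(i < n.+1) gr i)%VS;
  lgr_coact : forall n a, a \in gr n ->
    coact a \in (\sum_(i < n.+1) tensv (bos_gr i) (gr (n - i)%N))%VS
}.

Section DegreeZero.
Variables (A : comodAlg H) (gr : nat -> {vspace A}) (LA : is_Loewy_graded gr).

Fact deg0_is_aspace : is_aspace (gr 0%N).
Proof.
have g := lgr_grading LA; rewrite /is_aspace has_algid1 ?(gr1 g) //=.
by apply/prodvP => a b; apply: (grM g).
Qed.
Definition deg0_aspace : {aspace A} := ASpace deg0_is_aspace.
Notation A0 := (subvs_of deg0_aspace).

Lemma bos_incl_linear : linear bos_incl.
Proof. by move=> c x y; rewrite /bos_incl !linearP. Qed.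
HB.instance Definition _ :=
  GRing.isLinear.Build K H0 H _ bos_incl bos_incl_linear.

(** The restriction of the coaction to [A(0)], with values in [H0 (x) A(0)]
    once [H(0) = 1 # H0] is identified with [H0]; see [deg0_coactE]. *)
Definition deg0_coact (u : A0) : tens H0 A0 :=
  tmap (linfun bos_incl)^-1%VF (vsproj deg0_aspace) (coact (vsval u)).


Lemma bos_incl1 : bos_incl 1 = 1.
Proof. exact: bos1. Qed.

Lemma bos_inclM h k : bos_incl (h * k) = bos_incl h * bos_incl k.
Proof.
rewrite /bos_incl bosM -{1}(counitl h).
transitivity (bos_map phi (1 \ot
    \swd_(x \ot y <- comul h) (counit x *: (y * k)))).
  congr (bos_map phi (1 \ot _)).
  pose f : {linear H0 -> H0} := k \o* (idfun : H0 -> H0).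
  rewrite -[LHS]/(f _) linear_tlift; apply: eq_tlift => x y.
  by rewrite linearZ.
rewrite !linear_tlift; apply: eq_tlift => x y.
by rewrite mul1r bh_act1 pureZl !linearZ.
Qed.

Lemma bos_incl_comul h : comul (bos_incl h) = tmap bos_incl bos_incl (comul h).
Proof.
rewrite /bos_incl bos_comul bh_comul1 tliftE; last first.
  split=> [r1|r2] c s t.
    rewrite -tliftZ -tliftD; apply: eq_tlift => h1 h2.
    by rewrite !linearP.
  rewrite -tliftZ -tliftD; apply: eq_tlift => h1 h2.
  rewrite -tliftZ -tliftD; apply: eq_tlift => x r.
  by rewrite pure_linear_l linearP pure_linear_l.
apply: eq_tlift => h1 h2; rewrite bh_coact1 tliftE ?mul1r //.
split=> [x|r] c s t; first by rewrite pure_linear_l !linearP.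
by rewrite mulrDl -scalerAl !linearP pure_linear_l.
Qed.

Lemma bos_incl_counit h : counit (bos_incl h) = counit h.
Proof. by rewrite bos_counit bh_counit1 mul1r. Qed.

Lemma bos_incl_inj : injective bos_incl.
Proof.
have eb : bilin (fun (r : R) (x : H0) => bh_counit r *: x).
  split=> [r|x] c s t; first by rewrite linearP.
  by rewrite (linearP bh_counit) scalerDl scalerA.
move=> h k /(bij_inj (bos_bij phi)) /(congr1 (tlift
  (fun (r : R) (x : H0) => bh_counit r *: x))).
by rewrite !tliftE // bh_counit1 !scale1r.
Qed.

Lemma bos_incl_can : cancel bos_incl (linfun bos_incl)^-1%VF.
Proof.
have k0 : lker (linfun bos_incl) == 0%VS.
  by apply/lker0P => x y; rewrite !lfunE; apply: bos_incl_inj.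
by move=> h; rewrite -{1}(lfunE bos_incl) lker0_lfunK.
Qed.

Lemma deg0_coactE (u : A0) :
  tmap bos_incl vsval (deg0_coact u) = coact (vsval u).
Proof.
have : coact (vsval u) \in tensv (bos_gr 0) (gr 0%N).
  by have := lgr_coact LA (subvsP u); rewrite big_ord1.
rewrite /deg0_coact tmap_comp; try by [apply: linearP | move=> ? ? ?].
move: (coact _).
apply: (@tensv_eq _ _ _ _ (tmap _ _) idfun) => x a.
case/memv_imgP=> t t1 -> ag; rewrite /= tmap_lin; try by move=> ? ? ?; rewrite /= !linearP.
rewrite /= vsprojK //; congr (_ \ot a); rewrite lfunE /=.
move: t t1; rewrite ngr0.
apply: (tensv_eq (f := bos_incl \o (linfun bos_incl)^-1%VF \o bos_map phi)).
move=> r h /vlineP[c ->] _ /=.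
by rewrite pureZl linearZ -/(bos_incl h) !linearZ /= bos_incl_can.
Qed.

Lemma deg0_emb_can : cancel (tmap bos_incl (vsval : A0 -> A))
  (tmap (linfun bos_incl)^-1%VF (vsproj deg0_aspace)).
Proof.
by apply: tmap_can; [exact: linearP | exact: linearP | exact: bos_incl_can |
                     exact: vsvalK].
Qed.

Fact deg0_coact_linear : linear deg0_coact.
Proof. by move=> c u v; rewrite /deg0_coact !linearP. Qed.
HB.instance Definition _ :=
  GRing.isLinear.Build K A0 (tens H0 A0) _ deg0_coact deg0_coact_linear.

Fact deg0_coactP : is_coaction deg0_coact.
Proof.
split=> u.
  apply: (can_inj (tmap_can (linearP _) (linearP _) bos_incl_can deg0_emb_can)).
  transitivity (tassoc (tmap comul id (coact (vsval u)))).
    rewrite -deg0_coactE tmap_comp; try by [apply: linearP | move=> ? ? ?].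
    transitivity (tassoc (tmap (tmap bos_incl bos_incl) (vsval : A0 -> A)
        (tmap comul id (deg0_coact u)))); last first.
      congr (tassoc _); rewrite tmap_comp; try by [apply: linearP | move=> ? ? ?].
      by apply: eq_tmap => // h; rewrite /= bos_incl_comul.
    elim/tens_ind: (tmap comul id _) => [s a|s t IHs IHt]; last first.
      by rewrite !linearD /= IHs IHt.
    elim/tens_ind: s => [h k|s t IHs IHt]; last first.
      by rewrite !pureDl !linearD /= IHs IHt.
    by rewrite tassocE !tmapE /= !tmapE tassocE.
  rewrite (coactA (coactP A)) -deg0_coactE !tmap_comp; try by [apply: linearP | move=> ? ? ?].
  by apply: eq_tmap => // a; rewrite /= deg0_coactE.
apply: val_inj => /=.
rewrite (linear_tlift (vsval : {linear A0 -> A})).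
rewrite -[RHS](coact_counit (coactP A)) -deg0_coactE tlift_tmap; last first.
  split=> [h|x] c s t; first by rewrite linearP.
  by rewrite (linearP counit) scalerDl scalerA.
by apply: eq_tlift => h a; rewrite bos_incl_counit linearZ.
Qed.

Fact deg0_coact1 : deg0_coact 1 = 1 \ot 1.
Proof.
have v1 : vsval (1 : A0) = 1.
  by apply/eqP; rewrite algid_eq1; apply: (gr1 (lgr_grading LA)).
apply: (can_inj deg0_emb_can).
rewrite deg0_coactE v1 coact1 tmapE -(bos_incl1).
by congr (_ \ot _); apply: esym.
Qed.

Fact deg0_coactM (u v : A0) : deg0_coact (u * v) =
  \swd_(h \ot x <- deg0_coact u) \swd_(k \ot y <- deg0_coact v)
    ((h * k) \ot (x * y)).
Proof.
apply: (can_inj deg0_emb_can); rewrite deg0_coactE [vsval _]/= coactM.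
have mb (h : H) (x : A) : bilin (fun (k : H) (y : A) => (h * k) \ot (x * y)).
  split=> [k|y] c s t; first by rewrite mulrDr -scalerAr linearP.
  by rewrite mulrDr -scalerAr pure_linear_l.
rewrite -!deg0_coactE tlift_tmap; last first.
  split=> [h|x] c s t; rewrite -tliftZ -tliftD; apply: eq_tlift => k y.
    by rewrite mulrDl -scalerAl linearP.
  by rewrite mulrDl -scalerAl pure_linear_l.
rewrite [RHS]linear_tlift; apply: eq_tlift => h x /=.
rewrite tlift_tmap // [RHS]linear_tlift.
by apply: eq_tlift => k y; rewrite /= tmapE /= bos_inclM.
Qed.

Definition deg0 : comodAlg H0 :=
  @ComodAlg K H0 A0 deg0_coact deg0_coactP deg0_coact1 deg0_coactM.

End DegreeZero.
End LoewyGraded.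

(* Main.v *)
Require Import Defs.
From HB Require Import structures.
From mathcomp Require Import all_boot all_order all_algebra all_field.

Set Implicit Arguments.
Unset Strict Implicit.
Unset Printing Implicit Defensive.

Import GRing.Theory VectorInternalTheory.
Local Open Scope ring_scope.

(** Write [A0] for [A(0)].  An equivalence [F] of module categories from
    [A0]-modules to [X]-modules is governed by the [A0]-module [Q] with
    [F(Q) = X].  Compatibility with the action of [H0]-modules turns the
    coaction of [X] into a coaction of [H0] on [Q], which becomes a Hopf module,
    and then [X = End_A0(Q)^op] as comodule algebras, while [Q] is a
    progenerator because [X] is one ([Morita_progenerator]).  Conversely, for a
    Hopf module [Q] over [A] that is a progenerator, [M |-> Hom_A(Q, M)] is an
    equivalence of module categories from [A]-modules to [End_A(Q)^op]-modules
    ([progenerator_Morita]).  So it is enough to induce [Q] from [A0] to [A],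
    and [B] is the opposite of the endomorphism algebra of
    [A (x)_A0 Q].

    The induced module is realised inside [H (x) Q].  The degree zero part
    [p : A -> A0] is an algebra map, hence so is
    [kappa = (id (x) p) coact : A -> H (x) A0], and [kappa] is injective because
    [A] is Loewy-graded ([kappa_inj]).  Through [kappa], [A] acts on [H (x) Q],
    and [A (x)_A0 Q] becomes the submodule [A . delta(Q)], where
    [delta : Q -> H (x) Q] is the coaction ([Qhat]).  It inherits from [H] both a
    coaction and a grading, and it is again a progenerator, as dual bases of [Q]
    induce dual bases of it ([ind_progenerator]).

    An endomorphism of the induced module is determined by its values on
    [delta(Q)], which is the degree zero part; its degree [n] component moves
    [delta(Q)] into degree [n].  For this grading of [B] the Loewy conditions
    reduce to the fact that the comultiplication of [H] is graded
    ([ind_Loewy]), and the endomorphisms of degree zero are those of [Q]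
    ([deg0_ind_isom]), so that [B(0) = X].

    Finally, a nonzero subcomodule of a Loewy-graded comodule algebra meets its
    degree zero part ([subcomod_deg0]), and coinvariants have degree zero, so
    AM-exactness passes from [B(0)] to [B] ([AM_exact_deg0]). *)

(** * Linear algebra of tensor products *)

(** Closes the linearity conditions left by [tmap_comp] and [tmap_lin]; the
    second alternative is for the identity written as an abstraction. *)
Ltac linear_side := try by [exact: linearP | move=> ? ? ?].

Section TensorSlices.
Variable K : fieldType.
Implicit Types U V W : vectType K.

(** Maps built from [tlift] or from hypotheses carry their linearity as a bare
    proof; this makes the lemmas about [{linear U -> V}] available to them. *)
Definition mklin U V (f : U -> V) (fl : linear f) : {linear U -> V} :=
  HB.pack f (GRing.isLinear.Build K U V _ f fl).

Lemma linfunE U V (f : U -> V) (fl : linear f) : linfun f =1 f.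
Proof. by move=> u; rewrite -[f]/(mklin fl : U -> V) lfunE. Qed.

Lemma lin_scale U V (f : U -> V) a u : linear f -> f (a *: u) = a *: f u.
Proof. by move=> fl; apply: (linearZ_LR (mklin fl)). Qed.

Lemma lin_add U V (f : U -> V) u v : linear f -> f (u + v) = f u + f v.
Proof. by move=> fl; apply: (linearD (mklin fl)). Qed.

Lemma lin_zero U V (f : U -> V) : linear f -> f 0 = 0.
Proof. by move=> fl; apply: (linear0 (mklin fl)). Qed.

Lemma tlift0 U V W (t : tens U V) : \swd_(x \ot y <- t) (0 : W) = 0.
Proof. by rewrite /tlift big1 // => i _; rewrite big1 // => j _; rewrite scaler0. Qed.

Lemma lin_sum U V (f : U -> V) (fl : linear f) I (r : seq I) (P : pred I)
    (F : I -> U) :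
  f (\sum_(i <- r | P i) F i) = \sum_(i <- r | P i) f (F i).
Proof. exact: (linear_sum (mklin fl)). Qed.

Lemma lin_tlift U V W W' (f : W -> W') (b : U -> V -> W) t :
  linear f -> f (tlift b t) = \swd_(x \ot y <- t) f (b x y).
Proof. by move=> fl; apply: (linear_tlift (mklin fl)). Qed.

(** Identities between tensors are proved on pure tensors only. *)
Lemma tens_ext U V W (f g : tens U V -> W) :
  linear f -> linear g ->
  (forall u v, f (u \ot v) = g (u \ot v)) -> f =1 g.
Proof.
move=> fl gl efg; elim/tens_ind=> // s t es et.
by rewrite -[s]scale1r fl gl es et.
Qed.

(** Contraction of the first factor with a coordinate form: a tensor is
    determined by its slices, and [t \in tensv fullv V1] means that all of them
    lie in [V1], which is how one-sided membership is checked below. *)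
Definition slice U V (i : 'I_(dim U)) (t : tens U V) : V :=
  \sum_j (t : 'M_(_, _)) i j *: bvec j.

Lemma slice_linear U V i : linear (@slice U V i).
Proof.
move=> c s t; rewrite /slice scaler_sumr -big_split; apply: eq_bigr => j _ /=.
by rewrite !mxE scalerDl scalerA.
Qed.
HB.instance Definition _ U V i :=
  GRing.isLinear.Build K (tens U V) V _ (@slice U V i) (@slice_linear U V i).

Lemma slice_sum U V (t : tens U V) : t = \sum_i bvec i \ot slice i t.
Proof.
rewrite [LHS]tens_sum; apply: eq_bigr => i _.
by rewrite /slice linear_sum; apply: eq_bigr => j _; rewrite linearZ.
Qed.

Lemma slice_pure U V (u : U) (v : V) i : slice i (u \ot v) = v2r u 0 i *: v.
Proof.
rewrite [in RHS](vec_bvec v) scaler_sumr; apply: eq_bigr => j _.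
by rewrite scalerA /pure mxE big_ord1 !mxE.
Qed.

Lemma slice_tmap U V V' (g : V -> V') (t : tens U V) i :
  linear g -> slice i (tmap id g t) = g (slice i t).
Proof.
move=> gl; move: t; apply: tens_ext => [c s t|c s t|u v].
- by rewrite !linearP.
- by rewrite linearP gl.
by rewrite tmap_lin // !slice_pure -[g]/(mklin gl : _ -> _) linearZ.
Qed.

Lemma slice_inj U V (s t : tens U V) : (forall i, slice i s = slice i t) -> s = t.
Proof.
by move=> e; rewrite [s]slice_sum [t]slice_sum; apply: eq_bigr => i _; rewrite e.
Qed.

Lemma pure_memt U V (U1 : {vspace U}) (V1 : {vspace V}) u v :
  u \in U1 -> v \in V1 -> u \ot v \in tensv U1 V1.
Proof.
move=> uU vV; rewrite (coord_vbasis uU) (coord_vbasis vV).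
rewrite (lin_sum (pure_linear_l _)); apply: memv_suml => i _.
rewrite pureZl memvZ // linear_sum; apply: memv_suml => j _.
rewrite linearZ memvZ //; apply: memv_span; apply/allpairsP.
by exists ((vbasis U1)`_i, (vbasis V1)`_j); split=> //; apply: mem_nth; rewrite size_tuple.
Qed.

Lemma tensv_fullP U V (V1 : {vspace V}) (t : tens U V) :
  reflect (forall i, slice i t \in V1) (t \in tensv fullv V1).
Proof.
apply: (iffP idP) => [tV i|tV]; last first.
  by rewrite [t]slice_sum; apply: memv_suml => i _; rewrite pure_memt ?memvf.
suff -> : slice i t = projv V1 (slice i t) by apply: memv_proj.
apply: (tensv_eq (f := slice i) (g := projv V1 \o slice i) _ tV) => u v _ vV.
by rewrite /= slice_pure linearZ /= projv_id.
Qed.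

End TensorSlices.

Section TensMem.
Variable K : fieldType.
Implicit Types U V W : vectType K.

Lemma tensv_sub U V W (f : tens U V -> W) (U1 : {vspace U}) (V1 : {vspace V})
    (W1 : {vspace W}) t : linear f ->
  (forall u v, u \in U1 -> v \in V1 -> f (u \ot v) \in W1) ->
  t \in tensv U1 V1 -> f t \in W1.
Proof.
move=> fl fW; pose X := [seq u \ot v | u <- vbasis U1, v <- vbasis V1].
rewrite -[tensv _ _]/<<in_tuple X>>%VS => /coord_span ->.
rewrite (lin_sum fl); apply: memv_suml => i _; rewrite (lin_scale _ _ fl) memvZ //.
have /allpairsP[[u v] /= [uU vV ->]] : X`_i \in X by apply: mem_nth.
by apply: fW; apply: vbasis_mem.
Qed.

Lemma tlift_mem U V W (b : U -> V -> W) (W1 : {vspace W}) t :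
  (forall u v, b u v \in W1) -> tlift b t \in W1.
Proof.
by move=> bW; apply: memv_suml => i _; apply: memv_suml => j _; rewrite memvZ.
Qed.

Lemma tmap_memt U V U' V' (f : U -> U') (g : V -> V') (U1 : {vspace U'})
    (V1 : {vspace V'}) t :
  (forall u, f u \in U1) -> (forall v, g v \in V1) -> tmap f g t \in tensv U1 V1.
Proof. by move=> fU gV; apply: tlift_mem => u v; rewrite pure_memt. Qed.

Lemma tensvS U V (U1 U2 : {vspace U}) (V1 V2 : {vspace V}) :
  (U1 <= U2)%VS -> (V1 <= V2)%VS -> (tensv U1 V1 <= tensv U2 V2)%VS.
Proof.
move=> /subvP sU /subvP sV; apply/subvP => t; apply: (tensv_sub (f := idfun)).
  exact: linearP.
by move=> u v /sU uU /sV vV; apply: pure_memt.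
Qed.

Lemma sumv_mem V W (f : V -> W) n (Us : nat -> {vspace V}) (Ws : nat -> {vspace W}) v :
  linear f -> (forall k u, (k < n)%N -> u \in Us k -> f u \in Ws k) ->
  v \in (\sum_(k < n) Us k)%VS -> f v \in (\sum_(k < n) Ws k)%VS.
Proof.
move=> fl fU /memv_sumP[w wU ->]; rewrite (lin_sum fl); apply: memv_sumr => k _.
by apply: fU; rewrite ?ltn_ord ?wU.
Qed.

Lemma sumv_eq V W (f g : V -> W) n (Us : nat -> {vspace V}) v :
  linear f -> linear g ->
  (forall k u, (k < n)%N -> u \in Us k -> f u = g u) ->
  v \in (\sum_(k < n) Us k)%VS -> f v = g v.
Proof.
move=> fl gl e /memv_sumP[w wU ->]; rewrite (lin_sum fl) (lin_sum gl).
by apply: eq_bigr => k _; apply: (e k); rewrite ?ltn_ord ?wU.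
Qed.

End TensMem.

(** * Twisting maps by a coaction *)

(** Proves linearity or bilinearity of an expression by pushing a combination
    [c *: s + t] outwards through one head symbol at a time. *)
Ltac linear_step := first
  [ done
  | rewrite linearP
  | rewrite pure_linear_l
  | rewrite lact_linear_l
  | rewrite mulrDl -scalerAl
  | rewrite mulrDr -scalerAr
  | rewrite scalerDl -scalerA
  | match goal with fl : linear ?f |- _ => rewrite fl end
  | rewrite -tliftZ -tliftD; apply: eq_tlift => ? ? /= ].
Ltac solve_linear := (try (split=> ?)); move=> ? ? ? /=; do ?linear_step.

Section Stir.
Variables (K : fieldType) (H : hopfAlg K) (Y : lmod H) (W : vectType K).

Lemma tmap_lact_linear (V : vectType K) (g : V -> W) (t : tens Y V) :
  linear (fun h : H => tmap (lact h) g t).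
Proof. by rewrite /tmap; solve_linear. Qed.

Variables (M : vectType K) (co : {linear M -> tens H M}) (coP : is_coaction co).

(** The map [m |-> phi(m_(-1)) . w(m_(0))].  For [phi = id] it turns a map that is
    linear in the factor [W] into one that is linear for the diagonal action,
    and for [phi] the antipode it turns it back. *)
Definition stir (phi : H -> H) (w : M -> tens Y W) (m : M) : tens Y W :=
  \swd_(h \ot m0 <- co m) tmap (lact (phi h)) id (w m0).

Lemma stir_linear phi w : linear (stir phi w).
Proof. by rewrite /stir; solve_linear. Qed.

(** Coassociativity of [M] replaces the two legs by
    [phi(h_(1)) psi(h_(2))], which the hypothesis on [phi] and [psi] contracts.
    The antipode makes twisting by [id] invertible: see [stirK], [stirVK]. *)
Lemma stir_stir (phi psi : H -> H) (w : M -> tens Y W) m :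
  linear phi -> linear psi -> linear w ->
  (forall h, \swd_(k \ot l <- comul h) (phi k * psi l) = (counit h)%:A) ->
  stir phi (stir psi w) m = w m.
Proof.
move=> phil psil wl conv.
pose T2 h (s : tens H M) : tens Y W :=
  \swd_(k \ot m1 <- s) tmap (lact (phi h * psi k)) id (w m1).
have T2b h : bilin (fun k m1 => tmap (lact (phi h * psi k)) id (w m1)).
  split=> u c s t; first by rewrite wl linearP.
  by rewrite psil mulrDr -scalerAr tmap_lact_linear.
have Tb : bilin T2.
  split=> u c s t; first by rewrite /T2 linearP.
  rewrite /T2 -tliftZ -tliftD; apply: eq_tlift => k m1.
  by rewrite phil mulrDl -scalerAl tmap_lact_linear.
transitivity (tlift T2 (tmap id co (co m))).
  rewrite tlift_tmap // /stir; apply: eq_tlift => h m0.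
  rewrite linear_tlift; apply: eq_tlift => k m1 /=.
  rewrite tmap_comp //; try exact: lact_linear.
  by apply: eq_tmap => // y; rewrite /= actM //; apply: lactP.
rewrite -(coactA coP).
transitivity (w (\swd_(h \ot x <- co m) (counit h *: x))); last by rewrite coact_counit.
rewrite lin_tlift // [tassoc _]linear_tlift linear_tlift.
apply: eq_tlift => h m0 /=.
transitivity (tmap (lact (\swd_(k \ot l <- comul h) (phi k * psi l))) id (w m0)).
  elim/tens_ind: (comul h) => [k l|s t IHs IHt]; last first.
    rewrite pureDl !linearD /= IHs IHt.
    by rewrite (lin_add _ _ (tmap_lact_linear id (w m0))).
  rewrite tassocE tliftE // /T2 tliftE // tliftE //.
  by solve_linear.
rewrite conv (lin_scale _ _ (tmap_lact_linear id (w m0))) (lin_scale _ _ wl).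
congr (_ *: _); rewrite -[RHS]tmap_id; apply: eq_tmap => // y.
by rewrite act1 //; apply: lactP.
Qed.

Lemma stirK w m : linear w -> stir (@antipode K H) (stir id w) m = w m.
Proof. by move=> wl; apply: stir_stir => //; [apply: linearP | apply: antipodel]. Qed.

Lemma stirVK w m : linear w -> stir id (stir (@antipode K H) w) m = w m.
Proof. by move=> wl; apply: stir_stir => //; [apply: linearP | apply: antipoder]. Qed.

Lemma stir_eq0 w : linear w -> (forall m, stir id w m = 0) -> forall m, w m = 0.
Proof.
move=> wl w0 m; rewrite -(stirK m wl) {1}/stir.
rewrite -[RHS](tlift0 _ (co m)); apply: eq_tlift => h m0.
by rewrite /= w0 linear0.
Qed.

End Stir.

(** * Hom spaces out of a Hopf module *)

Section Homs.
Variables (K : fieldType) (A : falgType K).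

(** Module maps as a subspace of the linear maps; commuting with the action of
    a basis of [A] suffices. *)
Definition hom_space (M N : lmod A) : {vspace 'Hom(M, N)} :=
  (\bigcap_(i < dim A) lker (linfun (fun f : 'Hom(M, N) =>
     (f \o linfun (lact (bvec i)))%VF - (linfun (lact (bvec i)) \o f)%VF)))%VS.

Lemma hom_spaceP (M N : lmod A) (f : 'Hom(M, N)) :
  f \in hom_space M N <-> forall a m, f (lact a m) = lact a (f m).
Proof.
have l i : linear (fun f : 'Hom(M, N) =>
     (f \o linfun (lact (bvec i)))%VF - (linfun (lact (bvec i)) \o f)%VF).
  move=> c g h; rewrite comp_lfunDl comp_lfunDr -comp_lfunZl -comp_lfunZr.
  by rewrite scalerBr opprD addrACA.
have e i : (f \in lker (linfun (fun f : 'Hom(M, N) =>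
     (f \o linfun (lact (bvec i)))%VF - (linfun (lact (bvec i)) \o f)%VF)))
    <-> forall m, f (lact (bvec i) m) = lact (bvec i) (f m).
  rewrite memv_ker linfunE; last exact: l.
  rewrite subr_eq0; split=> [/eqP/lfunP eb m|eb].
    by have := eb m; rewrite !comp_lfunE !lfunE.
  by apply/eqP/lfunP => m; rewrite !comp_lfunE !lfunE eb.
split=> [fH a m|fH].
  have fi i : forall m, f (lact (bvec i) m) = lact (bvec i) (f m).
    apply/e; move: fH; rewrite memvE => /subv_bigcapP/(_ i isT).
    by rewrite -memvE.
  rewrite [a]vec_bvec !(lin_sum (lact_linear_l _)) linear_sum.
  apply: eq_bigr => i _.
  by rewrite !(lin_scale _ _ (lact_linear_l _)) linearZ /= fi.
by rewrite memvE; apply/subv_bigcapP => i _; rewrite -memvE; apply/e => m.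
Qed.

Definition homs (M N : lmod A) : Type := subvs_of (hom_space M N).
HB.instance Definition _ (M N : lmod A) :=
  Vector.copy (homs M N) (subvs_of (hom_space M N)).

Definition hfun (M N : lmod A) (f : homs M N) : 'Hom(M, N) := vsval f.
HB.instance Definition _ (M N : lmod A) :=
  GRing.Linear.copy (@hfun M N) (@vsval _ _ (hom_space M N)).

Definition mkhom (M N : lmod A) (f : 'Hom(M, N)) : homs M N :=
  vsproj (hom_space M N) f.
HB.instance Definition _ (M N : lmod A) :=
  GRing.Linear.copy (@mkhom M N) (vsproj (hom_space M N)).

Lemma hfun_inj M N : injective (@hfun M N).
Proof. exact: subvs_inj. Qed.

Lemma hfunP M N (f : homs M N) a m : hfun f (lact a m) = lact a (hfun f m).
Proof. by have /hom_spaceP := subvsP f; apply. Qed.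

Definition hom_of (M N : lmod A) (f : homs M N) : lmod_hom M N := LmodHom (hfunP f).

Lemma homs_eq M N (f g : homs M N) : hfun f =1 hfun g -> f = g.
Proof. by move=> e; apply: hfun_inj; apply/lfunP. Qed.

Lemma mkhomK (M N : lmod A) (f : 'Hom(M, N)) :
  (forall a m, f (lact a m) = lact a (f m)) -> hfun (mkhom f) = f.
Proof. by move=> fH; apply: vsprojK; apply/hom_spaceP. Qed.

Lemma mkhomE (M N : lmod A) (f : M -> N) m : linear f ->
  (forall a m, f (lact a m) = lact a (f m)) -> hfun (mkhom (linfun f)) m = f m.
Proof. by move=> fl fH; rewrite mkhomK ?linfunE // => a x; rewrite !linfunE. Qed.

Lemma hfun_lin (M N : lmod A) (m : M) : linear (fun f : homs M N => hfun f m).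
Proof. by move=> c f g; rewrite linearP add_lfunE scale_lfunE. Qed.

Lemma hfunZ (M N : lmod A) c (f : homs M N) m : hfun (c *: f) m = c *: hfun f m.
Proof. exact: lin_scale (hfun_lin m). Qed.

Lemma hfunD (M N : lmod A) (f g : homs M N) m : hfun (f + g) m = hfun f m + hfun g m.
Proof. exact: lin_add (hfun_lin m). Qed.

Lemma hfun_sum (M N : lmod A) I (r : seq I) (P : pred I) (F : I -> homs M N) m :
  hfun (\sum_(i <- r | P i) F i) m = \sum_(i <- r | P i) hfun (F i) m.
Proof. exact: (lin_sum (hfun_lin m)). Qed.

Fact reg_action : is_action (fun a b : A => a * b).
Proof.
split=> [|a|a b c]; last 2 first.
- by rewrite mul1r.
- by rewrite mulrA.
by split=> x c s t; rewrite ?mulrDl ?mulrDr -?scalerAl -?scalerAr.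
Qed.
Definition reg : lmod A := Lmod reg_action.

Definition rmul (a : A) (x : reg) : reg := (x : A) * a.

Fact rmul_linear a : linear (rmul a).
Proof. by move=> c x y; rewrite /rmul mulrDl -scalerAl. Qed.

Fact rmul_subproof a (b : A) (x : reg) :
  linfun (rmul a) (lact b x) = lact b (linfun (rmul a) x).
Proof. by rewrite !linfunE; [rewrite /rmul /= mulrA | apply: rmul_linear..]. Qed.
Definition rmulh a : lmod_hom reg reg := LmodHom (rmul_subproof a).

Lemma rmulhE a x : rmulh a x = (x : A) * a.
Proof. exact: (linfunE (rmul_linear a)). Qed.

(** Projecting the composite on the module maps keeps this total and linear;
    for a module map [g] it is the composite itself ([hpostE]). *)
Definition hpost (M N N' : lmod A) (g : 'Hom(N, N')) (f : homs M N) : homs M N' :=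
  mkhom (g \o hfun f)%VF.

Lemma hpost_linear M N N' g : linear (@hpost M N N' g).
Proof.
move=> c f f'; rewrite /hpost -[RHS]linearP; congr mkhom.
by rewrite [hfun _]linearP comp_lfunDr comp_lfunZr.
Qed.
HB.instance Definition _ M N N' g :=
  GRing.isLinear.Build K _ _ _ (@hpost M N N' g) (@hpost_linear M N N' g).

Lemma hpostE M N N' (g : lmod_hom N N') (f : homs M N) m :
  hfun (hpost g f) m = g (hfun f m).
Proof.
rewrite /hpost mkhomK ?comp_lfunE // => a x.
by rewrite !comp_lfunE hfunP homP.
Qed.

End Homs.

(** Objects of the category of Hopf modules, [H]-comodules and [A]-modules at
    once; nonzero, so that their endomorphism algebras are nontrivial. *)
Record hopfMod (K : fieldType) (H : hopfAlg K) (A : comodAlg H) := HopfMod {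
  hm :> lmod A;
  hco : {linear hm -> tens H hm};
  hcoP : is_coaction hco;
  hco_act : forall a q, hco (lact a q) = lact a (hco q : tmod (reg H) hm);
  hm_neq0 : exists q : hm, q != 0
}.
Arguments hco {K H A h}.

Section Iota.
Variables (K : fieldType) (H : hopfAlg K) (A : comodAlg H) (Q : hopfMod A).

Section Def.
Variables (Y : lmod H) (N : lmod A).

(** The canonical map [Y (x) Hom_A(Q, N) -> Hom_A(Q, Y (x) N)], evaluated at
    [q]: it sends [y \ot f] to [q_(-1) y \ot f(q_(0))]. *)
Definition tev (t : tens Y (homs Q N)) (q : Q) : tens Y N :=
  \swd_(h \ot q0 <- hco q) tmap (lact h) (fun f : homs Q N => hfun f q0) t.

Lemma tev_lin t : linear (tev t).
Proof. by rewrite /tev; solve_linear. Qed.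

Lemma tev_lin_l q : linear (tev^~ q).
Proof. by rewrite /tev; solve_linear. Qed.

Lemma tev_pure_bilin y (f : homs Q N) :
  bilin (fun (h : H) (q0 : Q) => @lact K H Y h y \ot hfun f q0).
Proof. by solve_linear. Qed.

Lemma tevE y f q :
  tev (y \ot f) q = \swd_(h \ot q0 <- hco q) (lact h y \ot hfun f q0).
Proof.
apply: eq_tlift => h q0; rewrite tmap_lin //; first exact: lact_linear.
exact: hfun_lin.
Qed.

Lemma tev_stir t q :
  tev t q = stir hco id (fun q0 => tmap id (fun f : homs Q N => hfun f q0) t) q.
Proof.
apply: eq_tlift => h q0; rewrite tmap_comp //; exact: lact_linear.
Qed.

Lemma tev_ev_linear (t : tens Y (homs Q N)) :
  linear (fun q0 => tmap id (fun f : homs Q N => hfun f q0) t).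
Proof. by rewrite /tmap; solve_linear. Qed.

(** Evaluation at [q] is [tev] with its twist removed by the antipode. *)
Lemma tev_inj s t : tev s =1 tev t -> s = t.
Proof.
move=> e; apply/eqP; rewrite -subr_eq0; apply/eqP.
have e0 q : tmap id (fun f : homs Q N => hfun f q) (s - t) = 0.
  apply: (stir_eq0 (hcoP Q) (tev_ev_linear (s - t))) => {}q.
  have l := linearB (mklin (tev_lin_l q)) s t.
  by rewrite -tev_stir [LHS]l /= e subrr.
apply: slice_inj => i; rewrite linear0; apply: homs_eq => q.
rewrite -(slice_tmap _ _ (hfun_lin q)) e0.
by rewrite linear0 (lin_zero (hfun_lin q)).
Qed.

Lemma tev_act t a q : tev t (lact a q) = lact a (tev t q : tmod Y N).
Proof.
move: t; apply: tens_ext => [||y f].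
- exact: tev_lin_l.
- by move=> c s t; rewrite tev_lin_l linearP.
rewrite !tevE hco_act.
elim/tens_ind: (hco q) => [h q0|s t IHs IHt]; last by rewrite !linearD /= IHs IHt.
rewrite [lact a _]tactE linear_tlift tliftE; last exact: tev_pure_bilin.
rewrite [RHS]tactE; apply: eq_tlift => k x /=.
rewrite tliftE; last exact: tev_pure_bilin.
by rewrite /= actM ?hfunP //; apply: lactP.
Qed.

(** Untwisting [w] by the antipode gives a map [w'] into [Y (x) N] that must be
    shown [A]-linear in the factor [N].  Instead of the antimultiplicativity of
    the antipode this uses twice that a map whose twist vanishes is zero, first
    for the comodule [A] and then for [Q]. *)
Lemma tev_surj (w : Q -> tmod Y N) : linear w ->
  (forall a q, w (lact a q) = lact a (w q)) -> exists t, tev t =1 w.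
Proof.
move=> wl wA; pose w' := stir hco (@antipode K H) w : Q -> tens Y N.
have w'l : linear w' by apply: stir_linear.
have w'A a q : w' (lact a q) = tmap id (lact a) (w' q).
  (* The defect of linearity, twisted by [Q] only. *)
  pose G q a : tens Y N := \swd_(h \ot q0 <- hco q)
    tmap (lact h) id (w' (lact a q0) - tmap id (lact a) (w' q0)).
  have tl (t : tens Y N) : linear (fun a : A => tmap id (lact a) t).
    by rewrite /tmap; solve_linear.
  have Gl r : linear (G r).
    rewrite /G => c s t; rewrite -tliftZ -tliftD; apply: eq_tlift => h q0.
    rewrite lact_linear_l w'l tl -[RHS]linearP /=; congr (tmap (lact h) id _).
    by rewrite scalerBr opprD addrACA.
  have B : bilin (fun h q => tmap (lact h) id (w' q) : tens Y N).
    by split=> x c s t; rewrite ?w'l ?linearP ?tmap_lact_linear.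
  have G0 r b : G r b = 0.
    apply: (stir_eq0 (coactP A) (Gl r)) => {}b.
    transitivity (stir hco id w' (lact b r) -
                  lact b (stir hco id w' r : tmod Y N)); last first.
      by rewrite /w' !(stirVK (hcoP Q)) // wA subrr.
    rewrite /stir hco_act /= [X in X - _]linear_tlift [tact _ _ in RHS]/tact.
    rewrite -[X in _ = _ - X]/(tact _ _) -scaleN1r -tliftZ -tliftD.
    apply: eq_tlift => k x /=; rewrite tlift_tmap // linear_tlift.
    rewrite [tmap _ _ (tlift _ _)]linear_tlift -tliftZ -tliftD.
    apply: eq_tlift => h r0 /=; rewrite linearB /= scaleN1r.
    rewrite !linearB /= !tmap_comp //; try exact: lact_linear.
    congr (_ - _).
    - by apply: eq_tmap => // y; rewrite /= actM //; apply: lactP.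
    - by move=> c s t /=; rewrite !linearP.
  apply/eqP; rewrite -subr_eq0; apply/eqP.
  have l : linear (fun q => w' (lact a q) - tmap id (lact a) (w' q)).
    move=> c s t; rewrite linearP w'l w'l linearP opprD scalerBr; exact: addrACA.
  by apply: (stir_eq0 (hcoP Q) l _ q) => {}q; apply: G0.
(* The coefficients of [w'] in a basis of [Y] are module maps. *)
exists (\sum_i bvec i \ot mkhom (linfun (fun q => slice i (w' q)))).
move=> q; rewrite tev_stir -[RHS](stirVK (hcoP Q)) //; apply: eq_tlift => h q0.
congr (tmap _ _ _); rewrite linear_sum [RHS]slice_sum; apply: eq_bigr => i _.
rewrite /= tmap_lin //; last exact: hfun_lin.
rewrite mkhomE // => [c s t|b r]; first by rewrite w'l linearP.
by rewrite w'A slice_tmap //; apply: lact_linear.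
Qed.

End Def.

End Iota.

Section IotaTheory.
Variables (K : fieldType) (H : hopfAlg K) (A : comodAlg H) (Q : hopfMod A).
Implicit Types (Y Z : lmod H) (N : lmod A).

Definition tev_hom Y N (t : tens Y (homs Q N)) : homs Q (tmod Y N) :=
  mkhom (linfun (tev t : Q -> tmod Y N)).

Definition tens_hom Y N : 'Hom(tens Y (homs Q N), homs Q (tmod Y N)) :=
  linfun (@tev_hom Y N).

Lemma tens_hom_linear Y N :
  linear (@tev_hom Y N).
Proof.
move=> c s t; apply: homs_eq => q; rewrite hfunD hfunZ.
by rewrite !mkhomE ?tev_lin_l //; (exact: tev_lin || exact: tev_act).
Qed.

Lemma tens_homE Y N (t : tens Y (homs Q N)) q : hfun (tens_hom Y N t) q = tev t q.
Proof.
rewrite linfunE; last exact: tens_hom_linear.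
by rewrite mkhomE //; [apply: tev_lin | apply: tev_act].
Qed.

(** The inverse of [tens_hom]; it is the tensor structure of the functor
    [Hom_A(Q, -)], and all the coherence conditions are checked after applying
    [tens_hom], where they become identities between values. *)
Definition hom_tens Y N : 'Hom(homs Q (tmod Y N), tens Y (homs Q N)) := (tens_hom Y N)^-1%VF.

Lemma tens_homK Y N : cancel (tens_hom Y N) (hom_tens Y N).
Proof.
apply: lker0_lfunK; apply/lker0P => s t e; apply: tev_inj => q.
by rewrite -!tens_homE e.
Qed.

Lemma hom_tensK Y N : cancel (hom_tens Y N) (tens_hom Y N).
Proof.
move=> g; have [t e] := tev_surj (linearP (hfun g)) (hfunP g).
have -> : g = tens_hom Y N t by apply: homs_eq => q; rewrite tens_homE e.
by rewrite tens_homK.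
Qed.

Lemma tev_hom_tens Y N (g : homs Q (tmod Y N)) q : tev (hom_tens Y N g) q = hfun g q.
Proof. by rewrite -tens_homE hom_tensK. Qed.

Lemma tev_nat Y Y' N N' (u : lmod_hom Y Y') (v : lmod_hom N N') t q :
  tev (tmap u (hpost v) t : tens Y' (homs Q N')) q = tmap u v (tev t q).
Proof.
move: t; apply: tens_ext => [c s t|c s t|y f].
- by rewrite linearP tev_lin_l.
- by rewrite tev_lin_l linearP.
rewrite tmapE !tevE linear_tlift; apply: eq_tlift => h q0.
by rewrite /= tmapE /= homP hpostE.
Qed.

Lemma tev_assoc Y Z N (s : tens (hmod_tens Y Z) (homs Q N)) q :
  tev (tmap id (tens_hom Z N) (tassoc s) : tens Y (homs Q (tmod Z N))) q =
  tassoc (tev s q).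
Proof.
move: s; apply: tens_ext => [c s t|c s t|yz f].
- by rewrite !linearP tev_lin_l.
- by rewrite tev_lin_l linearP.
elim/tens_ind: yz => [y z|s t IHs IHt]; last first.
  rewrite !pureDl !linearD /= !(lin_add _ _ (tev_lin_l q)) IHs IHt.
  by rewrite [RHS]linearD.
rewrite tassocE tmap_lin //; last exact: linearP.
rewrite !tevE.
pose T2 h (s : tens H Q) : tens Y (tens Z N) :=
  \swd_(k \ot q0 <- s) (lact h y \ot (lact k z \ot hfun f q0)).
have T2b h : bilin (fun (k : H) (q0 : Q) => lact h y \ot (lact k z \ot hfun f q0)).
  by split=> u c v w; rewrite ?lact_linear_l ?linearP ?pure_linear_l ?linearP.
have Tb : bilin T2.
  split=> [h|s] c v w; first by rewrite /T2 linearP.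
  rewrite /T2 -tliftZ -tliftD; apply: eq_tlift => k x.
  by rewrite lact_linear_l pure_linear_l.
transitivity (tlift T2 (tmap id hco (hco q))).
  rewrite tlift_tmap //; apply: eq_tlift => h q0.
  by rewrite tens_homE tevE linear_tlift.
rewrite -(coactA (hcoP Q)) [tassoc _]linear_tlift linear_tlift [RHS]linear_tlift.
apply: eq_tlift => h q0 /=. rewrite tactE.
change (@coact K H (regular_comodAlg H) h) with (comul h).
elim/tens_ind: (comul h) => [k l|s t IHs IHt]; last first.
  by rewrite linearD !pureDl !linearD /= IHs IHt.
rewrite tliftE; last exact: tact_pure_bilin.
by rewrite !tassocE tliftE // /T2 tliftE.
Qed.

Lemma tev_unit N (t : tens (hmod_unit H) (homs Q N)) q :
  tunit (tev t q) = hfun (tunit t) q.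
Proof.
move: t; apply: tens_ext => [c s t|c s t|x f].
- by rewrite tev_lin_l linearP.
- by rewrite [tunit _]linearP hfunD hfunZ.
have ub (V : vectType K) : bilin (fun (x : K^o) (v : V) => (x : K) *: v).
  by split=> [y|v] b s t; rewrite ?linearP //= scalerDl scalerA.
rewrite tevE [tunit (_ \ot _)]tliftE // hfunZ -{2}(coact_counit (hcoP Q) q).
rewrite linear_tlift linear_tlift -tliftZ; apply: eq_tlift => h q0 /=.
by rewrite [tunit _]tliftE // linearZ /= scalerA [in RHS]mulrC.
Qed.

End IotaTheory.

Section Endo.
Variables (K : fieldType) (H : hopfAlg K) (A : comodAlg H) (Q : hopfMod A).

Definition endo : Type := homs Q Q.
HB.instance Definition _ := Vector.copy endo (homs Q Q).

Definition endo_one : endo := mkhom \1%VF.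

(** The product of the opposite endomorphism algebra: [f * g] is [f] followed
    by [g], since [A] acts on the left. *)
Definition endo_mul (f g : endo) : endo := mkhom (hfun g \o hfun f)%VF.

Lemma endo_oneE q : hfun endo_one q = q.
Proof. by rewrite mkhomK ?id_lfunE // => a x; rewrite !id_lfunE. Qed.

Lemma endo_mulE f g q : hfun (endo_mul f g) q = hfun g (hfun f q).
Proof. by rewrite mkhomK ?comp_lfunE // => a x; rewrite !comp_lfunE !hfunP. Qed.

Fact endo_mulA : associative endo_mul.
Proof. by move=> f g h; apply: homs_eq => q; rewrite !endo_mulE. Qed.
Fact endo_mul1l : left_id endo_one endo_mul.
Proof. by move=> f; apply: homs_eq => q; rewrite endo_mulE endo_oneE. Qed.
Fact endo_mul1r : right_id endo_one endo_mul.
Proof. by move=> f; apply: homs_eq => q; rewrite endo_mulE endo_oneE. Qed.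
Fact endo_mulDl : left_distributive endo_mul +%R.
Proof.
move=> f g h; apply: homs_eq => q.
by rewrite hfunD !endo_mulE [X in hfun h X]hfunD linearD.
Qed.
Fact endo_mulDr : right_distributive endo_mul +%R.
Proof.
move=> f g h; apply: homs_eq => q.
by rewrite hfunD !endo_mulE hfunD.
Qed.
Fact endo_one_neq0 : endo_one != 0.
Proof.
have [q] := hm_neq0 Q; apply: contraNneq => e.
by rewrite -(endo_oneE q) e (lin_zero (hfun_lin q)).
Qed.
HB.instance Definition _ := GRing.Zmodule_isNzRing.Build endo
  endo_mulA endo_mul1l endo_mul1r endo_mulDl endo_mulDr endo_one_neq0.

Fact endo_scaleAl c (f g : endo) : c *: (f * g) = (c *: f) * g.
Proof.
apply: homs_eq => q.
by rewrite hfunZ !endo_mulE [X in _ = hfun g X]hfunZ linearZ.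
Qed.
HB.instance Definition _ := GRing.Lmodule_isLalgebra.Build K endo endo_scaleAl.
Fact endo_scaleAr c (f g : endo) : c *: (f * g) = f * (c *: g).
Proof. by apply: homs_eq => q; rewrite hfunZ !endo_mulE hfunZ. Qed.
HB.instance Definition _ := GRing.Lalgebra_isAlgebra.Build K endo endo_scaleAr.
HB.instance Definition _ := Algebra_isFalgebra.Build K endo.

Lemma hmulE (f g : endo) q : hfun (f * g) q = hfun g (hfun f q).
Proof. exact: endo_mulE. Qed.

Lemma hone (q : Q) : hfun (1 : endo) q = q.
Proof. exact: endo_oneE. Qed.

End Endo.

(** * The comodule algebra of endomorphisms *)

Section EndoComod.
Variables (K : fieldType) (H : hopfAlg K) (A : comodAlg H) (Q : hopfMod A).
Notation B := (endo Q).

Fact hcoh_subproof a q : linfun (hco : Q -> tmod (reg H) Q) (lact a q) =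
  lact a (linfun (hco : Q -> tmod (reg H) Q) q).
Proof. by rewrite !lfunE /= hco_act. Qed.
Definition hcoh : lmod_hom Q (tmod (reg H) Q) := LmodHom hcoh_subproof.

(** The coaction [f |-> f_(-1) \ot f_(0)] determined by
    [hco (f q) = q_(-1) f_(-1) \ot f_(0)(q_(0))]. *)
Definition endo_coact (f : B) : tens H B := hom_tens Q (reg H) Q (hpost hcoh f).

Fact endo_coact_linear : linear endo_coact.
Proof. by move=> c f g; rewrite /endo_coact !linearP. Qed.
HB.instance Definition _ :=
  GRing.isLinear.Build K B (tens H B) _ endo_coact endo_coact_linear.

Lemma endo_coactE f q : tev (endo_coact f : tens (reg H) (homs Q Q)) q = hco (hfun f q).
Proof. by rewrite tev_hom_tens hpostE lfunE. Qed.

Fact comulh_subproof g h :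
  linfun (comul : reg H -> hmod_tens (reg H) (reg H)) (lact g h) =
  lact g (linfun (comul : reg H -> hmod_tens (reg H) (reg H)) h).
Proof.
rewrite !lfunE /= comulM /tact; apply: eq_tlift => x y.
by apply: eq_tlift.
Qed.
Definition comulh : lmod_hom (reg H) (hmod_tens (reg H) (reg H)) :=
  LmodHom comulh_subproof.

Fact counith_subproof g h :
  linfun (counit : reg H -> hmod_unit H) (lact g h) =
  lact g (linfun (counit : reg H -> hmod_unit H) h).
Proof. by rewrite !lfunE /= counitM. Qed.
Definition counith : lmod_hom (reg H) (hmod_unit H) := LmodHom counith_subproof.

Lemma hpost_id (M N : lmod A) (f : homs M N) : hpost (hom_id N) f = f.
Proof. by apply: homs_eq => m; rewrite hpostE /= id_lfunE. Qed.

Lemma tens_hom_endo_coact f : tens_hom Q (reg H) Q (endo_coact f) = hpost hcoh f.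
Proof. exact: hom_tensK. Qed.

Fact endo_coactP : is_coaction endo_coact.
Proof.
split=> f.
  apply: (can_inj (tmap_can (linearP idfun) (linearP (hom_tens Q (reg H) Q))
    (fun x => erefl x) (@tens_homK _ _ _ Q (reg H) Q))).
  apply: (@tev_inj _ _ _ Q (reg H) (tmod (reg H) Q)) => q.
  rewrite tev_assoc [tmap id _ (tmap _ _ _)]tmap_comp; linear_side.
  have -> : tmap comul id (endo_coact f) =
      tmap comulh (hpost (hom_id Q)) (endo_coact f).
    by apply: eq_tmap => x; rewrite ?hpost_id //= lfunE.
  have -> : tmap (id \o id) (tens_hom Q (reg H) Q \o endo_coact) (endo_coact f) =
      tmap (hom_id (reg H)) (hpost hcoh) (endo_coact f).
    by apply: eq_tmap => x; rewrite /= ?id_lfunE ?tens_hom_endo_coact.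
  rewrite !tev_nat !endo_coactE.
  transitivity (tassoc (tmap comul id (hco (hfun f q)))).
    by congr (tassoc _); apply: eq_tmap => x; rewrite /= ?id_lfunE ?lfunE.
  rewrite (coactA (hcoP Q)).
  by apply: eq_tmap => x; rewrite /= ?id_lfunE ?lfunE.
apply: (@homs_eq _ _ Q Q) => q.
have -> : \swd_(h \ot x <- endo_coact f) (counit h *: x) =
    tunit (tmap counith (hpost (hom_id Q)) (endo_coact f)).
  rewrite [RHS]tlift_tmap; last by split=> [y|v] b s t; rewrite ?linearP //= scalerDl scalerA.
  by apply: eq_tlift => h x; rewrite /= lfunE hpost_id.
rewrite -tev_unit tev_nat endo_coactE -[RHS](coact_counit (hcoP Q)).
rewrite [LHS]tlift_tmap; last by split=> [y|v] b s t; rewrite ?linearP //= scalerDl scalerA.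
by apply: eq_tlift => h x; rewrite /= lfunE id_lfunE.
Qed.

Section Functor.
Variable N : lmod A.

(** [Hom_A(Q, N)] is a left module over the opposite endomorphism algebra by
    precomposition. *)
Definition bact (b : B) (f : homs Q N) : homs Q N := mkhom (hfun f \o hfun b)%VF.

Lemma bactE b f q : hfun (bact b f) q = hfun f (hfun b q).
Proof. by rewrite mkhomK ?comp_lfunE // => a x; rewrite !comp_lfunE !hfunP. Qed.

Fact bactP : is_action bact.
Proof.
split=> [|f|a b f].
- split=> [b|f] c s t; apply: homs_eq => q; rewrite hfunD hfunZ !bactE.
    by rewrite hfunD hfunZ.
  by rewrite [hfun (_ + _) q]hfunD hfunZ linearP.
- by apply: homs_eq => q; rewrite bactE hone.
by apply: homs_eq => q; rewrite !bactE hmulE.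
Qed.

Definition hmod : lmod B := Lmod bactP.

Lemma tev_bact (Y : lmod H) (b : tens H B) (t : tens Y (homs Q N)) q :
  tev (\swd_(h \ot x <- b) tmap (lact h) (bact x) t : tens Y (homs Q N)) q =
  \swd_(h \ot q0 <- tev (b : tens (reg H) (homs Q Q)) q)
     tmap (lact h) (fun f : homs Q N => hfun f q0) t.
Proof.
have bl (f : homs Q N) : linear (bact^~ f) by case: (act_bilin bactP).
have br x : linear (bact x) by case: (act_bilin bactP).
move: t; apply: tens_ext => [c s t|c s t|y f].
- rewrite -tev_lin_l; congr (tev _ q); rewrite -tliftZ -tliftD.
  by apply: eq_tlift => h x; rewrite linearP.
- rewrite -tliftZ -tliftD; apply: eq_tlift => h x; exact: linearP.
have B1 : bilin (fun (h : H) (x : B) => lact h y \ot bact x f).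
  by split=> u c v w; rewrite ?lact_linear_l ?bl ?linearP ?pure_linear_l.
have B2 : bilin (fun (h : H) (q0 : Q) => @lact _ _ Y h y \ot hfun f q0).
  exact: tev_pure_bilin.
transitivity (tev (tlift (fun (h : H) (x : B) => lact h y \ot bact x f) b
   : tens Y (homs Q N)) q).
  by congr (tev _ q); apply: eq_tlift => h x; rewrite tmap_lin //; apply: lact_linear.
transitivity (tlift (fun (h : H) (q0 : Q) => @lact _ _ Y h y \ot hfun f q0)
   (tev (b : tens (reg H) (homs Q Q)) q)); last first.
  apply: eq_tlift => h q0; rewrite tmap_lin //; first exact: lact_linear.
  exact: hfun_lin.
move: b; apply: tens_ext => [c s t|c s t|h x].
- by rewrite linearP tev_lin_l.
- by rewrite tev_lin_l linearP.
rewrite tliftE // !tevE linear_tlift; apply: eq_tlift => k q0 /=.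
by rewrite tliftE // bactE actM //; apply: lactP.
Qed.

End Functor.

(** This is at once the multiplicativity of the coaction (for [Y = H] and
    [N = Q]) and the linearity of the tensor structure of [Hom_A(Q, -)] over
    the endomorphisms. *)
Lemma tev_bact_coact (N : lmod A) (Y : lmod H) (b : B) (t : tens Y (homs Q N)) q :
  tev (\swd_(h \ot x <- endo_coact b) tmap (lact h) (bact x) t
     : tens Y (homs Q N)) q = tev t (hfun b q).
Proof. by rewrite tev_bact endo_coactE. Qed.

Fact endo_coact1 : endo_coact 1 = 1 \ot 1.
Proof.
apply: (@tev_inj _ _ _ Q (reg H) Q) => q; rewrite endo_coactE hone.
rewrite tevE -[LHS]tlift_pure; apply: eq_tlift => h q0.
by rewrite hone /= mulr1.
Qed.

Fact endo_coactM (a b : B) : endo_coact (a * b) =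
  \swd_(h \ot x <- endo_coact a) \swd_(k \ot y <- endo_coact b)
    ((h * k) \ot (x * y)).
Proof.
apply: (@tev_inj _ _ _ Q (reg H) Q) => q; rewrite endo_coactE hmulE -endo_coactE.
by rewrite -tev_bact_coact.
Qed.

Definition endo_comod : comodAlg H :=
  @ComodAlg K H B endo_coact endo_coactP endo_coact1 endo_coactM.

End EndoComod.

(** * Morita equivalence defined by a progenerator *)

(** Dual bases witnessing that [Q] is projective and a generator. *)
Definition progenerator (K : fieldType) (A : falgType K) (Q : lmod A) : Prop :=
  (exists n (v : 'I_n -> homs Q (reg A)) (s : 'I_n -> Q),
     forall q, \sum_j lact (hfun (v j) q) (s j) = q) /\
  (exists n (v : 'I_n -> homs Q (reg A)) (s : 'I_n -> Q),
     \sum_j hfun (v j) (s j) = 1 :> A).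

Section HomFunctor.
Variables (K : fieldType) (H : hopfAlg K) (A : comodAlg H) (Q : hopfMod A).
Notation B := (endo_comod Q).

Definition hmodB (N : lmod A) : lmod B := hmod Q N.

Definition hpost_lfun (M N : lmod A) (g : lmod_hom M N) :
  'Hom(hmodB M, hmodB N) := linfun (@hpost _ A Q M N g).

Lemma hpost_lfunE M N (g : lmod_hom M N) (f : homs Q M) :
  hpost_lfun g f = hpost g f.
Proof. exact: lfunE. Qed.

Fact hfhom_subproof (M N : lmod A) (g : lmod_hom M N) (b : B) (f : hmodB M) :
  hpost_lfun g (lact b f) = lact b (hpost_lfun g f).
Proof.
by rewrite !hpost_lfunE; apply: homs_eq => q; rewrite !(hpostE, bactE).
Qed.
Definition hfhom M N g : lmod_hom (hmodB M) (hmodB N) :=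
  LmodHom (@hfhom_subproof M N g).

Fact hfhom_id (M : lmod A) : hfhom (hom_id M) =1 id.
Proof. by move=> f; rewrite /= hpost_lfunE hpost_id. Qed.

Fact hfhom_comp (M N P : lmod A) (g : lmod_hom N P) (f : lmod_hom M N) :
  hfhom (hom_comp g f) =1 hfhom g \o hfhom f.
Proof.
move=> x; rewrite /= !hpost_lfunE; apply: homs_eq => q.
by rewrite !hpostE /= comp_lfunE.
Qed.

Fact hfhom_linear (M N : lmod A) (c : K) (f g h : lmod_hom M N) :
  (forall m, h m = c *: f m + g m) ->
  forall m, hfhom h m = c *: hfhom f m + hfhom g m.
Proof.
move=> e x; rewrite /= !hpost_lfunE; apply: homs_eq => q.
by rewrite hfunD hfunZ !hpostE e.
Qed.

Definition hfunctor : lin_functor A B :=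
  LinFunctor hfhom_id hfhom_comp hfhom_linear.

Fact hstr_subproof (Y : lmod H) (M : lmod A) (b : B) (f : hmodB (tmod Y M)) :
  (hom_tens Q Y M : 'Hom(hmodB (tmod Y M), tmod Y (hmodB M))) (lact b f) =
  lact b ((hom_tens Q Y M : 'Hom(hmodB (tmod Y M), tmod Y (hmodB M))) f).
Proof.
apply: (@tev_inj _ _ _ Q Y M) => q.
by rewrite tev_hom_tens bactE [RHS]tev_bact_coact tev_hom_tens.
Qed.
Definition hstr Y M : lmod_hom (hfunctor (tmod Y M)) (tmod Y (hfunctor M) : lmod B) :=
  LmodHom (@hstr_subproof Y M).

Fact hstr_bij Y M : bijective (hstr Y M).
Proof. by exists (tens_hom Q Y M); [apply: hom_tensK | apply: tens_homK]. Qed.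

Fact hstr_nat (Y Y' : lmod H) (M M' : lmod A)
      (f : lmod_hom Y Y') (g : lmod_hom M M') :
    hstr Y' M' \o fhom hfunctor (tmod_hom f g) =1
    tmod_hom f (fhom hfunctor g) \o hstr Y M.
Proof.
move=> x /=; apply: (@tev_inj _ _ _ Q Y' M') => q.
rewrite hpost_lfunE tev_hom_tens hpostE /= !lfunE /=.
have -> : tmap f (hpost_lfun g) (hom_tens Q Y M x) =
    tmap f (hpost g) (hom_tens Q Y M x).
  by apply: eq_tmap => // u; rewrite hpost_lfunE.
by rewrite tev_nat tev_hom_tens.
Qed.

Fact hstr_assoc (Y Z : lmod H) (M : lmod A) :
    tmod_assoc Y Z (hfunctor M) \o hstr (hmod_tens Y Z) M =1
    tmod_hom (hom_id Y) (hstr Z M) \o hstr Y (tmod Z M)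
      \o fhom hfunctor (tmod_assoc Y Z M).
Proof.
move=> x /=; rewrite lfunE /= hpost_lfunE lfunE /=.
apply: (can_inj (tmap_can (linearP idfun) (linearP (hom_tens Q Z M))
    (fun x => erefl x) (@tens_homK _ _ _ Q Z M))).
apply: (@tev_inj _ _ _ Q Y (tmod Z M)) => q.
rewrite tev_assoc tev_hom_tens.
rewrite [tmap _ _ (tmap _ _ _)]tmap_comp; linear_side.
have -> : tmap (idfun \o (\1%VF : 'End(Y))) (tens_hom Q Z M \o hom_tens Q Z M)
    (hom_tens Q Y (tmod Z M) (hpost (tmod_assoc Y Z M) x)) =
    hom_tens Q Y (tmod Z M) (hpost (tmod_assoc Y Z M) x).
  by rewrite -[RHS]tmap_id; apply: eq_tmap => u; rewrite /= ?id_lfunE ?hom_tensK.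
by rewrite tev_hom_tens hpostE /= lfunE.
Qed.

Fact hstr_unit (M : lmod A) :
    tmod_unit (hfunctor M) \o hstr (hmod_unit H) M =1
    fhom hfunctor (tmod_unit M).
Proof.
move=> x /=; rewrite lfunE /= hpost_lfunE; apply: homs_eq => q.
by rewrite -tev_unit tev_hom_tens hpostE /= lfunE.
Qed.

Definition Hom_functor : mod_functor A B :=
  ModFunctor hstr_bij hstr_nat hstr_assoc hstr_unit.

End HomFunctor.

Section Morita.
Variables (K : fieldType) (H : hopfAlg K) (A : comodAlg H) (Q : hopfMod A).
Notation B := (endo_comod Q).
Notation F := (hfunctor Q).

Definition act_on (M : lmod A) (p : homs Q (reg A)) (m : M) : homs Q M :=
  mkhom (linfun (fun q => lact (hfun p q : A) m)).

Lemma act_onE (M : lmod A) (p : homs Q (reg A)) (m : M) q :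
  hfun (act_on p m) q = lact (hfun p q : A) m.
Proof.
rewrite mkhomE //; first by move=> c s t; rewrite linearP lact_linear_l.
by move=> a x; rewrite hfunP /= actM //; apply: lactP.
Qed.

Section Generator.
Variables (n : nat) (v : 'I_n -> homs Q (reg A)) (s : 'I_n -> Q).
Hypothesis gen : \sum_j hfun (v j) (s j) = 1 :> A.

Lemma gen_sum (M : lmod A) (m : M) : \sum_j hfun (act_on (v j) m) (s j) = m.
Proof.
rewrite -[RHS](act1 (lactP M)) -gen (lin_sum (lact_linear_l m)).
by apply: eq_bigr => j _; rewrite act_onE.
Qed.

Lemma hfunctor_faithful (M N : lmod A) (f g : lmod_hom M N) :
  fhom F f =1 fhom F g -> f =1 g.
Proof.
move=> e m; rewrite -(gen_sum m) !linear_sum; apply: eq_bigr => j _ /=.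
have := congr1 (fun u : homs Q N => hfun u (s j)) (e (act_on (v j) m)).
by rewrite /= !hpost_lfunE !hpostE.
Qed.

(** Every [m] is a sum of values [phi(s_j)] of maps [phi] from [Q], so a map
    between Hom spaces prescribes a map between modules.  Linearity over the
    endomorphisms, applied to those of the form [q' |-> v_j(q') q], shows that
    the prescription is [g(phi)(q)] for every [phi] and [q], hence consistent. *)
Lemma hfunctor_full (M N : lmod A) (g : lmod_hom (F M) (F N)) :
  exists f : lmod_hom M N, fhom F f =1 g.
Proof.
pose G (u : homs Q M) : homs Q N := g u.
pose f0 m := \sum_j hfun (G (act_on (v j) m)) (s j).
have f0E (u : homs Q M) q : f0 (hfun u q) = hfun (G u) q.
  rewrite /f0.
  transitivity (\sum_j hfun (G u) (hfun (act_on (v j) q) (s j))).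
    apply: eq_bigr => j _.
    have -> : act_on (v j) (hfun u q) = bact (act_on (v j) q : endo Q) u.
      by apply: homs_eq => q'; rewrite bactE !act_onE hfunP.
    have -> : G (bact (act_on (v j) q : endo Q) u) = bact (act_on (v j) q : endo Q) (G u).
      exact: (homP g (act_on (v j) q : endo Q) u).
    by rewrite bactE.
  by rewrite -linear_sum gen_sum.
have f0l : linear f0.
  move=> c x y; rewrite /f0 scaler_sumr -big_split; apply: eq_bigr => j _ /=.
  rewrite -hfunZ -hfunD; congr (hfun _ _); rewrite /G -linearP; congr (g _).
  apply: homs_eq => q; rewrite hfunD hfunZ !act_onE; exact: linearP.
have f0A a m : f0 (lact a m) = lact a (f0 m).
  rewrite -{1}(gen_sum m) linear_sum (lin_sum f0l) linear_sum.
  by apply: eq_bigr => j _; rewrite /= -hfunP f0E hfunP.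
have fA a m : linfun f0 (lact a m) = lact a (linfun f0 m) by rewrite !linfunE.
exists (LmodHom fA) => u; rewrite /= hpost_lfunE; apply: homs_eq => q.
by rewrite (hpostE (LmodHom fA)) /= linfunE // f0E.
Qed.

End Generator.

Section Projective.
Variables (n : nat) (v : 'I_n -> homs Q (reg A)) (s : 'I_n -> Q).
Hypothesis proj : forall q, \sum_j lact (hfun (v j) q : A) (s j) = q.
Variable N : lmod B.

Notation P := (F (reg A)).

Definition dual_act (a : A) (f : homs P N) : homs P N :=
  mkhom (hfun f \o fhom F (rmulh a))%VF.

Lemma dual_actE a f (p : P) : hfun (dual_act a f) p = hfun f (hpost (rmulh a) p).
Proof.
rewrite mkhomK => [|b x]; rewrite !comp_lfunE ?homP ?hfunP //.
by rewrite -hpost_lfunE.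
Qed.

Fact dual_actP : is_action dual_act.
Proof.
split=> [|f|a b f].
- split=> [a|f] c x y; apply: homs_eq => p; rewrite hfunD hfunZ !dual_actE.
    by rewrite hfunD hfunZ.
  rewrite -linearP; congr (hfun f _); apply: homs_eq => q.
  by rewrite hfunD hfunZ !hpostE !rmulhE mulrDr -scalerAr.
- apply: homs_eq => p; rewrite dual_actE; congr (hfun f _); apply: homs_eq => q.
  by rewrite hpostE rmulhE mulr1.
apply: homs_eq => p; rewrite !dual_actE; congr (hfun f _); apply: homs_eq => q.
by rewrite !hpostE !rmulhE mulrA.
Qed.

(** The preimage of a [B]-module [N] is [Hom_B(Hom_A(Q, A), N)], on which [A]
    acts by right multiplication on its own copy. *)
Definition dual : lmod A := Lmod dual_actP.

Definition coev_inv (f : F dual) : N :=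
  \sum_j hfun (hfun (f : homs Q dual) (s j) : homs P N) (v j).

(** Built from the pairing of [p] and [q] with values in [B], which is the
    endomorphism [q' |-> p(q') q]. *)
Definition coev0 (x : N) (q : Q) : dual :=
  mkhom (linfun (fun p : P => lact (act_on p q : B) x)).

Lemma coev0E x q (p : P) : hfun (coev0 x q : homs P N) p = lact (act_on p q : B) x.
Proof.
rewrite mkhomE // => [c y z|b y].
  rewrite -lact_linear_l; congr (lact _ x); apply: (@homs_eq _ _ Q Q) => r.
  by rewrite hfunD hfunZ !act_onE hfunD hfunZ lact_linear_l.
rewrite -actM; last exact: lactP.
congr (lact _ x); apply: (@homs_eq _ _ Q Q) => r.
by rewrite hmulE !act_onE bactE.
Qed.

Definition coev (x : N) : F dual := mkhom (linfun (coev0 x)).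

Lemma coevE x q : hfun (coev x : homs Q dual) q = coev0 x q.
Proof.
rewrite mkhomE // => [c y z|a y]; apply: (@homs_eq _ _ P N) => p.
  rewrite hfunD hfunZ !coev0E -lact_linear_l; congr (lact _ x).
  apply: (@homs_eq _ _ Q Q) => r; rewrite hfunD hfunZ !act_onE; exact: linearP.
rewrite dual_actE !coev0E; congr (lact _ x); apply: (@homs_eq _ _ Q Q) => r.
by rewrite !act_onE hpostE rmulhE actM //; apply: lactP.
Qed.

Lemma coevK : cancel coev coev_inv.
Proof.
move=> x; rewrite /coev_inv -[RHS](act1 (lactP N)).
transitivity (lact (\sum_j act_on (v j) (s j) : B) x).
  by rewrite (lin_sum (lact_linear_l x)); apply: eq_bigr => j _; rewrite coevE coev0E.
congr (lact _ x); apply: (@homs_eq _ _ Q Q) => q.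
rewrite hfun_sum hone -[RHS]proj.
by apply: eq_bigr => j _; rewrite act_onE.
Qed.

(** Linearity over [B] of [f(s_j)], applied to the endomorphism
    [r |-> p(r) q], moves [p] and [q] past the dual basis, which then sums to
    [q] by projectivity. *)
Lemma coev_invK : cancel coev_inv coev.
Proof.
move=> f; apply: (@homs_eq _ _ Q dual) => q; rewrite coevE.
apply: (@homs_eq _ _ P N) => p; rewrite coev0E /coev_inv linear_sum.
rewrite -{2}(proj q) linear_sum hfun_sum; apply: eq_bigr => j _.
rewrite /= (hfunP (f : homs Q dual)) [RHS]dual_actE.
rewrite -[LHS](hfunP (hfun (f : homs Q dual) (s j) : homs P N)).
congr (hfun _ _); apply: homs_eq => r.
by rewrite bactE act_onE hpostE rmulhE hfunP.
Qed.

Lemma coev_linear : linear coev.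
Proof.
move=> c x y; apply: (@homs_eq _ _ Q dual) => q; rewrite hfunD hfunZ !coevE.
apply: (@homs_eq _ _ P N) => p; rewrite hfunD hfunZ !coev0E; exact: linearP.
Qed.

Lemma coev_act (b : B) x : coev (lact b x) = lact b (coev x).
Proof.
apply: (@homs_eq _ _ Q dual) => q; rewrite bactE !coevE.
apply: (@homs_eq _ _ P N) => p; rewrite !coev0E -actM; last exact: lactP.
congr (lact _ x); apply: (@homs_eq _ _ Q Q) => r.
by rewrite hmulE !act_onE hfunP.
Qed.

Lemma hfunctor_ess_surj :
  exists M : lmod A, exists i : lmod_hom (F M) N, bijective i.
Proof.
have ul : linear coev_inv.
  move=> c f g; apply: (can_inj coevK); rewrite coev_linear.
  by rewrite !coev_invK.
have uA (b : B) f : linfun coev_inv (lact b f) = lact b (linfun coev_inv f).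
  by rewrite !linfunE //; apply: (can_inj coevK); rewrite coev_act !coev_invK.
exists dual, (LmodHom uA); exists coev => x; rewrite /= linfunE //.
  exact: coev_invK.
exact: coevK.
Qed.

End Projective.

Theorem progenerator_Morita : progenerator Q -> equivariant_Morita A B.
Proof.
move=> [[n [v [s proj]]] [n' [v' [s' gen]]]].
exists (Hom_functor Q); split.
- exact: hfunctor_full gen.
- exact: hfunctor_faithful gen.
- exact: hfunctor_ess_surj proj.
Qed.

End Morita.

(** * The Hopf module defined by a Morita equivalence *)

Section Evaluation.
Variables (K : fieldType) (H : hopfAlg K).

Lemma hom_compE (A : falgType K) (M N P : lmod A)
    (g : lmod_hom N P) (f : lmod_hom M N) m : hom_comp g f m = g (f m).
Proof. exact: comp_lfunE. Qed.

Lemma tmod_homE (B : comodAlg H) (Y Y' : lmod H) (M M' : lmod B)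
    (f : lmod_hom Y Y') (g : lmod_hom M M') t : tmod_hom f g t = tmap f g t.
Proof. exact: lfunE. Qed.

Lemma tmod_assocE (B : comodAlg H) (Y Z : lmod H) (M : lmod B) t :
  tmod_assoc Y Z M t = tassoc t.
Proof. exact: lfunE. Qed.

Lemma hom_idE (B : falgType K) (M : lmod B) m : hom_id M m = m.
Proof. exact: id_lfunE. Qed.

Lemma tmod_unitE (B : comodAlg H) (M : lmod B) t : tmod_unit M t = tunit t.
Proof. exact: lfunE. Qed.

Lemma tunit_bilin (V : vectType K) : bilin (fun (x : K^o) (v : V) => (x : K) *: v).
Proof. by split=> [y|v] b s t; rewrite ?linearP //= scalerDl scalerA. Qed.

Lemma counit_bilin (V : vectType K) : bilin (fun (x : H) (v : V) => counit x *: v).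
Proof. by split=> [y|v] c s t; rewrite ?linearP //= scalerDl scalerA. Qed.

End Evaluation.

Lemma comodAlg_isomI (K : fieldType) (H : hopfAlg K) (A B : comodAlg H)
    (f : A -> B) :
  linear f -> f 1 = 1 -> (forall a b, f (a * b) = f a * f b) -> bijective f ->
  (forall a, coact (f a) = tmap id f (coact a)) -> comodAlg_isom A B.
Proof.
move=> fl f1 fM [g fK gK] fC.
have fh : ahom_in {:A} (linfun f).
  by apply/ahom_inP; split=> [a b _ _|]; rewrite !linfunE.
exists (AHom fh); split=> [|a].
  by exists g => x; rewrite /= linfunE.
rewrite /= linfunE // fC; apply: eq_tmap => // x; by rewrite linfunE.
Qed.

Lemma comodAlg_isom_trans (K : fieldType) (H : hopfAlg K) (A B C : comodAlg H) :
  comodAlg_isom A B -> comodAlg_isom B C -> comodAlg_isom A C.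
Proof.
move=> [f [fb fC]] [g [gb gC]].
apply: (@comodAlg_isomI _ _ A C (g \o f)).
- by move=> c x y; rewrite /= !linearP.
- by rewrite /= !rmorph1.
- by move=> x y; rewrite /= !rmorphM.
- exact: bij_comp.
move=> a; rewrite /= gC fC tmap_comp //; exact: linearP.
Qed.

Section Quotient.
Variables (K : fieldType) (A : falgType K) (M : lmod A) (U : {vspace M}).
Hypothesis UA : forall a u, u \in U -> lact a u \in U.

Let pr (m : M) : subvs_of (U^C)%VS := vsproj (U^C)%VS (daddv_pi (U^C)%VS U m).

Let pr_lin : linear pr.
Proof. by move=> c x y; rewrite /pr !linearP. Qed.

Let capCU : ((U^C :&: U) = 0)%VS.
Proof. by rewrite capvC capv_compl. Qed.

Let pr_sub m : m - vsval (pr m) \in U.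
Proof.
rewrite /pr vsprojK ?memv_pi //.
have mUC : m \in (U^C + U)%VS by rewrite addvC addv_complf memvf.
rewrite -{1}(daddv_pi_add capCU mUC) addrAC subrr add0r; exact: memv_pi.
Qed.

Let pr0 u : u \in U -> pr u = 0.
Proof.
move=> uU; apply: val_inj; apply/eqP; rewrite -memv0 -capCU memv_cap subvsP /=.
by have := memvB uU (pr_sub u); rewrite subKr.
Qed.

Let qact (a : A) (n : subvs_of (U^C)%VS) := pr (lact a (vsval n)).

Let qactP : is_action qact.
Proof.
split=> [|n|a b n].
- split=> [a|n] c x y; first by rewrite /qact !linearP pr_lin.
  by rewrite /qact lact_linear_l pr_lin.
- rewrite /qact act1; last exact: lactP.
  apply: val_inj => /=; rewrite /pr vsprojK ?memv_pi //.
  by rewrite daddv_pi_id // subvsP.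
rewrite /qact actM; last exact: lactP.
apply/eqP; rewrite -subr_eq0; apply/eqP.
rewrite -(linearB (mklin pr_lin)) /= -linearB; apply: pr0; apply: UA.
exact: pr_sub.
Qed.

(** The quotient by [U], carried by a complement of [U]; it serves to show that
    families of module maps are jointly surjective. *)
Lemma quotient_lmod : U <> fullv -> exists (N : lmod A) (p : lmod_hom M N),
  (forall u, u \in U -> p u = 0) /\ exists m, p m != 0.
Proof.
move=> Uf; pose N := Lmod qactP.
have pA (a : A) (m : M) : linfun (pr : M -> N) (lact a m) = lact a (linfun (pr : M -> N) m).
  rewrite !linfunE // /= /qact; apply/eqP; rewrite -subr_eq0; apply/eqP.
  rewrite -(linearB (mklin pr_lin)) /= -linearB; apply: pr0; apply: UA.
  exact: pr_sub.
exists N, (LmodHom pA); split=> [u uU|]; first by rewrite /= linfunE // pr0.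
have [m _ mU] : exists2 m, m \in fullv & m \notin U.
  by apply/subvPn; apply/negP => s; apply: Uf; apply/eqP; rewrite eqEsubv subvf.
exists m; apply: contra mU; rewrite /= linfunE // => /eqP e.
by have := pr_sub m; rewrite e subr0.
Qed.

End Quotient.

Lemma lmod_hom_inv (K : fieldType) (A : falgType K) (M N : lmod A)
    (f : lmod_hom M N) : bijective f ->
  exists g : lmod_hom N M, cancel f g /\ cancel g f.
Proof.
move=> [g fK gK].
have gl : linear g by move=> c x y; apply: (can_inj fK); rewrite linearP /= !gK.
have gA a n : linfun g (lact a n) = lact a (linfun g n).
  by rewrite !linfunE //; apply: (can_inj fK); rewrite homP !gK.
by exists (LmodHom gA); split=> x; rewrite /= linfunE // ?fK ?gK.
Qed.

Section MoritaCoaction.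
Variables (K : fieldType) (H : hopfAlg K) (A X : comodAlg H) (F : mod_functor A X).
Hypothesis Feq : is_equivalence F.

Lemma F_full (M N : lmod A) (g : lmod_hom (F M) (F N)) :
  exists f : lmod_hom M N, fhom F f =1 g.
Proof. by case: Feq => full _ _; apply: full. Qed.

Lemma F_faithful (M N : lmod A) (f g : lmod_hom M N) :
  fhom F f =1 fhom F g -> f =1 g.
Proof. by case: Feq => _ faithful _; apply: faithful. Qed.

Definition Fh (M N : lmod A) (f : homs M N) : 'Hom(F M, F N) := fhom F (hom_of f).

Lemma Fh_linear M N : linear (@Fh M N).
Proof.
move=> c f g; apply/lfunP => z; rewrite add_lfunE scale_lfunE.
by apply: fhom_linear => m; apply: (hfun_lin m).
Qed.
HB.instance Definition _ M N := GRing.isLinear.Build K _ _ _ (@Fh M N) (@Fh_linear M N).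

Lemma fhom_ext (M N : lmod A) (f g : lmod_hom M N) : f =1 g -> fhom F f =1 fhom F g.
Proof.
move=> e z; have h m : f m = 0 *: f m + g m by rewrite scale0r add0r.
by rewrite (@fhom_linear _ _ _ F M N 0 f g f h z) scale0r add0r.
Qed.

Lemma hom_of_mkhom (M N : lmod A) (f : lmod_hom M N) : hom_of (mkhom f) =1 f.
Proof. by move=> m; rewrite /= mkhomK //; apply: homP. Qed.

Lemma F_eq0 (M N : lmod A) (f : lmod_hom M N) :
  (forall z, fhom F f z = 0) -> forall m, f m = 0.
Proof.
move=> f0 m; rewrite -(hom_of_mkhom f); have -> : mkhom f = 0 :> homs M N.
  apply: homs_eq => {}m.
  have : hom_of (mkhom f) =1 hom_of (0 : homs M N).
    apply: F_faithful => z; rewrite (fhom_ext (hom_of_mkhom f)) f0.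
    by rewrite -[RHS]/(Fh 0 z) linear0 zero_lfunE.
  exact.
exact: (lin_zero (hfun_lin m)).
Qed.

Lemma F_0 (M N : lmod A) (f : lmod_hom M N) :
  (forall m, f m = 0) -> forall z, fhom F f z = 0.
Proof.
move=> f0 z; transitivity (Fh (0 : homs M N) z); last by rewrite linear0 zero_lfunE.
by apply: fhom_ext => m; rewrite f0 [RHS](lin_zero (hfun_lin m)).
Qed.

Lemma F_comp (M N P : lmod A) (g : lmod_hom N P) (f : lmod_hom M N) z :
  fhom F (hom_comp g f) z = fhom F g (fhom F f z).
Proof. exact: fhom_comp. Qed.

Variables (Q : lmod A) (i : lmod_hom (F Q) (reg X)) (j : lmod_hom (reg X) (F Q)).
Hypotheses (iK : cancel i j) (jK : cancel j i).

Definition strX (Y : lmod H) : lmod_hom (F (tmod Y Q)) (tmod Y (reg X)) :=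
  hom_comp (tmod_hom (hom_id Y) i) (mf_str F Y Q).

Lemma strXE Y z : strX Y z = tmap id i (mf_str F Y Q z).
Proof. by rewrite /= comp_lfunE lfunE; apply: eq_tmap => y //=; rewrite id_lfunE. Qed.

Lemma strX_bij Y : bijective (strX Y).
Proof.
have [c cK cVK] := mf_str_bij F Y Q.
have k1 : cancel (tmap (id : Y -> Y) i) (tmap id j).
  by apply: tmap_can => //; exact: linearP.
have k2 : cancel (tmap (id : Y -> Y) j) (tmap id i).
  by apply: tmap_can => //; exact: linearP.
exists (c \o tmap id j) => z.
  change (c (tmap id j (strX Y z)) = z); by rewrite strXE k1 cK.
change (strX Y (c (tmap id j z)) = z); by rewrite strXE cVK k2.
Qed.

Fact coactX_subproof (x : X) (y : reg X) :
  linfun (coact : reg X -> tmod (reg H) (reg X)) (lact x y) =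
  lact x (linfun (coact : reg X -> tmod (reg H) (reg X)) y).
Proof. by rewrite !lfunE /= coactM /tact. Qed.
Definition coactX : lmod_hom (reg X) (tmod (reg H) (reg X)) :=
  LmodHom coactX_subproof.

(** The coaction of [X], seen as a module map [X -> H (x) X], is the image
    under the equivalence of a map [Q -> H (x) Q]. *)
Lemma ex_Morita_coact : exists d : lmod_hom Q (tmod (reg H) Q),
  forall z, strX (reg H) (fhom F d z) = coact (i z : X).
Proof.
have [k [kK kVK]] := lmod_hom_inv (strX_bij (reg H)).
have [d dE] := F_full (hom_comp k (hom_comp coactX i)).
by exists d => z; rewrite dE hom_compE kVK hom_compE /= lfunE.
Qed.

End MoritaCoaction.

Section MoritaCoactionAxioms.
Variables (K : fieldType) (H : hopfAlg K) (A X : comodAlg H) (F : mod_functor A X).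
Hypothesis Feq : is_equivalence F.
Variables (Q : lmod A) (i : lmod_hom (F Q) (reg X)) (j : lmod_hom (reg X) (F Q)).
Hypotheses (iK : cancel i j) (jK : cancel j i).
Variable d : lmod_hom Q (tmod (reg H) Q).
Hypothesis dE : forall z, strX i (reg H) (fhom F d z) = coact (i z : X).

Let dE' z : tmap id i (mf_str F (reg H) Q (fhom F d z)) = coact (i z : X).
Proof. by rewrite -strXE dE. Qed.

Lemma str_nat (Y Y' : lmod H) (M M' : lmod A)
      (f : lmod_hom Y Y') (g : lmod_hom M M') z :
  mf_str F Y' M' (fhom F (tmod_hom f g) z) = tmap f (fhom F g) (mf_str F Y M z).
Proof. by have := @mf_str_nat _ _ _ _ F _ _ _ _ f g z; rewrite /= lfunE. Qed.

Lemma str_assoc (Y Z : lmod H) (M : lmod A) z :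
  tmap id (mf_str F Z M) (mf_str F Y (tmod Z M) (fhom F (tmod_assoc Y Z M) z)) =
  tassoc (mf_str F (hmod_tens Y Z) M z).
Proof.
have := @mf_str_assoc _ _ _ _ F Y Z M z; rewrite /= !lfunE /= => ->.
by apply: eq_tmap => // y; rewrite id_lfunE.
Qed.

(** Both sides are module maps, so by faithfulness they may be compared after
    [F]; there the tensor structure turns the identity into coassociativity of
    [X]. *)
Lemma Morita_coact_coassoc m : tassoc (tmap comul id (d m)) = tmap id d (d m).
Proof.
pose L := hom_comp (tmod_assoc (reg H) (reg H) Q)
  (hom_comp (tmod_hom (comulh H) (hom_id Q)) d).
pose R := hom_comp (tmod_hom (hom_id (reg H)) d) d.
have LE q : L q = tassoc (tmap comul id (d q)).
  rewrite !hom_compE tmod_assocE tmod_homE; congr (tassoc _).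
  by apply: eq_tmap => x; rewrite ?hom_idE //= lfunE.
have RE q : R q = tmap id d (d q).
  by rewrite hom_compE tmod_homE; apply: eq_tmap => x //; rewrite hom_idE.
rewrite -LE -RE; suff: fhom F L =1 fhom F R by move/(F_faithful Feq); apply.
move=> z; have inj1 : injective (mf_str F (reg H) (tmod (reg H) Q)).
  exact: bij_inj (mf_str_bij F _ _).
have [c [cK cVK]] := lmod_hom_inv (mf_str_bij F (reg H) Q).
have k2 : cancel (tmap id (mf_str F (reg H) Q) :
    tens H (F (tmod (reg H) Q)) -> tens H (tens H (F Q))) (tmap id c).
  by apply: tmap_can => //; exact: linearP.
have k3 : cancel (tmap id i : tens H (F Q) -> tens H X) (tmap id j).
  by apply: tmap_can => //; exact: linearP.
have k4 : cancel (tmap id (tmap id i) : tens H (tens H (F Q)) -> tens H (tens H X))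
    (tmap id (tmap id j)).
  by apply: tmap_can => //; exact: linearP.
apply: inj1; apply: (can_inj k2); apply: (can_inj k4).
rewrite !F_comp (@str_assoc (reg H) (reg H) Q) !str_nat.
transitivity (tassoc (tmap comul id (coact (i z : X)))).
  rewrite -dE'; move: (mf_str F _ _ _); apply: tens_ext => [||h q].
  - by move=> a s t; rewrite !linearP.
  - by move=> a s t; rewrite !linearP.
  rewrite !tmap_lin; linear_side.
  rewrite fhom_id [comulh H h]lfunE /=.
  elim/tens_ind: (comul h) => [h1 h2|s t IHs IHt].
    rewrite !tassocE !tmap_lin //; exact: linearP.
  by rewrite !pureDl !linearD /= IHs IHt.
rewrite (coactA (coactP X)) -dE'.
rewrite !tmap_comp; linear_side.
apply: eq_tmap => h /=; first by rewrite id_lfunE.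
by rewrite dE'.
Qed.

Lemma Morita_coact_counit m : \swd_(h \ot x <- d m) (counit h *: x) = m.
Proof.
pose L := hom_comp (tmod_unit Q) (hom_comp (tmod_hom (counith H) (hom_id Q)) d).
have LE q : L q = \swd_(h \ot x <- d q) (counit h *: x).
  rewrite !hom_compE tmod_unitE tmod_homE [LHS]tlift_tmap; last exact: tunit_bilin.
  by apply: eq_tlift => h x; rewrite hom_idE /= lfunE.
rewrite -LE; suff: fhom F L =1 fhom F (hom_id Q).
  by move/(F_faithful Feq) => ->; rewrite hom_idE.
move=> z; rewrite fhom_id !F_comp -(@mf_str_unit _ _ _ _ F Q) /= -[LHS]/(tmod_unit _ _).
rewrite tmod_unitE str_nat; apply: (can_inj iK).
rewrite -[RHS](coact_counit (coactP X)) -dE'.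
rewrite [RHS]tlift_tmap; last by split=> [y|v] b s t; rewrite ?linearP //= scalerDl scalerA.
rewrite [tunit _]tlift_tmap; last exact: tunit_bilin.
rewrite linear_tlift; apply: eq_tlift => h q /=.
by rewrite fhom_id lfunE linearZ.
Qed.

End MoritaCoactionAxioms.

Section MoritaDualBases.
Variables (K : fieldType) (H : hopfAlg K) (A X : comodAlg H) (F : mod_functor A X).
Hypothesis Feq : is_equivalence F.
Variables (Q : lmod A) (i : lmod_hom (F Q) (reg X)) (j : lmod_hom (reg X) (F Q)).
Hypotheses (iK : cancel i j) (jK : cancel j i).

Let z0 : F Q := j (1 : X).

Lemma i_z0 : i z0 = 1 :> X.
Proof. exact: jK. Qed.

Lemma z0_gen z : z = lact (i z : X) z0.
Proof. by apply: (can_inj iK); rewrite homP i_z0 /= mulr1. Qed.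

(** A linear functor sends zero modules to zero modules. *)
Lemma preimage_reg_neq0 (M : lmod X) : (exists m : M, m != 0) -> forall k : lmod_hom (F Q) M,
  bijective k -> exists q : Q, q != 0.
Proof.
move=> [m mn0] k [k' kK k'K].
have [Q0|Qn0] := eqVneq (fullv : {vspace Q}) 0%VS; last first.
  by exists (vpick fullv); rewrite vpick0.
suff e0 : forall z : F Q, z = 0 by case/eqP: mn0; rewrite -(k'K m) (e0 (k' m)) linear0.
move=> z; rewrite -[LHS](@fhom_id _ _ _ F Q); apply: F_0 => q.
by apply/eqP; rewrite -memv0 -Q0 memvf.
Qed.

Section Psi.

(** The identification of the endomorphisms of [Q] with [X]: an endomorphism of
    the regular module [X = F(Q)] is the right multiplication by its value at 1. *)
Definition psi (f : homs Q Q) : X := i (Fh F f z0).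

Lemma psi_linear : linear psi.
Proof. by move=> c f g; rewrite /psi linearP add_lfunE scale_lfunE linearP. Qed.

Lemma i_Fh (f : homs Q Q) z : i (Fh F f z) = (i z : X) * psi f.
Proof. by rewrite {1}(z0_gen z) [Fh F f _]homP homP. Qed.

Lemma psi_inj : injective psi.
Proof.
move=> f g e; have : hom_of f =1 hom_of g.
  apply: (F_faithful Feq) => z; apply: (can_inj iK).
  by rewrite -[LHS]/(i (Fh F f z)) -[RHS]/(i (Fh F g z)) !i_Fh e.
by move=> e'; apply: homs_eq.
Qed.

Lemma psi_surj x : exists f, psi f = x.
Proof.
have [f fE] := F_full Feq (hom_comp j (hom_comp (rmulh x) i)).
exists (mkhom f); rewrite /psi /Fh (fhom_ext (hom_of_mkhom f)) fE !hom_compE.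
by rewrite jK rmulhE i_z0 mul1r.
Qed.

End Psi.

Section Proj.

Definition orb (q : Q) : homs (reg A) Q := mkhom (linfun (fun a : reg A => lact (a : A) q)).

Lemma orbE q a : hfun (orb q) a = lact (a : A) q.
Proof.
by rewrite mkhomE // => [|b x]; [apply: lact_linear_l | rewrite /= actM //; apply: lactP].
Qed.

(** Elements [z] of [F(A)] correspond to module maps [Q -> A], because
    [X -> F(A)], [x |-> x z], has the form [F(p)]. *)
Lemma ex_hom_reg (z : F (reg A)) : exists p : homs Q (reg A),
  forall y, Fh F p y = lact (i y : X) z.
Proof.
have gl : linear (fun y => lact (i y : X) z).
  by move=> c x y; rewrite linearP lact_linear_l.
have gA (x : X) y : linfun (fun y => lact (i y : X) z) (lact x y) =
    lact x (linfun (fun y => lact (i y : X) z) y).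
  by rewrite !linfunE // homP /= actM //; apply: lactP.
have [f fE] := F_full Feq (LmodHom gA).
exists (mkhom f) => y.
by rewrite /Fh (fhom_ext (hom_of_mkhom f)) fE /= linfunE.
Qed.

(** The images under [F] of the maps [a |-> a q] generate [F(Q) = X]: otherwise
    a nonzero map from [X] to a quotient would come from a map on [Q] vanishing
    at every [q].  Writing 1 as a sum of elements of these images gives the dual
    basis. *)
Lemma Morita_projective : exists n (v : 'I_n -> homs Q (reg A)) (s : 'I_n -> Q),
     forall q, \sum_j lact (hfun (v j) q) (s j) = q.
Proof.
pose J : {vspace reg X} := (\sum_(k < dim Q) limg (i \o Fh F (orb (bvec k))))%VS.
have Jfull : J = fullv.
  have [//|/eqP Jn] := eqVneq J fullv.
  have JA (x : X) u : u \in J -> lact x u \in J.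
    case/memv_sumP=> w wJ ->; rewrite linear_sum; apply: memv_sumr => k _ /=.
    have /memv_imgP[y _ ->] := wJ k isT.
    have := memv_img (i \o Fh F (orb (bvec k)))%VF (memvf (lact x y)).
    by rewrite !comp_lfunE [Fh _ _ _]homP homP.
  have [N [p [p0 [m mn0]]]] := quotient_lmod JA Jn.
  have [M [k kb]] : exists M, exists k : lmod_hom (F M) N, bijective k.
    by case: Feq => _ _; apply.
  have [k' [kK k'K]] := lmod_hom_inv kb.
  have [g gE] := F_full Feq (hom_comp k' (hom_comp p i)).
  have g0 q : g q = 0.
    suff gb l : g (bvec l) = 0.
      rewrite (vec_bvec q) linear_sum big1 // => l _.
      by rewrite linearZ /= gb scaler0.
    have := @F_eq0 _ _ _ _ _ Feq _ _ (hom_comp g (hom_of (orb (bvec l)))) _ 1.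
    rewrite hom_compE /= orbE act1; last exact: lactP.
    apply=> z; rewrite F_comp gE !hom_compE p0 ?linear0 //.
    apply: (subvP (sumv_sup l _ (subvv _))) => //.
    by rewrite -[fhom F _ z]/(Fh F (orb (bvec l)) z) -comp_lfunE memv_img ?memvf.
  case/eqP: mn0; have := F_0 (F:=F) g0 (j m); rewrite gE !hom_compE jK.
  by move/(congr1 k); rewrite k'K linear0.
have /memv_sumP[w wJ w1] : (1 : X) \in J by rewrite Jfull memvf.
have [z zE] : exists z : 'I_(dim Q) -> F (reg A),
    forall k, w k = i (Fh F (orb (bvec k)) (z k)).
  apply: (fin_all_exists (P := fun k z => w k = i (Fh F (orb (bvec k)) z))) => k.
  by have /memv_imgP[y _ ->] := wJ k isT; exists y; rewrite comp_lfunE.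
have [v vE] := fin_all_exists (fun k => ex_hom_reg (z k)).
exists (dim Q), v, (@bvec _ Q) => q.
pose f : homs Q Q := \sum_k hpost (hom_of (orb (bvec k))) (v k).
have : f = mkhom (hom_id Q).
  apply: psi_inj; rewrite /psi linear_sum sum_lfunE linear_sum.
  rewrite [RHS](congr1 _ (fhom_ext (hom_of_mkhom (hom_id Q)) z0)) fhom_id i_z0 w1.
  apply: eq_bigr => k _ /=; rewrite zE; congr (i _).
  transitivity (fhom F (hom_comp (hom_of (orb (bvec k))) (hom_of (v k))) z0).
    by apply: fhom_ext => x; rewrite hom_compE; exact: (hpostE (hom_of (orb (bvec k))) (v k) x).
  by rewrite F_comp -[fhom F (hom_of (v k)) _]/(Fh F (v k) _) vE i_z0 act1 //; apply: lactP.
move/(congr1 (fun f : homs Q Q => hfun f q)); rewrite hfun_sum => e.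
rewrite -[RHS](hom_idE (M := Q)) -[RHS](hom_of_mkhom (hom_id Q)) -[RHS]e.
by apply: eq_bigr => k _; rewrite hpostE orbE.
Qed.

(** If the images of the maps [Q -> A] did not span [A], the map to the
    quotient would be killed by [F], as every element of [F(A)] is in the image
    of some [F(v)]. *)
Lemma Morita_generator : exists n (v : 'I_n -> homs Q (reg A)) (s : 'I_n -> Q),
     \sum_j hfun (v j) (s j) = 1 :> A.
Proof.
have [v vE] := fin_all_exists (fun k : 'I_(dim (F (reg A))) => ex_hom_reg (bvec k)).
pose T : {vspace reg A} := (\sum_k limg (hfun (v k)))%VS.
have Tfull : T = fullv.
  have [//|/eqP Tn] := eqVneq T fullv.
  have TA (a : A) u : u \in T -> lact a u \in T.
    case/memv_sumP=> w wT ->; rewrite linear_sum; apply: memv_sumr => k _ /=.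
    have /memv_imgP[y _ ->] := wT k isT.
    by have := memv_img (hfun (v k)) (memvf (lact a y)); rewrite hfunP.
  have [N [p [p0 [m mn0]]]] := quotient_lmod TA Tn.
  case/eqP: mn0; apply: (F_eq0 Feq) => z.
  rewrite [z]vec_bvec linear_sum big1 // => k _; rewrite linearZ /=.
  have -> : bvec k = Fh F (v k) z0 by rewrite vE i_z0 act1 //; apply: lactP.
  rewrite /Fh -F_comp F_0 ?scaler0 // => q; rewrite hom_compE p0 //.
  apply: (subvP (sumv_sup k _ (subvv _))) => //.
  by rewrite memv_img ?memvf.
have /memv_sumP[w wT w1] : (1 : A) \in T by rewrite Tfull memvf.
have [s sE] : exists s : 'I_(dim (F (reg A))) -> Q, forall k, w k = hfun (v k) (s k).
  apply: (fin_all_exists (P := fun k s => w k = hfun (v k) s)) => k.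
  by have /memv_imgP[y _ ->] := wT k isT; exists y.
by exists (dim (F (reg A))), v, s; rewrite w1; apply: eq_bigr => k _.
Qed.

End Proj.

End MoritaDualBases.

(** Combines the coaction, the dual bases and [psi].  That [psi] is a comodule
    map is read off at [i^-1(1)], where the coaction of [X] is [1 \ot 1]. *)
Theorem Morita_progenerator (K : fieldType) (H : hopfAlg K) (A X : comodAlg H)
    (F : mod_functor A X) : is_equivalence F ->
  exists Q : hopfMod A, progenerator Q /\ comodAlg_isom (endo_comod Q) X.
Proof.
move=> Feq; have [Q [i ib]] : exists Q, exists i : lmod_hom (F Q) (reg X), bijective i.
  by case: Feq => _ _; apply.
have [j [iK jK]] := lmod_hom_inv ib.
have [d dE] := ex_Morita_coact Feq iK jK.
pose d0 : {linear Q -> tens H Q} := mklin (fun c x y => linearP d c x y).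
have dP : is_coaction d0.
  by split=> m; [apply: (Morita_coact_coassoc Feq iK dE) | apply: (Morita_coact_counit Feq iK dE)].
have dA a q : d0 (lact a q) = lact a (d0 q : tmod (reg H) Q) by apply: (homP d).
have nz : exists q : Q, q != 0.
  by apply: (preimage_reg_neq0 _ ib); exists (1 : X); apply: oner_neq0.
pose Qh := HopfMod dP dA nz; exists Qh; split.
  by split; [apply: (Morita_projective Feq iK jK) | apply: (Morita_generator Feq jK)].
apply: (@comodAlg_isomI _ _ (endo_comod Qh) X (psi i j)).
- exact: psi_linear.
- rewrite /psi /Fh -[RHS](i_z0 jK) -[in RHS](@fhom_id _ _ _ F Q (j 1)).
  by congr (i _); apply: fhom_ext => q; rewrite hom_idE; apply: (hone (Q := Qh)).
- move=> f g; rewrite -(i_Fh iK jK g) /psi /Fh; congr (i _).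
  by rewrite -F_comp; apply: fhom_ext => q; rewrite hom_compE; apply: (hmulE (Q := Qh)).
- have ex x := psi_surj Feq jK x.
  have pinj := psi_inj Feq iK jK.
  have [g [gl gK]] : exists g, cancel (psi i j) g /\ cancel g (psi i j).
    have k0 : lker (linfun (psi i j)) == 0%VS.
      by apply/lker0P => f f'; rewrite !(linfunE (psi_linear i j)); apply: pinj.
    exists ((linfun (psi i j))^-1%VF); split=> [f|x].
      by rewrite -(linfunE (psi_linear i j) f) lker0_lfunK.
    have [f <-] := ex x; congr (psi i j _).
    by rewrite -(linfunE (psi_linear i j) f) lker0_lfunK.
  by exists g.
move=> f.
have key (s : tens H (homs Q Q)) :
    strX i (reg H) (Fh F (tens_hom Qh (reg H) Q s) (j (1 : X))) = tmap id (psi i j) s.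
  move: s; apply: tens_ext => [c s t|c s t|h u].
  - by rewrite !(linearP, add_lfunE, scale_lfunE).
  - by rewrite linearP.
  have e : hom_of (tens_hom Qh (reg H) Q (h \ot u)) =1
      hom_comp (tmod_hom (@rmulh K H h) (hom_of u)) d.
    move=> q; rewrite hom_compE tmod_homE [LHS]tens_homE tevE.
    by apply: eq_tlift => k q0; rewrite [rmulh _ _]rmulhE.
  rewrite /Fh (fhom_ext e) F_comp strXE str_nat.
  transitivity (tmap (@rmul K H h) (fun x => x * psi i j u) (coact (1 : X))).
    rewrite -[in RHS](i_z0 jK) -dE strXE.
    rewrite !tmap_comp; try by [exact: linearP | apply: rmul_linear |
      move=> ? ? ? | move=> c x y; rewrite mulrDl -scalerAl].
    by apply: eq_tmap => x; rewrite /= ?[X in X = _]rmulhE // -[fhom F _ x]/(Fh F u x) (i_Fh iK jK).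
  rewrite coact1 !tmap_lin //; try by [exact: psi_linear | apply: rmul_linear |
    move=> c x y; rewrite mulrDl -scalerAl].
  by rewrite /rmul !mul1r.
rewrite -key /=.
have e : hom_of (tens_hom Qh (reg H) Q (endo_coact (f : endo Qh))) =1
    hom_comp d (hom_of f).
  by move=> q; rewrite hom_compE [LHS]tens_homE endo_coactE.
by rewrite /Fh (fhom_ext e) F_comp dE.
Qed.

(** * Gradings and their projections *)

(** A grading given by its projections, which makes membership in sums of
    components an equation ([gp_eq], [gp_filt]). *)
Record grproj (K : fieldType) (V : vectType K) (gr : nat -> {vspace V})
    (N : nat) (pr : nat -> 'End(V)) : Prop := Grproj {
  gp_in : forall k v, pr k v \in gr k;
  gp_id : forall k l v, v \in gr k -> pr l v = if l == k then v else 0;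
  gp_sum : forall v, v = \sum_(k < N) pr k v
}.

Section Grproj.
Variable K : fieldType.

(** The components beyond the bound [N] of [gr_full] vanish by directness. *)
Lemma grading_grproj (A : falgType K) (gr : nat -> {vspace A}) :
  is_grading gr -> exists N pr, grproj gr N pr.
Proof.
move=> G; have [N Nf] := gr_full G; pose e := esym Nf.
pose pr k : 'End(A) := if insub k is Some i then sumv_pi_for e (i : 'I_N) else 0.
have pri (i : 'I_N) : pr i = sumv_pi_for e i by rewrite /pr valK.
have prn k v : (N <= k)%N -> pr k v = 0.
  by move=> Nk; rewrite /pr insubN ?zero_lfunE // -leqNgt.
have prin k v : pr k v \in gr k.
  have [kN|Nk] := ltnP k N; last by rewrite prn ?mem0v.
  by rewrite (pri (Ordinal kN)) memv_sum_pi.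
have prsum v : v = \sum_(k < N) pr k v.
  rewrite -[LHS](sumv_pi_sum e (memvf v)); apply: eq_bigr => k _.
  by rewrite pri.
exists N, pr; split=> // k l v vk.
have [lN|lN] := ltnP l (N + k.+1); last first.
  rewrite prn; last by apply: leq_trans lN; apply: leq_addr.
  by case: eqP lN => // ->; rewrite addnS ltnNge leq_addl.
have /directv_sum_independent D := gr_direct G (N + k.+1).
have kM : (k < N + k.+1)%N by rewrite addnS ltnS leq_addl.
pose us (i : 'I_(N + k.+1)) := pr i v - (if i == Ordinal kM then v else 0).
suff : us (Ordinal lN) = 0 by move/eqP; rewrite subr_eq0 -val_eqE /= => /eqP.
apply: D => // [i _|]; rewrite /us.
  by rewrite memvB //; case: eqP => [->|]; rewrite ?mem0v.
rewrite sumrB -big_mkcond big_pred1_eq big_split_ord /= -prsum.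
by rewrite big1 ?addr0 ?subrr // => i _; rewrite prn // leq_addr.
Qed.

Variables (V : vectType K) (gr : nat -> {vspace V}) (N : nat) (pr : nat -> 'End(V)).
Hypothesis P : grproj gr N pr.

Lemma gp_eq k v : v \in gr k <-> pr k v = v.
Proof.
split=> [vk|<-]; last exact: gp_in P _ _.
by rewrite (gp_id P k vk) eqxx.
Qed.

Lemma gp_out k v : (N <= k)%N -> pr k v = 0.
Proof.
move=> Nk; rewrite [v](gp_sum P) linear_sum big1 // => i _ /=.
rewrite (gp_id P _ (gp_in P i v)); case: eqP => // e.
by have := ltn_ord i; rewrite -e ltnNge Nk.
Qed.

Lemma gp_sumM M v : (N <= M)%N -> v = \sum_(k < M) pr k v.
Proof.
move=> NM; rewrite {1}[v](gp_sum P) (big_ord_widen_cond _ xpredT (fun k => pr k v) NM).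
rewrite big_mkcond; apply: eq_bigr => k _; case: ltnP => //= Nk.
by rewrite gp_out.
Qed.

Lemma gp_filt n v : v \in (\sum_(k < n) gr k)%VS <-> forall k, (n <= k)%N -> pr k v = 0.
Proof.
split=> [/memv_sumP[w wU ->] k nk|v0].
  rewrite linear_sum big1 // => i _ /=; rewrite (gp_id P _ (wU i isT)).
  by case: eqP => // e; have := ltn_ord i; rewrite -e ltnNge nk.
have := gp_sumM v (leq_addr n N); rewrite addnC big_split_ord /= => ->.
rewrite [X in _ + X]big1 ?addr0; last by move=> i _; rewrite v0 // leq_addr.
by apply: memv_sumr => k _; apply: gp_in P _ _.
Qed.

Lemma gp_direct n : directv (\sum_(k < n) gr k).
Proof.
apply/directv_sum_independent => us Uu u0 i _.
have := congr1 (pr i) u0; rewrite linear0 linear_sum (bigD1 i) //= big1 ?addr0.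
  by move=> <-; apply/esym/gp_eq/Uu.
move=> j; rewrite (gp_id P _ (Uu j isT)) eq_sym -val_eqE /=.
by case: eqP.
Qed.

Lemma gp_full : (\sum_(k < N) gr k)%VS = fullv.
Proof.
apply/vspaceP => v; rewrite memvf [v](gp_sum P).
by apply: memv_sumr => k _; apply: gp_in P _ _.
Qed.

Lemma gp_ext (W : vectType K) (f g : V -> W) : linear f -> linear g ->
  (forall k v, v \in gr k -> f v = g v) -> f =1 g.
Proof.
move=> fl gl e v; rewrite [v](gp_sum P) (lin_sum fl) (lin_sum gl).
by apply: eq_bigr => k _; apply: (e k); apply: gp_in P _ _.
Qed.

End Grproj.

(** * The grading of a bosonization *)

Section BosGrading.
Variables (K : fieldType) (H0 H : hopfAlg K) (V : ydmod H0).
Variables (R : nicholsAlg V) (phi : bosonization H R).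
Notation HH := (bos_gr phi).
Notation bos := (bos_map phi).

Lemma bos_grP n x : reflect (exists2 t, t \in tensv (ngr R n) fullv & x = bos t)
  (x \in HH n).
Proof.
apply: (iffP idP) => [/memv_imgP[t tR ->]|[t tR ->]]; first by exists t; rewrite ?lfunE.
by rewrite -lfunE memv_img.
Qed.

Lemma bos_mem n r h : r \in ngr R n -> bos (r \ot h) \in HH n.
Proof. by move=> rn; apply/bos_grP; exists (r \ot h); rewrite ?pure_memt ?memvf. Qed.

Lemma bos_grproj : exists N h, grproj HH N h.
Proof.
have [N [pr P]] := grading_grproj (ngrP R).
have [bi biK bK] := bos_bij phi.
have bil : linear bi by move=> c x y; apply: (can_inj biK); rewrite linearP /= !bK.
pose h k : 'End(H) := linfun (fun x => bos (tmap (pr k) id (bi x))).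
have hE k x : h k x = bos (tmap (pr k) id (bi x)).
  by rewrite linfunE // => c y z; rewrite bil !linearP.
exists N, h; split=> [k x|k l x|x].
- rewrite hE; apply/bos_grP; eexists; last by [].
  by apply: tmap_memt => u; rewrite ?memvf // (gp_in P).
- case/bos_grP=> t tk ->; rewrite hE biK.
  transitivity (bos (if l == k then t else 0)); last by case: eqP => // _; rewrite linear0.
  congr (bos _); case: eqP => [->|/eqP lk].
    apply: (tensv_eq (f := tmap (pr k) id) (g := idfun) _ tk) => r a rk _.
    by rewrite /= tmap_lin ?(gp_eq P k r).1 // => c y z; rewrite linearP.
  apply: (tensv_eq (f := tmap (pr l) id) (g := \0) _ tk) => r a rk _.
  rewrite /= tmap_lin ?(gp_id P _ rk) ?(negPf lk) //; last exact: linearP.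
  by rewrite (lin_zero (pure_linear_l a)).
transitivity (\sum_(k < N) bos (tmap (pr k) id (bi x))); last by apply: eq_bigr => k _; rewrite hE.
rewrite -linear_sum -{1}[x]bK; congr (bos _).
move: (bi x); apply: tens_ext => [//||r a].
  move=> c s t; rewrite scaler_sumr -big_split; apply: eq_bigr => k _; exact: linearP.
rewrite {1}[r](gp_sum P) (lin_sum (pure_linear_l a)); apply: eq_bigr => k _.
by rewrite tmap_lin //; apply: linearP.
Qed.

Lemma bos_grM m n x y : x \in HH m -> y \in HH n -> x * y \in HH (m + n)%N.
Proof.
case/bos_grP=> t tm ->; case/bos_grP=> s sn ->.
move: tm; apply: (tensv_sub (f := fun t => bos t * bos s)) => [c u v|r h rm _].
  by rewrite linearP mulrDl -scalerAl.
move: sn; apply: (tensv_sub (f := fun s => bos (r \ot h) * bos s)) => [c u v|r' k rn _].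
  by rewrite linearP mulrDr -scalerAr.
rewrite bosM; apply: tlift_mem => h1 h2; apply: bos_mem.
by apply: (grM (ngrP R)) => //; apply: ngr_act.
Qed.

Lemma bos_incl0 h : bos_incl phi h \in HH 0.
Proof. by apply: bos_mem; rewrite ngr0 memv_line. Qed.

Lemma bos_gr_comul n x : x \in HH n ->
  comul x \in (\sum_(k < n.+1) tensv (HH k) (HH (n - k)%N))%VS.
Proof.
case/bos_grP=> t tn ->; move: tn.
apply: (tensv_sub (f := comul \o bos)) => [c u v|r h rn _].
  by rewrite /= !linearP.
rewrite /= bos_comul.
have B1 h1 h2 r1 : bilin (fun (x : H0) (r20 : R) =>
    bos (r1 \ot (x * h1)) \ot bos (r20 \ot h2)).
  split=> [y|y] c s u; first by rewrite pure_linear_l !linearP.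
  by rewrite mulrDl -scalerAl !linearP pure_linear_l.
pose b r1 r2 := \swd_(h1 \ot h2 <- comul h) \swd_(y \ot r20 <- bh_coact r2)
  (bos (r1 \ot (y * h1)) \ot bos (r20 \ot h2)).
have bb : bilin b.
  split=> y c s u; rewrite /b -tliftZ -tliftD; apply: eq_tlift => h1 h2.
    by rewrite !linearP.
  rewrite -tliftZ -tliftD; apply: eq_tlift => z r20.
  by rewrite pure_linear_l linearP pure_linear_l.
have := ngr_comul rn.
apply: (sumv_mem (Us := fun k => tensv (ngr R k) (ngr R (n - k)%N))
  (Ws := fun k => tensv (HH k) (HH (n - k)%N)) (f := tlift b)).
  exact: linearP.
move=> k u _; apply: tensv_sub; first exact: linearP.
move=> r1 r2 r1k r2k; rewrite tliftE //; apply: tlift_mem => h1 h2.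
have := ngr_coact r2k; apply: tensv_sub; first exact: linearP.
by move=> y r20 _ r20k; rewrite tliftE // pure_memt ?bos_mem.
Qed.

End BosGrading.

Section BosProjections.
Variables (K : fieldType) (H0 H : hopfAlg K) (V : ydmod H0).
Variables (R : nicholsAlg V) (phi : bosonization H R).
Variables (Nh : nat) (prH : nat -> 'End(H)) (Ph : grproj (bos_gr phi) Nh prH).
Notation HH := (bos_gr phi).
Notation incl := (bos_incl phi).

(** Multiplication by an element of degree zero preserves degrees. *)
Lemma prH_mul0r m x k : prH m (x * incl k) = prH m x * incl k.
Proof.
move: x; apply: (gp_ext Ph) => [c x y|c x y|n x xn].
- by rewrite mulrDl -scalerAl linearP.
- by rewrite linearP mulrDl -scalerAl.
have := bos_grM xn (bos_incl0 phi k); rewrite addn0 => xkn.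
by rewrite (gp_id Ph _ xn) (gp_id Ph _ xkn); case: eqP; rewrite ?mul0r.
Qed.

Lemma prH_mul0l m x k : prH m (incl k * x) = incl k * prH m x.
Proof.
move: x; apply: (gp_ext Ph) => [c x y|c x y|n x xn].
- by rewrite mulrDr -scalerAr linearP.
- by rewrite linearP mulrDr -scalerAr.
have := bos_grM (bos_incl0 phi k) xn; rewrite add0n => xkn.
by rewrite (gp_id Ph _ xn) (gp_id Ph _ xkn); case: eqP; rewrite ?mulr0.
Qed.

(** Form in which [bos_gr_comul] is used: components of the wrong total degree
    vanish. *)
Lemma comul_pr i j n x : x \in HH n -> (i + j)%N != n -> tmap (prH i) (prH j) (comul x) = 0.
Proof.
move=> xn ij; have := bos_gr_comul xn.
apply: (sumv_eq (Us := fun k => tensv (HH k) (HH (n - k)%N))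
  (f := tmap (prH i) (prH j)) (g := \0)); linear_side.
move=> k u kn uk.
apply: (tensv_eq (f := tmap (prH i) (prH j)) (g := \0) _ uk) => y z yk zk.
rewrite /= tmap_lin; linear_side.
rewrite (gp_id Ph _ yk) (gp_id Ph _ zk).
case: eqP => [ik|_]; last by rewrite (lin_zero (pure_linear_l _)).
case: eqP => [jk|_]; last by rewrite linear0.
by case/eqP: ij; rewrite ik jk subnKC.
Qed.

End BosProjections.

(** * Cofree Hopf modules and Hopf submodules *)

Section Cofree.
Variables (K : fieldType) (H : hopfAlg K) (A : comodAlg H) (N : lmod A).
Hypothesis Nnz : exists n : N, n != 0.

Definition cofree : lmod A := tmod (reg H) N.

(** The Hopf module [H (x) N] with diagonal action and the comultiplication of
    [H] as coaction. *)
Definition cofree_coact (t : cofree) : tens H cofree := tassoc (tmap comul id t).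

Fact cofree_coact_linear : linear cofree_coact.
Proof. by move=> c s t; rewrite /cofree_coact !linearP. Qed.
HB.instance Definition _ :=
  GRing.isLinear.Build K cofree (tens H cofree) _ cofree_coact cofree_coact_linear.

Lemma cofree_coactE h n :
  cofree_coact (h \ot n) = tassoc (comul h \ot n).
Proof. by rewrite /cofree_coact tmap_lin //; apply: linearP. Qed.

Lemma tassoc_comul_assoc (W : vectType K) (t : tens H W) :
  tassoc (tmap comul id (tassoc (tmap comul id t))) =
  tmap id (fun s => tassoc (tmap comul id s)) (tassoc (tmap comul id t)).
Proof.
move: t; apply: tens_ext => [c s t|c s t|h n].
- by rewrite !linearP.
- by rewrite !linearP.
rewrite tmap_lin //; last exact: linearP.
have l1 : linear (fun s : tens H W => tassoc (tmap comul id s)).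
  by move=> c s u; rewrite !linearP.
pose T (s : tens H (tens H H)) : tens H (tens H (tens H W)) :=
  \swd_(x \ot yz <- s) (x \ot tassoc (yz \ot n)).
have Tb : bilin (fun x (yz : tens H H) => x \ot tassoc (yz \ot n)).
  by split=> u c s v; rewrite ?pure_linear_l ?linearP // pure_linear_l !linearP.
transitivity (T (tassoc (tmap comul id (comul h)))).
  elim/tens_ind: (comul h) => [x y|s t IHs IHt]; last first.
    by rewrite pureDl !linearD /= IHs IHt /T !linearD.
  rewrite tassocE !tmap_lin //; try exact: linearP.
  elim/tens_ind: (comul x) => [x1 x2|s t IHs IHt]; last first.
    by rewrite !pureDl !linearD /= IHs IHt /T -linearD -linearD -pureDl.
  by rewrite !tassocE /T tliftE // tassocE.
rewrite comulA; elim/tens_ind: (comul h) => [x y|s t IHs IHt]; last first.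
  by rewrite pureDl !linearD /= -IHs -IHt /T !linearD.
rewrite tassocE !tmap_lin //; try exact: linearP.
by rewrite /T tliftE.
Qed.

Fact cofree_coactP : is_coaction cofree_coact.
Proof.
split=> t; first exact: tassoc_comul_assoc.
move: t; apply: tens_ext => [c s t|//|h n]; first by rewrite !linearP.
rewrite cofree_coactE.
transitivity ((\swd_(x \ot y <- comul h) (counit x *: y)) \ot n); last by rewrite counitl.
elim/tens_ind: (comul h) => [x y|s t IHs IHt]; last first.
  by rewrite pureDl !linearD /= IHs IHt -pureDl.
rewrite tassocE tliftE; last exact: counit_bilin.
rewrite tliftE; last exact: counit_bilin.
by rewrite pureZl.
Qed.

Fact cofree_act a (t : cofree) : cofree_coact (lact a t) =
  lact a (cofree_coact t : tmod (reg H) cofree).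
Proof.
pose f := hom_comp (tmod_assoc (reg H) (reg H) N) (tmod_hom (comulh H) (hom_id N)).
have fE s : f s = cofree_coact s.
  rewrite hom_compE tmod_assocE tmod_homE; congr (tassoc _).
  by apply: eq_tmap => x; rewrite ?hom_idE //= lfunE.
by rewrite -!fE homP.
Qed.

Fact cofree_nz : exists t : cofree, t != 0.
Proof.
have [n n0] := Nnz; exists (1 \ot n); apply: contraNneq n0 => e.
have b : bilin (fun (h : H) (m : N) => counit h *: m).
  exact: counit_bilin.
have := tliftE 1 n b; rewrite e linear0 counit1 scale1r => <-.
by [].
Qed.

Definition cofreeHM : hopfMod A := HopfMod cofree_coactP cofree_act cofree_nz.

End Cofree.

Section SubHM.
Variables (K : fieldType) (H : hopfAlg K) (A : comodAlg H) (M : hopfMod A).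
Variable U : {vspace M}.
Hypothesis UA : forall a u, u \in U -> lact a u \in U.
Hypothesis UH : forall u, u \in U -> hco u \in tensv fullv U.
Hypothesis Unz : exists2 u, u \in U & u != 0.
Notation S := (subvs_of U).

Definition sub_act (a : A) (u : S) : S := vsproj U (lact a (vsval u)).

Lemma sub_actE a u : vsval (sub_act a u) = lact a (vsval u).
Proof. by rewrite vsprojK // UA // subvsP. Qed.

Fact sub_actP : is_action sub_act.
Proof.
split=> [|u|a b u].
- split=> [a|u] c s t; apply: subvs_inj; rewrite sub_actE !linearP /= !sub_actE //.
  by rewrite lact_linear_l.
- by apply: subvs_inj; rewrite sub_actE act1 //; apply: lactP.
by apply: subvs_inj; rewrite !sub_actE actM //; apply: lactP.
Qed.
Definition sub_lmod : lmod A := Lmod sub_actP.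

Definition sub_coact (u : sub_lmod) : tens H sub_lmod :=
  tmap id (vsproj U) (hco (vsval u)).

Fact sub_coact_linear : linear sub_coact.
Proof. by move=> c s t; rewrite /sub_coact !linearP. Qed.
HB.instance Definition _ :=
  GRing.isLinear.Build K sub_lmod (tens H sub_lmod) _ sub_coact sub_coact_linear.

Lemma sub_coactE u : tmap id vsval (sub_coact u) = hco (vsval u).
Proof.
rewrite /sub_coact tmap_comp; linear_side.
apply: (tensv_eq (f := tmap _ _) (g := idfun) _ (UH (subvsP u))) => h m _ mU.
by rewrite /= tmap_lin /= ?vsprojK // => ? ? ?; rewrite !linearP.
Qed.

Lemma tmap_id_can (W W' : vectType K) (f : {linear W -> W'}) (g : {linear W' -> W}) :
  cancel f g -> cancel (tmap (id : H -> H) f) (tmap id g).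
Proof. by move=> fK; apply: tmap_can => //; exact: linearP. Qed.

Let vK : cancel (vsval : S -> M) (vsproj U). Proof. exact: vsvalK. Qed.

Fact sub_coactP : is_coaction sub_coact.
Proof.
split=> u.
  apply: (can_inj (tmap_id_can (tmap_id_can vK))).
  transitivity (tassoc (tmap comul id (hco (vsval u)))).
    rewrite -sub_coactE; move: (sub_coact u); apply: tens_ext => [c s t|c s t|h s].
    - by rewrite !linearP.
    - by rewrite !linearP.
    rewrite !tmap_lin //; linear_side.
    elim/tens_ind: (comul h) => [x y|s1 t IHs IHt]; last first.
      by rewrite !pureDl !linearD /= IHs IHt.
    by rewrite !tassocE !tmap_lin //=; try exact: linearP; rewrite tmap_lin.
  rewrite (coactA (hcoP M)) -sub_coactE !tmap_comp; linear_side.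
  by apply: eq_tmap => // s; rewrite /= sub_coactE.
apply: subvs_inj; rewrite (linear_tlift (vsval : {linear S -> M})).
rewrite -[RHS](coact_counit (hcoP M)) -sub_coactE tlift_tmap; last first.
  exact: counit_bilin.
by apply: eq_tlift => h s; rewrite linearZ.
Qed.

Fact sub_hco_act a (u : sub_lmod) : sub_coact (lact a u) =
  lact a (sub_coact u : tmod (reg H) sub_lmod).
Proof.
apply: (can_inj (tmap_id_can vK)); rewrite sub_coactE sub_actE hco_act -sub_coactE.
move: (sub_coact u); apply: tens_ext => [c s t|c s t|h s].
- by rewrite !linearP.
- by rewrite !linearP.
rewrite tmap_lin //; rewrite [LHS]tactE [X in tmap _ _ X]tactE linear_tlift.
apply: eq_tlift => k x /=.
by rewrite tmap_lin // -sub_actE.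
Qed.

Fact sub_nz : exists u : sub_lmod, u != 0.
Proof.
have [u uU u0] := Unz; exists (vsproj U u); apply: contraNneq u0 => e.
by rewrite -(vsprojK uU) e linear0.
Qed.

Definition subHM : hopfMod A := HopfMod sub_coactP sub_hco_act sub_nz.

End SubHM.

Section RegHM.
Variables (K : fieldType) (H : hopfAlg K) (A : comodAlg H).

Fact reg_hco_act (a : A) (b : reg A) : (coact : reg A -> tens H (reg A)) (lact a b) =
  lact a (coact (b : A) : tmod (reg H) (reg A)).
Proof. by rewrite /= coactM. Qed.

Fact reg_nz : exists a : reg A, a != 0.
Proof. by exists (1 : A); apply: oner_neq0. Qed.

Definition regHM : hopfMod A := HopfMod (hm := reg A) (coactP A) reg_hco_act reg_nz.

End RegHM.

(** * The induced module of a Loewy-graded comodule algebra *)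

Section Loewy.
Variables (K : fieldType) (H0 H : hopfAlg K) (V : ydmod H0).
Variables (R : nicholsAlg V) (phi : bosonization H R).
Variables (A : comodAlg H) (gr : nat -> {vspace A}) (LA : is_Loewy_graded phi gr).
Variables (Nh : nat) (prH : nat -> 'End(H)) (Ph : grproj (bos_gr phi) Nh prH).
Variables (Na : nat) (prA : nat -> 'End(A)) (PA : grproj gr Na prA).
Notation HH := (bos_gr phi).
Notation A0 := (deg0 LA).
Notation incl := (bos_incl phi).

(** A projection of algebras, as the grading is by natural numbers. *)
Definition deg0_part (a : A) : A0 := vsproj (deg0_aspace LA) (prA 0 a).

Lemma deg0_part_linear : linear deg0_part.
Proof. by move=> c x y; rewrite /deg0_part !linearP. Qed.
HB.instance Definition _ := GRing.isLinear.Build K A A0 _ deg0_part deg0_part_linear.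

Lemma val_deg0_part a : vsval (deg0_part a : subvs_of (deg0_aspace LA)) = prA 0 a.
Proof. by rewrite vsprojK // (gp_in PA). Qed.

Lemma deg0_part_eq0 n a : a \in gr n -> n <> 0%N -> deg0_part a = 0.
Proof.
move=> an n0; rewrite /deg0_part (gp_id PA _ an); case: eqP => [e|_]; last by rewrite linear0.
by case: n0; rewrite -e.
Qed.

Lemma deg0_partK u : deg0_part (vsval (u : subvs_of (deg0_aspace LA))) = u.
Proof. by rewrite /deg0_part (gp_eq PA 0 _).1 ?vsvalK //; apply: subvsP. Qed.

Lemma deg0_partM a b : deg0_part (a * b) = deg0_part a * deg0_part b.
Proof.
move: b; apply: (gp_ext PA) => [c x y|c x y|n b bn].
- by rewrite mulrDr -scalerAr linearP.
- by rewrite linearP mulrDr -scalerAr.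
move: a; apply: (gp_ext PA) => [c x y|c x y|m a am].
- by rewrite mulrDl -scalerAl linearP.
- by rewrite linearP mulrDl -scalerAl.
have abmn := grM (lgr_grading LA) am bn.
have [/eqP|mn0] := eqVneq (m + n)%N 0%N; last first.
  rewrite (deg0_part_eq0 abmn) //; last exact/eqP.
  have [m0|m0] := eqVneq m 0%N; last by rewrite (deg0_part_eq0 am) ?mul0r //; apply/eqP.
  by rewrite (deg0_part_eq0 bn) ?mulr0 //; move: mn0; rewrite m0 => /eqP.
rewrite addn_eq0 => /andP[/eqP m0 /eqP n0]; move: am bn abmn; rewrite m0 n0 => am bn abn.
by apply: subvs_inj; rewrite [RHS]/= !val_deg0_part !(gp_eq PA 0 _).1.
Qed.

Lemma deg0_part1 : deg0_part 1 = 1.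
Proof.
have v1 : vsval (1 : subvs_of (deg0_aspace LA)) = 1.
  by apply/eqP; rewrite algid_eq1; apply: (gr1 (lgr_grading LA)).
by rewrite -v1 deg0_partK.
Qed.

(** The comodule algebra map [A -> H (x) A0] that embeds [A]. *)
Definition kappa (a : A) : tens H A0 := tmap id deg0_part (coact a).

Lemma kappa_linear : linear kappa.
Proof. by move=> c x y; rewrite /kappa !linearP. Qed.

(** The coaction has components [H(k) (x) gr(n - k)] in degree [n], of which the
    projection to degree zero keeps only [k = n]. *)
Lemma coact_deg0_part m n a : a \in gr n ->
  tmap (prH m) deg0_part (coact a) = (m == n)%:R *: kappa a.
Proof.
move=> an; have := lgr_coact LA an; rewrite /kappa.
pose g : {linear tens H A -> tens H A0} := (m == n)%:R \*: tmap id deg0_part.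
apply: (sumv_eq (Us := fun k => tensv (HH k) (gr (n - k)%N))
  (f := tmap (prH m) deg0_part) (g := g)); try exact: linearP.
move=> k u kn uk.
apply: (tensv_eq (f := tmap (prH m) deg0_part) (g := g) _ uk) => x b xk bk.
rewrite /g /= !tmap_lin //; try exact: linearP.
have [nk0|nk0] := eqVneq (n - k)%N 0%N; last first.
  by rewrite (deg0_part_eq0 bk) ?linear0 ?scaler0 //; apply/eqP.
have <- : k = n by apply/eqP; rewrite eqn_leq -ltnS kn -subn_eq0 nk0.
rewrite (gp_id Ph _ xk); case: eqP => _; first by rewrite scale1r.
by rewrite scale0r (lin_zero (pure_linear_l _)).
Qed.

Lemma kappa_pr m a : kappa (prA m a) = tmap (prH m) deg0_part (coact a).
Proof.
move: a; apply: (gp_ext PA) => [c x y|c x y|n a an].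
- by rewrite linearP kappa_linear.
- by rewrite !linearP.
rewrite (coact_deg0_part _ an) (gp_id PA _ an); case: eqP => _; first by rewrite scale1r.
by rewrite scale0r (lin_zero kappa_linear).
Qed.

Lemma coact_top n a : a \in gr n ->
  tmap (prH n) id (coact a) = tmap id (vsval : subvs_of (deg0_aspace LA) -> A) (kappa a).
Proof.
move=> an; rewrite /kappa tmap_comp; linear_side.
have := lgr_coact LA an.
apply: (sumv_eq (Us := fun k => tensv (HH k) (gr (n - k)%N))
  (f := tmap (prH n) id) (g := tmap (id \o id) (vsval \o deg0_part)));
  try exact: linearP.
move=> k u kn uk.
apply: (tensv_eq (f := tmap (prH n) id)
  (g := tmap (id \o id) (vsval \o deg0_part)) _ uk) => x b xk bk.
rewrite /= tmap_lin //; try exact: linearP.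
rewrite tmap_lin //; last by move=> c y z; rewrite /= !linearP.
rewrite /= val_deg0_part (gp_id Ph _ xk).
case: eqP => [nk|/eqP nk].
  move: bk; rewrite nk subnn => b0; by rewrite (gp_eq PA 0 _).1.
rewrite (lin_zero (pure_linear_l _)) (gp_id PA _ bk).
case: eqP => [e|_]; last by rewrite linear0.
by case/eqP: nk; apply/eqP; rewrite eqn_leq -subn_eq0 -e eqxx /= -ltnS.
Qed.

(** For [a] of degree [n], the component of the coaction in [H(n)] is carried by
    [kappa a] ([coact_top]).  If it vanishes, the coaction has values in lower
    degree of [H], so that [a] has degree less than [n] by the Loewy condition. *)
Lemma kappa_inj a : kappa a = 0 -> a = 0.
Proof.
move=> k0; rewrite [a](gp_sum PA) big1 // => n _.
have kn0 : kappa (prA n a) = 0.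
  rewrite kappa_pr; have := congr1 (tmap (prH n) id) k0.
  by rewrite linear0 /kappa tmap_comp //; exact: linearP.
have an := gp_in PA n a; move: (prA n a) kn0 an; move: (n : nat) => {k0}n b kb bn.
have c0 : tmap (prH n) id (coact b) = 0 by rewrite (coact_top bn) kb linear0.
have top t : t \in tensv (HH n) (gr 0%N) -> tmap (prH n) id t = t.
  move=> tn; apply: (tensv_eq (f := tmap (prH n) id) (g := idfun) _ tn) => x y xn _.
  by rewrite /= tmap_lin // ?(gp_eq Ph n x).1 //; exact: linearP.
have /memv_sumP[w wU cb] := lgr_coact LA bn.
have wn0 : w ord_max = 0.
  have wn := wU ord_max isT; rewrite /= subnn in wn.
  rewrite -(top _ wn) -[RHS]c0 cb linear_sum (bigD1 ord_max) //= big1 ?addr0 // => k kn.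
  apply: (tensv_eq (f := tmap (prH n) id) (g := \0) _ (wU k isT)) => x y xk _.
  rewrite /= tmap_lin //; last exact: linearP.
  rewrite (gp_id Ph _ xk); case: eqP => [e|_]; last by rewrite (lin_zero (pure_linear_l _)).
  by case/eqP: kn; apply: val_inj.
rewrite big_ord_recr /= wn0 addr0 in cb.
case: n w wU cb bn c0 top wn0 => [|n] w wU cb bn c0 top wn0.
  by rewrite -(coact_counit (coactP A) b) cb big_ord0 linear0.
have : b \in (\sum_(k < n.+1) gr k)%VS.
  apply/(lgr_filt LA); rewrite cb; apply: memv_suml => k _.
  have := wU (widen_ord (leqnSn _) k) isT; apply/subvP; apply: tensvS (subvf _).
  by rewrite /bos_filt; apply: (sumv_sup k).
by move/(gp_filt PA); move/(_ n.+1 (leqnn _)); rewrite (gp_eq PA _ _).1.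
Qed.


Section InducedModule.
Variable Q : hopfMod A0.

Fact pull_actP : is_action (fun (a : A) (q : Q) => lact (deg0_part a) q).
Proof.
split=> [|q|a b q].
- by split=> [a|q] c s t; rewrite linearP // lact_linear_l.
- by rewrite deg0_part1 act1 //; apply: lactP.
by rewrite deg0_partM actM //; apply: lactP.
Qed.
(** [Q] as an [A]-module through the projection of [A] to degree zero. *)
Definition pull : lmod A := Lmod pull_actP.

Definition HQ : hopfMod A := @cofreeHM _ _ _ pull (hm_neq0 Q).

(** The coaction of [Q] with [H0] embedded in [H]; it is linear over degree
    zero, injective, and its image is where the induced module starts. *)
Definition delta (q : Q) : HQ := tmap incl id (hco q).

Lemma delta_linear : linear delta.
Proof. by move=> c x y; rewrite /delta !linearP. Qed.
HB.instance Definition _ := GRing.isLinear.Build K Q HQ _ delta delta_linear.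

Lemma HQ_pair_linear (t : HQ) :
  bilin (fun (x : H) (u : A0) => tmap (@lact _ _ (reg H) x) (@lact _ _ Q u) t).
Proof.
rewrite /tmap; split=> z c s u; rewrite -tliftZ -tliftD; apply: eq_tlift => w v.
  by rewrite lact_linear_l linearP.
by rewrite lact_linear_l pure_linear_l.
Qed.

Lemma HQ_act (a : A) (t : HQ) : lact a t =
  \swd_(x \ot u <- kappa a) tmap (@lact _ _ (reg H) x) (@lact _ _ Q u) t.
Proof.
by rewrite /kappa tlift_tmap //; exact: HQ_pair_linear.
Qed.

Lemma delta_act (u : A0) q : delta (lact u q) =
  lact (vsval (u : subvs_of (deg0_aspace LA))) (delta q).
Proof.
rewrite HQ_act /kappa -deg0_coactE tmap_comp; try exact: linearP.
rewrite tlift_tmap; last exact: HQ_pair_linear.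
rewrite /delta hco_act linear_tlift; apply: eq_tlift => x v.
rewrite /= deg0_partK !tmap_comp; try by [exact: linearP | apply: lact_linear | move=> ? ? ?].
- by apply: eq_tmap => // y; rewrite /= bos_inclM.
- by move=> c s t; rewrite mulrDr -scalerAr.
- by [].
Qed.

Lemma delta_coact q : hco (delta q) = tmap incl delta (hco q).
Proof.
transitivity (tassoc (tmap (tmap incl incl) id (tmap comul id (hco q)))).
  rewrite /= /cofree_coact /delta !tmap_comp; linear_side.
  by congr (tassoc _); apply: eq_tmap => // x; rewrite /= bos_incl_comul.
transitivity (tmap incl (tmap incl id) (tassoc (tmap comul id (hco q)))).
  elim/tens_ind: (tmap comul id (hco q)) => [s y|s t IHs IHt]; last first.
    by rewrite !linearD /= IHs IHt.
  elim/tens_ind: s => [x z|s t IHs IHt]; last first.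
    by rewrite !pureDl !linearD /= IHs IHt.
  by rewrite tmap_lin // ?tmap_lin ?tassocE ?tmap_lin ?tmap_lin //; exact: linearP.
rewrite (coactA (hcoP Q)) tmap_comp; try exact: linearP.
by apply: eq_tmap.
Qed.

Lemma delta_counit q : \swd_(x \ot y <- delta q) (counit x *: y) = q.
Proof.
rewrite /delta tlift_tmap; last first.
  exact: counit_bilin.
rewrite -[RHS](coact_counit (hcoP Q)); apply: eq_tlift => x y.
by rewrite bos_incl_counit.
Qed.

Lemma delta_inj : injective delta.
Proof. by move=> q r e; rewrite -(delta_counit q) e delta_counit. Qed.

Definition prHQ n (t : HQ) : HQ := tmap (prH n) id t.

Lemma prHQ_linear n : linear (prHQ n).
Proof. by move=> c s t; rewrite /prHQ !linearP. Qed.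
HB.instance Definition _ n := GRing.isLinear.Build K HQ HQ _ (prHQ n) (prHQ_linear n).

(** The grading that [H (x) Q] gets from [H] is compatible on [A . delta(Q)]
    with that of [A]. *)
Lemma prHQ_delta n a q : prHQ n (lact a (delta q)) = lact (prA n a) (delta q).
Proof.
rewrite !HQ_act kappa_pr /delta; move: (hco q).
have l k : linear (fun s : tens H0 Q => \swd_(x \ot u <- k)
    tmap (@lact _ _ (reg H) x) (@lact _ _ Q u) (tmap incl id s) : tens H Q).
  by apply: tlift_lin => x u c s t; rewrite !linearP.
apply: tens_ext => [c s t|c s t|k r]; rewrite ?l //; first exact: linearP.
rewrite tmap_lin //; last exact: linearP.
have B : bilin (fun (x : H) (u : A0) =>
    tmap (@lact _ _ (reg H) x) (@lact _ _ Q u) (incl k \ot r)).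
  exact: HQ_pair_linear.
rewrite /kappa /prHQ linear_tlift !tlift_tmap //; last first.
  split=> [x|u] c s t; first by rewrite (B.1 x) linearP.
  by rewrite (B.2 u) linearP.
apply: eq_tlift => x b /=.
have ml y : linear ( *%R y : H -> H) by move=> c s t; rewrite mulrDr -scalerAr.
rewrite !tmap_lin //; try by [exact: linearP | apply: lact_linear].
by rewrite /= (prH_mul0r Ph).
Qed.

Definition Qgen (t : tens A Q) : HQ := \swd_(a \ot q <- t) lact a (delta q).

Lemma Qgen_linear : linear Qgen.
Proof. by move=> c s t; rewrite /Qgen linearP. Qed.

(** The submodule [A . delta(Q)] of [H (x) Q], a model of [A (x)_A0 Q]. *)
Definition Qhat : {vspace HQ} := limg (linfun Qgen).

Lemma Qgen_bilin : bilin (fun (a : A) (q : Q) => lact a (delta q)).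
Proof. by split=> z c s t; rewrite ?lact_linear_l // !linearP. Qed.

Lemma Qhat_gen a q : lact a (delta q) \in Qhat.
Proof.
rewrite -(tliftE a q Qgen_bilin) -[tlift _ _]/(Qgen _) -(linfunE Qgen_linear).
exact: memv_img (memvf _).
Qed.

Lemma Qhat_eq (W : vectType K) (f g : HQ -> W) : linear f -> linear g ->
  (forall a q, f (lact a (delta q)) = g (lact a (delta q))) -> {in Qhat, f =1 g}.
Proof.
move=> fl gl e t /memv_imgP[s _ ->]; rewrite (linfunE Qgen_linear).
rewrite /Qgen !lin_tlift //; exact: eq_tlift.
Qed.

Lemma Qhat_sub (W : vectType K) (f : HQ -> W) (W1 : {vspace W}) t : linear f ->
  (forall a q, f (lact a (delta q)) \in W1) -> t \in Qhat -> f t \in W1.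
Proof.
move=> fl fW /memv_imgP[s _ ->]; rewrite (linfunE Qgen_linear).
by rewrite /Qgen lin_tlift //; apply: tlift_mem.
Qed.

Lemma Qhat_act a t : t \in Qhat -> lact a t \in Qhat.
Proof.
apply: (Qhat_sub (f := lact a)) => [|b q]; first exact: lact_linear.
by rewrite -actM ?Qhat_gen //; apply: lactP.
Qed.

Lemma Qhat_pr n t : t \in Qhat -> prHQ n t \in Qhat.
Proof.
apply: (Qhat_sub (f := prHQ n)) => [|b q]; first exact: prHQ_linear.
by rewrite prHQ_delta Qhat_gen.
Qed.

Lemma Qhat_coact t : t \in Qhat -> hco t \in tensv fullv Qhat.
Proof.
apply: (Qhat_sub (f := hco)) => [|b q]; first exact: linearP.
rewrite hco_act delta_coact; apply: tlift_mem => x c.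
rewrite tmap_comp; try exact: lact_linear.
by apply: tmap_memt => y; rewrite ?memvf //= Qhat_gen.
Qed.

Lemma Qhat_delta q : delta q \in Qhat.
Proof. by rewrite -[delta q](act1 (lactP HQ)) Qhat_gen. Qed.

Lemma Qhat_nz : exists2 t, t \in Qhat & t != 0.
Proof.
have [q q0] := hm_neq0 Q; exists (delta q); first exact: Qhat_delta.
apply: contraNneq q0 => e; apply/eqP; apply: delta_inj.
by rewrite e linear0.
Qed.

Definition ind : hopfMod A := subHM Qhat_act Qhat_coact Qhat_nz.

End InducedModule.

Section InducedHom.
Variables (M N : hopfMod A0).

Fact pull_hom_subproof (g : homs M N) (a : A) (m : pull M) :
  (hfun g : 'Hom(pull M, pull N)) (lact a m) =
  lact a ((hfun g : 'Hom(pull M, pull N)) m).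
Proof. exact: (hfunP g (deg0_part a) m). Qed.
Definition pull_hom (g : homs M N) : lmod_hom (pull M) (pull N) :=
  LmodHom (@pull_hom_subproof g).

(** For [t] corresponding to [u : M -> N] this is the extension of [u] to
    [H (x) M]: right multiplication on [H] commutes with the action of [A]. *)
Definition fhat0 (t : tens H0 (homs M N)) (s : HQ M) : HQ N :=
  tlift (fun (k : H0) (g : homs M N) =>
    tmap (rmul (incl k : H)) (hfun g) (s : tens H M) : tens H N) t.

Lemma fhat0_linear t : linear (fhat0 t).
Proof. by apply: tlift_lin => x g c s s'; rewrite linearP. Qed.

Lemma fhat0_act t a s : fhat0 t (lact a s) = lact a (fhat0 t s).
Proof.
rewrite /fhat0 [RHS]linear_tlift; apply: eq_tlift => k g.
have := homP (tmod_hom (rmulh (incl k : H)) (pull_hom g)) a s.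
rewrite !tmod_homE; congr (_ = lact a _).
  by apply: eq_tmap => // x; rewrite rmulhE.
by apply: eq_tmap => // x; rewrite rmulhE.
Qed.

Lemma fhat0_incl (t : tens (reg H0) (homs M N)) (s : tens H0 M) :
  fhat0 t (tmap incl id s) = tmap incl id
    (\swd_(x \ot m <- s) tmap (@lact _ _ (reg H0) x) (fun g : homs M N => hfun g m) t).
Proof.
move: t; apply: tens_ext => [c t t'|c t t'|k g].
- by rewrite /fhat0 linearP.
- by rewrite -linearP -tliftZ -tliftD; congr (tmap _ _ _); apply: eq_tlift => x m; rewrite linearP.
have B : bilin (fun (k : H0) (g : homs M N) =>
    tmap (rmul (incl k : H)) (hfun g) (tmap incl id s) : tens H N).
  split=> [y|y] c u v; rewrite /tmap -tliftZ -tliftD; apply: eq_tlift => x m.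
    by rewrite hfunD hfunZ linearP.
  by rewrite /rmul linearP mulrDr -scalerAr pure_linear_l.
rewrite /fhat0 tliftE // tmap_comp; try by [exact: linearP | exact: rmul_linear].
rewrite linear_tlift; apply: eq_tlift => x m /=.
rewrite tmap_lin; [|by move=> c u v; rewrite mulrDr -scalerAr | exact: hfun_lin].
rewrite tmap_lin //; last exact: linearP.
by rewrite /rmul -bos_inclM.
Qed.

Definition fhat (u : homs M N) : HQ M -> HQ N :=
  fhat0 (hom_tens M (reg H0) N (hpost (hcoh N) u)).

Lemma fhat_linear u : linear (fhat u).
Proof. exact: fhat0_linear. Qed.

Lemma fhat_act u a s : fhat u (lact a s) = lact a (fhat u s).
Proof. exact: fhat0_act. Qed.

(** Functoriality of induction: the extension of [u] restricts to [u] along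
    [delta]. *)
Lemma fhat_delta u m : fhat u (delta m) = delta (hfun u m).
Proof.
rewrite /fhat fhat0_incl -[\swd_(x \ot m0 <- hco m) _]/(tev _ m) tev_hom_tens.
by rewrite hpostE /= lfunE.
Qed.

Lemma fhat_Qhat u s : s \in Qhat M -> fhat u s \in Qhat N.
Proof.
apply: Qhat_sub; first exact: fhat_linear.
by move=> a q; rewrite fhat_act fhat_delta Qhat_gen.
Qed.

End InducedHom.

(** Induction sends the regular module of [A0] to the image of [kappa], that is,
    to the regular module of [A]. *)
Lemma kappaM a b : kappa (a * b) = lact a (kappa b : HQ (regHM A0)).
Proof.
rewrite HQ_act [in RHS]/kappa tlift_tmap; last first.
  exact: (HQ_pair_linear (Q := regHM A0) (tmap id deg0_part (coact b))).
rewrite /kappa coactM linear_tlift; apply: eq_tlift => x a'.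
have ml (B : falgType K) (y : B) : linear ( *%R y : B -> B).
  by move=> c s t; rewrite mulrDr -scalerAr.
rewrite tmap_comp; [|exact: lact_linear | exact: (@lact_linear _ _ (reg A0))].
rewrite linear_tlift; apply: eq_tlift => y b' /=.
by rewrite tmap_lin //; [rewrite deg0_partM | exact: linearP].
Qed.

Lemma delta_reg (u : A0) :
  delta (u : regHM A0) = kappa (vsval (u : subvs_of (deg0_aspace LA))).
Proof.
rewrite /kappa -deg0_coactE tmap_comp; linear_side.
by apply: eq_tmap => // v; rewrite /= deg0_partK.
Qed.

Definition unkappa : 'Hom(HQ (regHM A0), A) :=
  ((linfun (kappa : A -> HQ (regHM A0)))^-1)%VF.

Lemma kappaK a : unkappa (kappa a) = a.
Proof.
have k0 : lker (linfun (kappa : A -> HQ (regHM A0))) == 0%VS.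
  rewrite -subv0; apply/subvP => b; rewrite memv_ker linfunE; last exact: kappa_linear.
  by move=> /eqP /kappa_inj ->; rewrite mem0v.
rewrite -[kappa a](linfunE kappa_linear); exact: lker0_lfunK.
Qed.

Lemma Qhat_reg t : t \in Qhat (regHM A0) -> kappa (unkappa t) = t.
Proof.
apply: (Qhat_eq (f := kappa \o unkappa) (g := id)) => // [c x y|a u].
  by rewrite /= linearP kappa_linear.
rewrite -[LHS]/(kappa (unkappa (lact a (delta u)))) delta_reg -kappaM kappaK.
done.
Qed.

Section Progenerator.
Variable Q : hopfMod A0.

(** A map [Q -> A0] induces a map from the induced module to [A]. *)
Definition ind_dual (u : homs Q (reg A0)) (x : ind Q) : A :=
  unkappa (fhat (u : homs Q (regHM A0)) (vsval x)).

Lemma ind_dual_linear u : linear (ind_dual u).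
Proof. by move=> c x y; rewrite /ind_dual linearP fhat_linear linearP. Qed.

Lemma ind_dual_gen u a q (x : ind Q) : vsval x = lact a (delta q) ->
  ind_dual u x = a * vsval (hfun u q : subvs_of (deg0_aspace LA)).
Proof.
move=> e; rewrite /ind_dual e fhat_act fhat_delta delta_reg -kappaM; exact: kappaK.
Qed.

Lemma ind_dual_act u a x : ind_dual u (lact a x) = a * ind_dual u x.
Proof.
rewrite /ind_dual [vsval _]sub_actE; last exact: Qhat_act.
rewrite fhat_act -{1}(Qhat_reg (fhat_Qhat (N := regHM A0) u (subvsP x))) -kappaM; exact: kappaK.
Qed.

Definition ind_homs u : homs (ind Q) (reg A) :=
  mkhom (linfun (ind_dual u : ind Q -> reg A)).

Lemma ind_homsE u x : hfun (ind_homs u) x = ind_dual u x.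
Proof. by rewrite mkhomE //; [exact: ind_dual_linear | exact: ind_dual_act]. Qed.

Definition ind_delta (q : Q) : ind Q := vsproj (Qhat Q) (delta q).

Lemma ind_deltaE q : vsval (ind_delta q) = delta q.
Proof. by rewrite vsprojK // Qhat_delta. Qed.

(** Dual bases of [Q] extend along [delta], since the induced module is
    generated by [delta(Q)]. *)
Lemma ind_progenerator : progenerator Q -> progenerator (ind Q).
Proof.
move=> [[n [v [s vs]]] [n' [v' [s' vs']]]]; split.
  exists n, (fun j => ind_homs (v j)), (fun j => ind_delta (s j)) => x.
  apply: subvs_inj; rewrite linear_sum /=.
  transitivity (\sum_j lact (unkappa (fhat (v j : homs Q (regHM A0)) (vsval x))) (delta (s j))).
    apply: eq_bigr => j _; rewrite ind_homsE [vsval _]sub_actE; last exact: Qhat_act.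
    by rewrite ind_deltaE.
  pose f t := \sum_j lact (unkappa (fhat (v j : homs Q (regHM A0)) t)) (delta (s j)).
  apply: (Qhat_eq (f := f) (g := id) _ _ _ (subvsP x)) => // [c y z|a q]; rewrite /f.
    rewrite scaler_sumr -big_split; apply: eq_bigr => j _ /=.
    by rewrite fhat_linear [unkappa _]linearP; exact: (lact_linear_l (M := HQ Q)).
  transitivity (lact a (delta (\sum_j lact (hfun (v j) q) (s j)))); last by rewrite vs.
  rewrite [X in _ = lact a X]linear_sum [RHS]linear_sum; apply: eq_bigr => j _.
  rewrite fhat_act fhat_delta delta_reg -kappaM kappaK actM; last exact: lactP.
  by rewrite -delta_act.
exists n', (fun j => ind_homs (v' j)), (fun j => ind_delta (s' j)).
have v1 : vsval (1 : subvs_of (deg0_aspace LA)) = 1.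
  by apply/eqP; rewrite algid_eq1; apply: (gr1 (lgr_grading LA)).
rewrite -v1 -vs' linear_sum; apply: eq_bigr => j _ /=.
rewrite ind_homsE (ind_dual_gen _ (a := 1) (q := s' j)) ?mul1r //.
by rewrite ind_deltaE act1 //; apply: lactP.
Qed.

End Progenerator.

(** * The grading of the endomorphisms of the induced module *)

Section InducedGrading.
Variable Q : hopfMod A0.
Notation IQ := (ind Q).
Notation B := (endo_comod IQ).

Lemma val_ind_gen a (q : Q) : vsval (lact a (ind_delta q) : IQ) = lact a (delta q).
Proof. by rewrite [vsval _]sub_actE ?ind_deltaE //; apply: Qhat_act. Qed.

Lemma ind_delta_linear : linear (@ind_delta Q).
Proof. by move=> c x y; rewrite /ind_delta !linearP. Qed.
HB.instance Definition _ := GRing.isLinear.Build K Q IQ _ (@ind_delta Q) ind_delta_linear.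

Lemma ind_ext (W : vectType K) (f g : IQ -> W) : linear f -> linear g ->
  (forall a q, f (lact a (ind_delta q)) = g (lact a (ind_delta q))) -> f =1 g.
Proof.
move=> fl gl e x; rewrite -(vsvalK x).
apply: (Qhat_eq (f := f \o vsproj (Qhat Q)) (g := g \o vsproj (Qhat Q)) _ _ _ (subvsP x)).
- by move=> c y z; rewrite /= linearP fl.
- by move=> c y z; rewrite /= linearP gl.
by move=> a q; have := e a q; rewrite -(vsvalK (lact a (ind_delta q))) val_ind_gen.
Qed.

Lemma homs_ind_ext (N : lmod A) (f g : homs IQ N) :
  (forall q, hfun f (ind_delta q) = hfun g (ind_delta q)) -> f = g.
Proof.
move=> e; apply: homs_eq; apply: ind_ext; try exact: linearP.
by move=> a q; rewrite !hfunP e.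
Qed.

Definition prInd n (x : IQ) : IQ := vsproj (Qhat Q) (prHQ n (vsval x)).

Lemma prInd_linear n : linear (prInd n).
Proof. by move=> c x y; rewrite /prInd !linearP. Qed.
HB.instance Definition _ n := GRing.isLinear.Build K IQ IQ _ (prInd n) (prInd_linear n).

Lemma val_prInd n x : vsval (prInd n x) = prHQ n (vsval x).
Proof. by rewrite vsprojK // Qhat_pr // subvsP. Qed.

Lemma prInd_gen n a q : prInd n (lact a (ind_delta q)) = lact (prA n a) (ind_delta q).
Proof. by apply: subvs_inj; rewrite val_prInd !val_ind_gen prHQ_delta. Qed.

Lemma prInd_prInd m n x : prInd m (prInd n x) = if m == n then prInd n x else 0.
Proof.
pose g : {linear IQ -> IQ} := (m == n)%:R \*: prInd n.
have -> : (if m == n then prInd n x else 0) = g x.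
  by rewrite /g /=; case: eqP => _; rewrite ?scale1r ?scale0r.
move: x; apply: ind_ext => [c x y||a q]; [by rewrite !linearP|exact: linearP|].
rewrite /g /= !prInd_gen (gp_id PA _ (gp_in PA n a)).
by case: eqP => _; rewrite ?scale1r // scale0r (lin_zero (lact_linear_l _)).
Qed.

Lemma prInd_sum x : x = \sum_(n < Na) prInd n x.
Proof.
move: x; apply: ind_ext => [//|c x y|a q].
  by rewrite scaler_sumr -big_split; apply: eq_bigr => n _; rewrite linearP.
rewrite {1}[a](gp_sum PA) (lin_sum (lact_linear_l _)); apply: eq_bigr => n _.
by rewrite prInd_gen.
Qed.

Lemma prInd_out n x : (Na <= n)%N -> prInd n x = 0.
Proof.
move=> Nn; rewrite -[0]/((\0 : IQ -> IQ) x); move: x; apply: ind_ext => [||a q].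
- exact: linearP.
- exact: linearP.
by rewrite prInd_gen (gp_out PA _ Nn) (lin_zero (lact_linear_l _)).
Qed.

Lemma prA_mul m n a b : a \in gr m -> prA (m + n) (a * b) = a * prA n b.
Proof.
move=> am; move: b; apply: (gp_ext PA) => [c x y|c x y|k b bk].
- by rewrite mulrDr -scalerAr linearP.
- by rewrite linearP mulrDr -scalerAr.
rewrite (gp_id PA _ (grM (lgr_grading LA) am bk)) (gp_id PA _ bk) eqn_add2l.
by case: eqP => _; rewrite ?mulr0.
Qed.

Lemma prInd_act m n a x : a \in gr m -> prInd (m + n) (lact a x) = lact a (prInd n x).
Proof.
move=> am; move: x; apply: ind_ext => [c x y|c x y|b q].
- by rewrite !linearP.
- by rewrite !linearP.
rewrite -actM; last exact: lactP.
by rewrite !prInd_gen prA_mul // actM //; apply: lactP.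
Qed.

Lemma prInd_delta q : prInd 0 (ind_delta q) = ind_delta q.
Proof.
rewrite -{1}[ind_delta q](act1 (lactP IQ)) prInd_gen (gp_eq PA 0 1).1.
  by rewrite act1 //; apply: lactP.
exact: gr1 (lgr_grading LA).
Qed.

(** The degree [k] part of [f]: on elements of degree [n] it is the component of
    degree [n + k] of [f]. *)
Definition degE0 k (f : homs IQ IQ) (x : IQ) : IQ :=
  \sum_(n < Na) prInd (n + k) (hfun f (prInd n x)).

Lemma degE0_linear k f : linear (degE0 k f).
Proof.
move=> c x y; rewrite /degE0 scaler_sumr -big_split; apply: eq_bigr => n _ /=.
by rewrite !linearP.
Qed.

Lemma degE0_hom k f n x : prInd n x = x -> degE0 k f x = prInd (n + k) (hfun f x).
Proof.
move=> xn; have [nN|Nn] := ltnP n Na; last first.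
  by rewrite -xn prInd_out // (lin_zero (degE0_linear k f)) !linear0.
rewrite /degE0 (bigD1 (Ordinal nN)) //= xn big1 ?addr0 // => m mn.
by rewrite -xn prInd_prInd; move: mn; rewrite -val_eqE /= => /negPf->; rewrite !linear0.
Qed.

(** On homogeneous arguments both sides are components of [a f(x)] of the same
    degree. *)
Lemma degE0_act k f a x : degE0 k f (lact a x) = lact a (degE0 k f x).
Proof.
rewrite {1}[x]prInd_sum [X in _ = lact a X](congr1 (degE0 k f) (prInd_sum x)).
rewrite linear_sum !(lin_sum (degE0_linear k f)) linear_sum.
apply: eq_bigr => n _.
rewrite -[LHS]/(degE0 k f (lact a (prInd n x))) -[RHS]/(lact a (degE0 k f (prInd n x))).
have : prInd n (prInd n x) = prInd n x by rewrite prInd_prInd eqxx.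
move: (prInd n x) => {}x xn.
move: a; apply: (gp_ext PA) => [c a b|c a b|m a am].
- by rewrite lact_linear_l degE0_linear.
- by rewrite lact_linear_l.
rewrite (@degE0_hom k f (m + n)); last by rewrite prInd_act // xn.
by rewrite (degE0_hom _ _ xn) hfunP -addnA prInd_act.
Qed.

Definition degE1 k (f : homs IQ IQ) : homs IQ IQ := mkhom (linfun (degE0 k f)).

Lemma degE1E k f x : hfun (degE1 k f) x = degE0 k f x.
Proof. by rewrite mkhomE //; [exact: degE0_linear | exact: degE0_act]. Qed.

Lemma degE1_linear k : linear (degE1 k).
Proof.
move=> c f g; apply: homs_eq => x; rewrite hfunD hfunZ !degE1E /degE0.
rewrite scaler_sumr -big_split; apply: eq_bigr => n _ /=.
by rewrite -[LHS]/(prInd (n + k) (hfun (c *: f + g) (prInd n x))) hfunD hfunZ linearP.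
Qed.

Definition degE k : 'End(B) := linfun (degE1 k : B -> B).

Lemma degE_hom k (f : B) n x : prInd n x = x ->
  hfun (degE k f : homs IQ IQ) x = prInd (n + k) (hfun (f : homs IQ IQ) x).
Proof. by move=> xn; rewrite linfunE ?degE1E ?(degE0_hom _ _ xn) //; exact: degE1_linear. Qed.

Lemma degE_delta k (f : B) q :
  hfun (degE k f : homs IQ IQ) (ind_delta q) = prInd k (hfun (f : homs IQ IQ) (ind_delta q)).
Proof. by rewrite (degE_hom _ _ (prInd_delta q)). Qed.

Definition endo_gr k : {vspace B} := limg (degE k).

Lemma degE_degE k l f : degE l (degE k f) = if l == k then degE k f else 0.
Proof.
apply: (@homs_ind_ext IQ) => q; rewrite !degE_delta prInd_prInd.
by case: eqP => _; rewrite ?degE_delta // (lin_zero (hfun_lin _)).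
Qed.

Lemma endo_grproj : grproj endo_gr Na degE.
Proof.
split=> [k f|k l f|f].
- by rewrite memv_img ?memvf.
- by case/memv_imgP=> g _ ->; rewrite degE_degE.
apply: (@homs_ind_ext IQ) => q; rewrite hfun_sum [LHS]prInd_sum.
by apply: eq_bigr => k _; rewrite degE_delta.
Qed.

(** For multiplicativity: [f] of degree [m] sends [delta(q)] to degree [m], where
    an endomorphism of degree [n] acts with values in degree [m + n]. *)
Lemma endo_grading : is_grading endo_gr.
Proof.
split; last 2 first.
- exact: gp_direct endo_grproj.
- by exists Na; exact: gp_full endo_grproj.
- apply/(gp_eq endo_grproj); apply: (@homs_ind_ext IQ) => q.
  by rewrite degE_delta !hone prInd_delta.
move=> m n f g /(gp_eq endo_grproj) fm /(gp_eq endo_grproj) gn.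
apply/(gp_eq endo_grproj); apply: (@homs_ind_ext IQ) => q.
rewrite degE_delta !hmulE.
have fq : prInd m (hfun (f : homs IQ IQ) (ind_delta q)) = hfun (f : homs IQ IQ) (ind_delta q).
  by rewrite -degE_delta fm.
by rewrite -(degE_hom _ _ fq) gn.
Qed.


Lemma ind_delta_coact q : hco (ind_delta q) = tmap incl (fun r : Q => ind_delta r) (hco q).
Proof.
apply: (can_inj (tmap_id_can (vsvalK (U := Qhat Q)))).
rewrite [LHS]sub_coactE; last exact: Qhat_coact.
rewrite ind_deltaE delta_coact tmap_comp; linear_side.
- by apply: eq_tmap => // r; rewrite /= ind_deltaE.
Qed.

Lemma hco_prInd i j n x : (i + j)%N != n ->
  tmap (prH i) (prInd j) (hco (prInd n x)) = 0.
Proof.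
move=> ij; apply: (can_inj (tmap_id_can (vsvalK (U := Qhat Q)))); rewrite linear0.
transitivity (tmap (prH i) (fun s : HQ Q => prHQ j s) (hco (prHQ n (vsval x)))).
  rewrite -val_prInd -(sub_coactE (@Qhat_coact Q)) !tmap_comp; linear_side.
  by apply: eq_tmap => y; rewrite /= ?val_prInd.
rewrite /= /cofree_coact /prHQ; elim/tens_ind: (vsval x) => [y q|s t IHs IHt]; last first.
  by rewrite !linearD /= IHs IHt addr0.
rewrite (tmap_lin (f := prH n)) ?(tmap_lin (f := comul)) //; linear_side.
have yn := gp_in Ph n y; move: (prH n y) yn => {}y yn.
transitivity (tassoc (tmap (prH i) (prH j) (comul y) \ot q)); last first.
  by rewrite (comul_pr Ph yn ij) (lin_zero (pure_linear_l _)) linear0.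
elim/tens_ind: (comul y) => [u v|s t IHs IHt]; last first.
  by rewrite pureDl !linearD /= IHs IHt pureDl linearD.
by rewrite tassocE tmap_lin ?tmap_lin ?tmap_lin ?tassocE //; exact: linearP.
Qed.

(** The counit recovers the [H]-degree of an element from its coaction. *)
Lemma hco_top i (t : HQ Q) : prHQ i t =
  tmap (prH i) (tlift (fun (x : H) (q : Q) => counit x *: q)) (hco t).
Proof.
rewrite /= /cofree_coact /prHQ; move: t; apply: tens_ext => [c s t|c s t|y q].
- by rewrite !linearP.
- by rewrite !linearP.
rewrite (tmap_lin (f := comul)) //; last exact: linearP.
have b (W : vectType K) : bilin (fun (x : H) (w : W) => counit x *: w).
  exact: counit_bilin.
rewrite tmap_lin //; last exact: linearP.
rewrite -{1}[y]counitr.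
elim/tens_ind: (comul y) => [u v|s t IHs IHt]; last first.
  by rewrite pureDl !linearD /= pureDl IHs IHt.
rewrite tassocE tmap_lin; linear_side.
rewrite !tliftE //; last first.
  by split=> [w|w] c s t; rewrite ?linearP //= scalerDl scalerA.
by rewrite linearZ pureZl linearZ.
Qed.

(** On [delta(Q)] the twist is by elements of degree zero in [H], so taking
    components commutes with the evaluation of [H (x) B] at these elements. *)
Lemma tev_deg i (u : homs IQ IQ -> homs IQ IQ) (v : IQ -> IQ)
    (t : tens (reg H) (homs IQ IQ)) q :
  linear u -> linear v ->
  (forall g r, hfun (u g) (ind_delta r) = v (hfun g (ind_delta r))) ->
  tev (tmap (prH i) u t : tens (reg H) (homs IQ IQ)) (ind_delta q) =
  tmap (prH i) v (tev t (ind_delta q)).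
Proof.
move=> ul vl uv; move: t; apply: tens_ext => [c s t|c s t|y g].
- by rewrite linearP tev_lin_l.
- by rewrite tev_lin_l linearP.
rewrite tmap_lin //; last exact: linearP.
have b (y' : H) (g' : homs IQ IQ) :
    bilin (fun (x : H) (z : IQ) => @lact _ _ (reg H) x y' \ot hfun g' z).
  exact: tev_pure_bilin.
rewrite !tevE ind_delta_coact !tlift_tmap // linear_tlift.
apply: eq_tlift => x r /=; rewrite uv tmap_lin //; last exact: linearP.
by rewrite (prH_mul0l Ph).
Qed.

Lemma tev_ind_eq0 (t : tens (reg H) (homs IQ IQ)) :
  (forall q, tev t (ind_delta q) = 0) -> t = 0.
Proof.
move=> t0; apply: tev_inj; apply: ind_ext; try exact: tev_lin.
move=> a q; rewrite !tev_act t0.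
by rewrite (lin_zero (tev_lin_l _)).
Qed.

Lemma endo_coact_deg i j n (f : B) : degE n f = f -> (i + j)%N != n ->
  tmap (prH i) (degE j) (endo_coact f) = 0.
Proof.
move=> fn ij; apply: tev_ind_eq0 => q.
rewrite (@tev_deg i (degE j) (prInd j)); try exact: linearP; last first.
  by move=> g r; exact: degE_delta.
by rewrite endo_coactE -fn degE_delta hco_prInd.
Qed.

(** Both conditions on the coaction of [f] are tested on the elements
    [delta(q)], where [endo_coactE] and [tev_deg] turn them into conditions on
    the coaction of [f(delta(q))] in [H (x) Q]. *)
Lemma ind_Loewy : is_Loewy_graded phi (A := B) endo_gr.
Proof.
have P := endo_grproj.
have coactE (n : nat) (f : B) : f \in endo_gr n ->
    endo_coact f \in (\sum_(i < n.+1) tensv (HH i) (endo_gr (n - i)%N))%VS.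
  move=> /(gp_eq P) fn.
  have e : endo_coact f = \sum_(i < Nh) \sum_(j < Na) tmap (prH i) (degE j) (endo_coact f).
    move: (endo_coact f); apply: tens_ext => [//||x g].
      move=> c s t; rewrite scaler_sumr -big_split; apply: eq_bigr => i _ /=.
      rewrite scaler_sumr -big_split; apply: eq_bigr => j _; exact: linearP.
    rewrite {1}[x](gp_sum Ph) (lin_sum (pure_linear_l g)); apply: eq_bigr => i _.
    rewrite {1}[g](gp_sum P) linear_sum; apply: eq_bigr => j _.
    by rewrite tmap_lin //; exact: linearP.
  rewrite e; apply: memv_suml => i _; apply: memv_suml => j _.
  have [ij|ij] := eqVneq (i + j)%N n; last by rewrite (endo_coact_deg fn ij) mem0v.
  have ni : (i < n.+1)%N by rewrite ltnS -ij leq_addr.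
  apply: (subvP (sumv_sup (Ordinal ni) _ (subvv _))) => //=.
  rewrite -ij addKn; apply: tmap_memt => x; [exact: gp_in Ph _ _ | exact: gp_in P _ _].
split; [exact: endo_grading | | exact: coactE].
move=> n f; split=> [fn|/memv_sumP[w wn ->]].
  apply/(gp_filt P) => k nk; apply: (@homs_ind_ext IQ) => q.
  rewrite degE_delta (lin_zero (hfun_lin _)); apply: subvs_inj.
  rewrite val_prInd linear0 hco_top -(sub_coactE (@Qhat_coact Q)).
  rewrite -[sub_coact _]/(hco (hfun (f : homs IQ IQ) (ind_delta q))) -endo_coactE.
  have c0 : tmap (prH k) id (endo_coact f) = 0.
    apply: (tensv_eq (f := tmap (prH k) id) (g := \0) _ fn) => x g xn _.
    rewrite /= tmap_lin //; last exact: linearP.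
    by move/(gp_filt Ph): xn => ->; rewrite ?(lin_zero (pure_linear_l _)).
  have := @tev_deg k id id (endo_coact f) q.
  rewrite c0 (lin_zero (tev_lin_l _)).
  move=> /(_ (fun c x y => erefl _) (fun c x y => erefl _) (fun g r => erefl _)) e0.
  have := congr1 (tmap id (tlift (fun (x : H) (r : Q) => counit x *: r) \o vsval)) e0.
  rewrite linear0 tmap_comp; try by [exact: linearP | move=> c x y; rewrite /= ?linearP].
  move=> e1; rewrite tmap_comp; linear_side.
  by rewrite [RHS]e1.
rewrite linear_sum; apply: memv_suml => k _.
have := coactE k (w k) (wn k isT); apply: subvP; apply/subv_sumP => i _.
apply: tensvS (subvf _); rewrite /bos_filt.
by apply: (sumv_sup (widen_ord (ltn_ord k) i)).
Qed.


Notation LB := ind_Loewy.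

(** Contraction with the counit of [H], a left inverse of [ind_delta]. *)
Definition ind_counit (x : IQ) : Q := tlift (fun (z : H) (q : Q) => counit z *: q) (vsval x).

Lemma ind_counit_linear : linear ind_counit.
Proof. by move=> c x y; rewrite /ind_counit !linearP. Qed.
HB.instance Definition _ := GRing.isLinear.Build K IQ Q _ ind_counit ind_counit_linear.

Lemma ind_counitK q : ind_counit (ind_delta q) = q.
Proof. by rewrite /ind_counit ind_deltaE delta_counit. Qed.

Lemma ind_delta_inj : injective (@ind_delta Q).
Proof. exact: can_inj ind_counitK. Qed.

Lemma ind_delta_act (u : A0) (q : Q) :
  ind_delta (lact u q) = lact (vsval (u : subvs_of (deg0_aspace LA))) (ind_delta q).
Proof. by apply: subvs_inj; rewrite val_ind_gen ind_deltaE delta_act. Qed.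

(** On a generator [a . delta(q)] the degree zero part is [p(a) . delta(q)] for
    the projection [p] of [A] to degree zero, and this lies in [delta(Q)]. *)
Lemma prInd0 (x : IQ) : prInd 0 x = ind_delta (ind_counit (prInd 0 x)).
Proof.
move: x; apply: ind_ext => [||a q]; try by move=> c x y; rewrite !linearP.
by rewrite prInd_gen -val_deg0_part -ind_delta_act ind_counitK.
Qed.

(** Restriction to degree zero, made total by projecting first. *)
Definition deg0_res0 (f : B) (q : Q) : Q :=
  ind_counit (prInd 0 (hfun (f : homs IQ IQ) (ind_delta q))).

Lemma ind_delta_res0 f q : ind_delta (deg0_res0 f q) = hfun (degE 0 f : homs IQ IQ) (ind_delta q).
Proof. by rewrite -prInd0 degE_delta. Qed.

Lemma deg0_res0_linear f : linear (deg0_res0 f).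
Proof. by move=> c x y; rewrite /deg0_res0 !linearP. Qed.

Lemma deg0_res0_act f (u : A0) q : deg0_res0 f (lact u q) = lact u (deg0_res0 f q).
Proof. by apply: ind_delta_inj; rewrite ind_delta_res0 !ind_delta_act hfunP ind_delta_res0. Qed.

Definition deg0_res (f : B) : endo Q := mkhom (linfun (deg0_res0 f)).

Lemma deg0_resE f q : hfun (deg0_res f) q = deg0_res0 f q.
Proof. by rewrite mkhomE //; [exact: deg0_res0_linear | exact: deg0_res0_act]. Qed.

Lemma deg0_res_linear : linear deg0_res.
Proof.
move=> c f g; apply: (@homs_eq _ _ Q Q) => q; rewrite hfunD hfunZ !deg0_resE /deg0_res0.
by rewrite -linearP -linearP; congr (ind_counit (prInd 0 _)); rewrite -hfunZ -hfunD.
Qed.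
HB.instance Definition _ := GRing.isLinear.Build K B (endo Q) _ deg0_res deg0_res_linear.

Lemma ind_delta_res f q : f \in endo_gr 0 ->
  ind_delta (hfun (deg0_res f) q) = hfun (f : homs IQ IQ) (ind_delta q).
Proof. by move=> /(gp_eq endo_grproj) f0; rewrite deg0_resE ind_delta_res0 f0. Qed.

(** Extension of an endomorphism of [Q] by functoriality of induction. *)
Definition deg0_ext (e : endo Q) : B :=
  mkhom (linfun (fun x : IQ => vsproj (Qhat Q) (fhat e (vsval x)) : IQ)).

Lemma deg0_extE e x : vsval (hfun (deg0_ext e : homs IQ IQ) x) = fhat e (vsval x).
Proof.
rewrite mkhomE; first by rewrite vsprojK // fhat_Qhat // subvsP.
  by move=> c y z; rewrite linearP fhat_linear linearP.
move=> a y; apply: subvs_inj; rewrite [RHS]sub_actE; last exact: Qhat_act.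
rewrite [vsval _ in LHS]vsprojK.
  rewrite [vsval _]sub_actE; last exact: Qhat_act.
  by rewrite fhat_act vsprojK // fhat_Qhat // subvsP.
by apply: fhat_Qhat; apply: subvsP.
Qed.

Lemma deg0_ext_delta e q : hfun (deg0_ext e : homs IQ IQ) (ind_delta q) = ind_delta (hfun e q).
Proof. by apply: subvs_inj; rewrite deg0_extE !ind_deltaE fhat_delta. Qed.

Lemma deg0_ext_mem e : deg0_ext e \in endo_gr 0.
Proof.
apply/(gp_eq endo_grproj); apply: (@homs_ind_ext IQ) => q.
by rewrite degE_delta deg0_ext_delta prInd_delta.
Qed.

Lemma deg0_extK e : deg0_res (deg0_ext e) = e.
Proof.
apply: (@homs_eq _ _ Q Q) => q; apply: ind_delta_inj.
by rewrite ind_delta_res ?deg0_ext_mem // deg0_ext_delta.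
Qed.

Lemma deg0_res_inj f g : f \in endo_gr 0 -> g \in endo_gr 0 -> deg0_res f = deg0_res g -> f = g.
Proof.
move=> f0 g0 e; apply: (@homs_ind_ext IQ) => q.
by rewrite -!ind_delta_res // e.
Qed.

Lemma deg0_res1 : deg0_res 1 = 1.
Proof.
apply: (@homs_eq _ _ Q Q) => q; apply: ind_delta_inj; rewrite ind_delta_res ?hone //.
exact: gr1 endo_grading.
Qed.

Lemma deg0_resM f g : f \in endo_gr 0 -> g \in endo_gr 0 ->
  deg0_res (f * g) = deg0_res f * deg0_res g.
Proof.
move=> f0 g0; apply: (@homs_eq _ _ Q Q) => q; apply: ind_delta_inj.
have fg := grM endo_grading f0 g0; rewrite ind_delta_res // !hmulE.
by rewrite !ind_delta_res.
Qed.

Notation B0 := (deg0 LB).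
Notation BA := (deg0_aspace LB).

Lemma tev_deg0_res (t : tens H0 B0) q :
  tev (tmap incl (vsval : subvs_of BA -> B) t : tens (reg H) (homs IQ IQ)) (ind_delta q) =
  tmap incl (fun r : Q => ind_delta r)
    (tev (tmap id (fun u : B0 => deg0_res (vsval (u : subvs_of BA))) t
      : tens (reg H0) (homs Q Q)) q).
Proof.
move: t; apply: tens_ext => [c s t|c s t|k u].
- by rewrite linearP tev_lin_l.
- by rewrite linearP tev_lin_l linearP.
rewrite !tmap_lin //; try exact: linearP; last first.
  by move=> c x y; rewrite /= linearP.
rewrite !tevE ind_delta_coact tlift_tmap; last exact: tev_pure_bilin.
rewrite linear_tlift; apply: eq_tlift => x r /=.
rewrite tmap_lin; [|exact: linearP | exact: ind_delta_linear].
by rewrite bos_inclM ind_delta_res //; apply: subvsP.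
Qed.

(** Restriction and extension are inverse to each other; both the product and
    the coaction are determined by values on [delta(Q)]. *)
Theorem deg0_ind_isom : comodAlg_isom (deg0 LB) (endo_comod Q).
Proof.
apply: (@comodAlg_isomI _ _ B0 (endo_comod Q) (fun u => deg0_res (vsval (u : subvs_of BA)))).
- by move=> c x y; rewrite /= linearP.
- have -> : vsval (1 : subvs_of BA) = 1.
    by apply/eqP; rewrite algid_eq1; apply: (gr1 (lgr_grading LB)).
  exact: deg0_res1.
- by move=> u v; apply: deg0_resM; apply: subvsP.
- have k2 : cancel (fun e => vsproj BA (deg0_ext e)) (fun u => deg0_res (vsval (u : subvs_of BA))).
    by move=> e; rewrite vsprojK ?deg0_extK //; apply: deg0_ext_mem.
  exists (fun e => vsproj BA (deg0_ext e)) => // u.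
  apply: subvs_inj; apply: deg0_res_inj; try exact: subvsP.
  exact: k2.
move=> u; apply: (@tev_inj _ _ _ Q (reg H0) Q) => q.
have k : injective (tmap incl (fun r : Q => ind_delta r) : tens H0 Q -> tens H IQ).
  apply: (can_inj (g := tmap ((linfun incl)^-1)%VF ind_counit)).
  apply: tmap_can; [exact: linearP | exact: linearP | exact: bos_incl_can | exact: ind_counitK].
apply: k; rewrite -tev_deg0_res [tmap incl vsval _](deg0_coactE u).
rewrite endo_coactE -ind_delta_coact ind_delta_res; last exact: subvsP.
by rewrite -endo_coactE.
Qed.

End InducedGrading.

End Loewy.

(** * AM-exactness and the main theorem *)

Section IsomAM.
Variables (K : fieldType) (H : hopfAlg K) (A B : comodAlg H).

Lemma tensv_full_tmap (M N : vectType K) (g : M -> N) (J : {vspace M})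
    (J' : {vspace N}) (t : tens H M) : linear g ->
  (forall x, x \in J -> g x \in J') -> t \in tensv fullv J ->
  tmap id g t \in tensv fullv J'.
Proof.
move=> gl gJ /tensv_fullP tJ; apply/tensv_fullP => i.
by rewrite slice_tmap // gJ.
Qed.

Lemma AM_exact_isom : comodAlg_isom A B -> AM_exact B -> AM_exact A.
Proof.
move=> [f [[g fK gK] fC]] [simB trivB].
have gl : linear g by move=> c x y; apply: (can_inj fK); rewrite linearP /= !gK.
have gC b : coact (g b) = tmap id g (coact b).
  rewrite -{2}[b]gK fC tmap_comp; try by [exact: gl | move=> ? ? ?].
  by rewrite -[LHS]tmap_id; apply: eq_tmap => // x; rewrite /= fK.
split=> [J Jr JH|].
  have [] := simB (ahval f @: J)%VS.
  - move=> _ b /memv_imgP[x xJ ->]; rewrite -[b]gK -rmorphM memv_img //; exact: Jr.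
  - move=> _ /memv_imgP[x xJ ->]; rewrite fC; apply: tensv_full_tmap (JH x xJ).
      exact: linearP.
    by move=> y yJ; apply: memv_img.
  - move=> J0; left; apply/eqP; rewrite -subv0; apply/subvP => x xJ.
    have : ahval f x \in (ahval f @: J)%VS by apply: memv_img.
    rewrite J0 !memv0 => /eqP e; apply/eqP.
    by rewrite -[x]fK [f x]e; apply: (lin_zero gl).
  move=> Jf; right; apply/vspaceP => x; rewrite memvf.
  have : f x \in (ahval f @: J)%VS by rewrite Jf memvf.
  by move=> /memv_imgP[y yJ /(can_inj fK) ->].
rewrite /trivial_coinvariants -trivB.
have -> : coinvariants B = (ahval f @: coinvariants A)%VS.
  apply/vspaceP => b; apply/idP/memv_imgP => [/coinvariantsP bc|[a /coinvariantsP ac ->]].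
    exists (g b); last by rewrite [ahval f _]gK.
    by apply/coinvariantsP; rewrite gC bc tmap_lin.
  by apply/coinvariantsP; rewrite fC ac tmap_lin //; exact: linearP.
rewrite limg_dim_eq //; have /eqP-> : lker (ahval f) == 0%VS by apply/lker0P; exact: can_inj fK.
exact: capv0.
Qed.

End IsomAM.

Section LoewyAM.
Variables (K : fieldType) (H0 H : hopfAlg K) (V : ydmod H0).
Variables (R : nicholsAlg V) (phi : bosonization H R).
Variables (B : comodAlg H) (gr : nat -> {vspace B}) (LB : is_Loewy_graded phi gr).
Notation HH := (bos_gr phi).
Notation incl := (bos_incl phi).
Notation B0 := (deg0 LB).
Notation BA := (deg0_aspace LB).

Let filt0 x : coact x \in tensv (HH 0) fullv -> x \in gr 0%N.
Proof.
move=> xH; have := (lgr_filt LB 0 x).1; rewrite big_ord1; apply.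
by rewrite /bos_filt big_ord1.
Qed.

(** For [x] in [J], a coefficient [y] of the component of the coaction of [x] of
    top degree [n] in [H] is again in [J].  By coassociativity a component of
    positive degree [m] in the coaction of [y] would contribute degree [n + m]
    to that of [x], so that [y] is in degree zero by the Loewy condition. *)
Lemma subcomod_deg0 (J : {vspace B}) :
  (forall x, x \in J -> coact x \in tensv fullv J) -> J != 0%VS ->
  exists2 y, y \in J & (y \in gr 0%N) && (y != 0).
Proof.
move=> JH J0; have [N [prH Ph]] := bos_grproj phi.
pose x := vpick J; have xJ : x \in J := memv_pick J.
have x0 : x != 0 by rewrite vpick0.
have coact_sum (z : tens H B) : z = \sum_(k < N) tmap (prH k) id z.
  move: z; apply: tens_ext => [//|c s t|u b].
    by rewrite scaler_sumr -big_split; apply: eq_bigr => k _; exact: linearP.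
  rewrite {1}[u](gp_sum Ph) (lin_sum (pure_linear_l b)); apply: eq_bigr => k _.
  by rewrite tmap_lin //; exact: linearP.
have coact_nz : coact x != 0.
  apply: contraNneq x0 => e.
  by rewrite -(coact_counit (coactP B) x) e linear0.
(* The degrees are bounded, so there is a least strict bound. *)
have ex : exists n, [forall k : 'I_N, (n <= k)%N ==> (tmap (prH k) id (coact x) == 0)].
  by exists N; apply/forallP => k; rewrite leqNgt ltn_ord.
have [n /forallP nP nmin] := ex_minnP ex.
have top k : (n <= k)%N -> tmap (prH k) id (coact x) = 0.
  move=> nk; have [kN|Nk] := ltnP k N.
    by have := nP (Ordinal kN); rewrite /= nk => /eqP.
  transitivity (tmap (\0 : H -> H) (id : B -> B) (coact x)).
    by apply: eq_tmap => // z; rewrite (gp_out Ph).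
  rewrite -[RHS](tlift0 _ (coact x)); apply: eq_tlift => u b.
  by rewrite (lin_zero (pure_linear_l b)).
(* Now [n] is the top degree, as [n.+1] bounds the nonzero components strictly. *)
case: n nP nmin top => [|n] nP nmin top.
  case/eqP: coact_nz; rewrite [LHS]coact_sum big1 // => k _; exact: top.
have tn0 : tmap (prH n) id (coact x) != 0.
  apply/eqP => e; have := nmin n; rewrite ltnn => H1.
  suff : false by []. apply: H1; apply/forallP => k; apply/implyP.
  rewrite leq_eqVlt => /orP[/eqP <-|nk]; first by rewrite e.
  by rewrite top.
pose t := tmap (prH n) id (coact x).
have [i yi] : exists i, slice i t != 0.
  apply/existsP; apply: contraNT tn0; rewrite negb_exists => /forallP s0.
  by apply/eqP; apply: slice_inj => i; rewrite linear0; apply/eqP; rewrite -[_ == _]negbK s0.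
pose y := slice i t.
have yJ : y \in J.
  apply: (elimT (tensv_fullP J t)); move: (JH x xJ); apply: tensv_sub; first exact: linearP.
  by move=> u b _ bJ; rewrite tmap_lin //; [apply: pure_memt; rewrite ?memvf | exact: linearP].
exists y => //; rewrite yi andbT; apply: filt0.
have cy m : m != 0%N -> tmap (prH m) id (coact y) = 0.
  move=> m0.
  rewrite -(slice_tmap _ _ (linearP coact)) /t tmap_comp; linear_side.
  rewrite -(slice_tmap _ _ (linearP (tmap (prH m) id))) tmap_comp; linear_side.
  transitivity (slice i (tmap (prH n) (tmap (prH m) id) (tmap id coact (coact x)))).
    by congr (slice i _); rewrite tmap_comp; try exact: linearP.
  rewrite -(coactA (coactP B)).
  pose L (z : tens H B) := slice i (tmap (prH n) (tmap (prH m) id) (tassoc (tmap comul id z))).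
  have Ll : linear L by move=> c z z'; rewrite /L !linearP.
  rewrite -[LHS]/(L (coact x)) [coact x]coact_sum (lin_sum Ll) big1 // => k _.
  have [kn|nk] := leqP k n; last by rewrite top // (lin_zero Ll).
  rewrite /L -[RHS](linear0 (slice i)); congr (slice i _).
  have knm : (n + m)%N != k.
    by apply: contraNneq m0 => e; rewrite -e -{2}[n]addn0 leq_add2l leqn0 in kn.
  elim/tens_ind: (coact x) => [z b|s s' IHs IHs']; last first.
    by rewrite !linearD /= IHs IHs' addr0.
  rewrite !tmap_lin //; try exact: linearP.
  transitivity (tassoc (tmap (prH n) (prH m) (comul (prH k z)) \ot b)); last first.
    rewrite (comul_pr Ph (gp_in Ph k z)) //.
    by rewrite (lin_zero (pure_linear_l b)) linear0.
  elim/tens_ind: (comul (prH k z)) => [u v|s s' IHs IHs']; last first.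
    by rewrite pureDl !linearD /= IHs IHs' pureDl linearD.
  by rewrite tassocE !tmap_lin ?tassocE //; exact: linearP.
rewrite [coact y]coact_sum; apply: memv_suml => k _.
have [k0|/cy ->] := eqVneq (k : nat) 0%N; last exact: mem0v.
by rewrite k0; apply: tmap_memt => u; rewrite ?memvf // (gp_in Ph).
Qed.

(** A nonzero stable right ideal meets degree zero in a nonzero stable right
    ideal of [B0], which contains 1; a coinvariant has a coaction with values in
    degree zero of [H], so it is a coinvariant of [B0]. *)
Lemma AM_exact_deg0 : AM_exact B0 -> AM_exact B.
Proof.
move=> [simB0 trivB0]; split=> [J Jr JH|].
  have [->|Jn0] := eqVneq J 0%VS; [by left | right].
  have [y yJ /andP[y0 yn0]] := subcomod_deg0 JH Jn0.
  pose J0 : {vspace B0} := (linfun (vsval : subvs_of BA -> B) @^-1: J)%VS.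
  have J0P (u : subvs_of BA) : (u \in J0) = (vsval u \in J).
    by rewrite -memv_preim lfunE.
  have [] := simB0 J0.
  - by move=> u v; rewrite !J0P; apply: Jr.
  - move=> u; rewrite J0P => /JH uH; apply/tensv_fullP => i.
    rewrite J0P -(slice_tmap _ _ (linearP (vsval : subvs_of BA -> B))).
    apply: (elimT (tensv_fullP J _)).
    have -> : tmap id (vsval : subvs_of BA -> B) (deg0_coact u) =
        tmap ((linfun incl)^-1)%VF id (coact (vsval u)).
      rewrite -deg0_coactE tmap_comp; linear_side.
      by apply: eq_tmap => // z; rewrite /= bos_incl_can.
    move: uH; apply: tensv_sub; first exact: linearP.
    by move=> z b _ bJ; rewrite tmap_lin //; [apply: pure_memt; rewrite ?memvf | exact: linearP].
  - move=> e; have : vsproj BA y \in J0 by rewrite J0P vsprojK.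
    by rewrite e memv0 => /eqP /(congr1 vsval); rewrite vsprojK // linear0 => e0; case/eqP: yn0.
  move=> e; have : vsproj BA 1 \in J0 by rewrite e memvf.
  rewrite J0P vsprojK; last exact: gr1 (lgr_grading LB).
  move=> J1; apply/vspaceP => x; rewrite memvf.
  by rewrite -[x]mul1r Jr.
rewrite /trivial_coinvariants -trivB0.
have -> : coinvariants B = (linfun (vsval : subvs_of BA -> B) @: coinvariants B0)%VS.
  apply/vspaceP => b; apply/idP/memv_imgP => [/coinvariantsP bc|[u uI ->]].
    have b0 : b \in BA.
      apply: filt0; rewrite bc; apply: pure_memt; rewrite ?memvf //.
      by rewrite -(bos_incl1 phi) bos_incl0.
    exists (vsproj BA b); last by rewrite lfunE /= vsprojK.
    apply: (introT (@coinvariantsP _ _ B0 (vsproj BA b))).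
    apply: (can_inj (@deg0_emb_can _ _ _ _ _ _ _ _ LB)).
    rewrite [LHS]deg0_coactE vsprojK // bc tmap_lin; try exact: linearP.
    by rewrite bos_incl1 /= vsprojK.
  have uc : deg0_coact u = 1 \ot u by apply: (elimT (@coinvariantsP _ _ B0 u)).
  apply/coinvariantsP; rewrite lfunE /= -deg0_coactE uc tmap_lin; try exact: linearP.
  by rewrite bos_incl1.
rewrite limg_dim_eq //.
have /eqP-> : lker (linfun (vsval : subvs_of BA -> B)) == 0%VS.
  by apply/lker0P => u v; rewrite !lfunE; apply: subvs_inj.
exact: capv0.
Qed.

End LoewyAM.

Theorem theorem4p5 (K : closedFieldType) (charK0 : [pchar K] =i pred0)
    (H0 : hopfAlg K) (ssH0 : semisimple_alg H0)
    (V : ydmod H0) (R : nicholsAlg V)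
    (H : hopfAlg K) (phi : bosonization H R)
    (A : comodAlg H) (Agr : nat -> {vspace A})
    (LA : is_Loewy_graded phi Agr) (AMA : AM_exact A)
    (X : comodAlg H0) (AMX : AM_exact X)
    (AX : equivariant_Morita (deg0 LA) X) :
  exists (B : comodAlg H) (Bgr : nat -> {vspace B})
         (LB : is_Loewy_graded phi Bgr),
    [/\ AM_exact B, equivariant_Morita A B & comodAlg_isom (deg0 LB) X].
Proof.
have [F /Morita_progenerator[Q [Qgen QX]]] := AX.
have [Nh [prH Ph]] := bos_grproj phi.
have [Na [prA PA]] := grading_grproj (lgr_grading LA).
have BX := comodAlg_isom_trans (deg0_ind_isom Ph PA Q) QX.
exists (endo_comod (ind PA Q)), (endo_gr prH PA Q), (ind_Loewy Ph PA Q); split=> //.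
  exact: AM_exact_deg0 (AM_exact_isom BX AMX).
by apply: progenerator_Morita; exact: (ind_progenerator Ph PA Qgen).
Qed.
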